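(* For every $\delta>0$, $\kappa_0\geqslant \delta$ and $N_0>0$ there is a constant $\alpha>0$ such that the following holds. Let $G$ be a group acting $(\kappa_0,N_0)$--acylindrically by isometries on a geodesic $\delta$--hyperbolic space $X$, and let $U\subset G$ be a finite subset of displacement $\lambda_0(U)\geqslant 10^{14}\kappa_0\log_2(2|U|)$ that is not contained in an infinite virtually cyclic subgroup of $G$. Then $$|U^3|\geqslant \left(\frac{\alpha}{\log_2^6(2|U|)}|U|\right)^2,$$ and more generally, for all natural numbers $n\geqslant 1$, $$|U^n|\geqslant \left(\frac{\alpha}{\log_2^6(2|U|)}|U|\right)^{[(n+1)/2]}.$$
   Context: $X$ is a geodesic metric space with distance $|x-y|$. The Gromov product is $(p,q)_x:=\frac12(|p-x|+|q-x|-|p-q|)$; $X$ is $\delta$--hyperbolic if $(p,r)_x\geqslant\min\{(p,q)_x,(q,r)_x\}-\delta$ for all $p,q,r,x\in X$. The action of $G$ on $X$ is $(\kappa_0,N_0)$--acylindrical if for all $x,y\in X$ with $|x-y|\geqslant\kappa_0$ there are at most $N_0$ elements $g\in G$ with $|gx-x|\leqslant 100\delta$ and $|gy-y|\leqslant 100\delta$. For a finite $U\subset G$, $E(U):=\inf_{x\in X}\frac{1}{|U|}\sum_{u\in U}|ux-x|$; a point $x_0\in X$ is fixed with $\frac{1}{|U|}\sum_{u\in U}|ux_0-x_0|\leqslant E(U)+\delta$, and the displacement is $\lambda_0(U):=\max_{u\in U}|ux_0-x_0|$. $U^n$ is the set of products of $n$ elements of $U$, $[x]$ the integral part, $\log_2^6$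 the sixth power of $\log_2$. *)

(* Defs.v *)
From Stdlib Require Import Reals List ZArith.
Import ListNotations.
Open Scope R_scope.

Record Group := {
  gcar :> Type;
  gmul : gcar -> gcar -> gcar;
  gone : gcar;
  ginv : gcar -> gcar;
  gmul_assoc : forall a b c, gmul a (gmul b c) = gmul (gmul a b) c;
  gmul_1l : forall a, gmul gone a = a;
  gmul_Vl : forall a, gmul (ginv a) a = gone
}.
Arguments gmul {_}.
Arguments gone {_}.
Arguments ginv {_}.

Definition gpow_nat {G : Group} (g : G) (n : nat) : G :=
  Nat.iter n (fun h => gmul g h) gone.
Definition gpow {G : Group} (g : G) (k : Z) : G :=
  match k with
  | Z0 => gone
  | Zpos p => gpow_nat g (Pos.to_nat p)
  | Zneg p => gpow_nat (ginv g) (Pos.to_nat p)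
  end.

Definition is_subgroup {G : Group} (H : G -> Prop) : Prop :=
  H gone /\ (forall a b, H a -> H b -> H (gmul a b)) /\ (forall a, H a -> H (ginv a)).
Definition is_infinite_set {T : Type} (H : T -> Prop) : Prop :=
  ~ exists L : list T, forall x, H x -> In x L.
(* H is virtually cyclic: some cyclic subgroup <g> of H has finite index,
   i.e. H is a finite union of cosets l<g> with l in H. *)
Definition virtually_cyclic {G : Group} (H : G -> Prop) : Prop :=
  exists (g : G) (L : list G), H g /\ (forall l, In l L -> H l) /\
    forall h, H h -> exists l k, In l L /\ h = gmul l (gpow g k).
Definition not_in_infinite_virtually_cyclic {G : Group} (U : list G) : Prop :=
  ~ exists H : G -> Prop, is_subgroup H /\ is_infinite_set H /\
      virtually_cyclic H /\ (forall u, In u U -> H u).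

Definition prod_list {G : Group} (l : list G) : G := fold_right gmul gone l.
Definition Upow {G : Group} (U : list G) (n : nat) (g : G) : Prop :=
  exists l : list G, length l = n /\ (forall u, In u l -> In u U) /\ g = prod_list l.

Record MetricSpace := {
  mcar :> Type;
  dist : mcar -> mcar -> R;
  dist_ge0 : forall x y, 0 <= dist x y;
  dist_eq0 : forall x y, dist x y = 0 <-> x = y;
  dist_sym : forall x y, dist x y = dist y x;
  dist_tri : forall x y z, dist x z <= dist x y + dist y z
}.
Arguments dist {_}.

Definition geodesic_space (X : MetricSpace) : Prop :=
  forall x y : X, exists gam : R -> X, gam 0 = x /\ gam (dist x y) = y /\
    forall s t, 0 <= s <= dist x y -> 0 <= t <= dist x y ->
      dist (gam s) (gam t) = Rabs (s - t).

Definition gromov {X : MetricSpace} (p q x : X) : R :=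
  (dist p x + dist q x - dist p q) / 2.

Definition hyperbolic (X : MetricSpace) (delta : R) : Prop :=
  forall p q r x : X, gromov p r x >= Rmin (gromov p q x) (gromov q r x) - delta.

Definition isometric_action (G : Group) (X : MetricSpace) (act : G -> X -> X) : Prop :=
  (forall x, act gone x = x) /\
  (forall g h x, act (gmul g h) x = act g (act h x)) /\
  (forall g x y, dist (act g x) (act g y) = dist x y).

Definition acylindrical (G : Group) (X : MetricSpace) (act : G -> X -> X)
  (delta kappa0 : R) (N0 : nat) : Prop :=
  forall x y : X, dist x y >= kappa0 ->
    forall L : list G, NoDup L ->
      (forall g, In g L -> dist (act g x) x <= 100 * delta /\ dist (act g y) y <= 100 * delta) ->
      (length L <= N0)%nat.

Definition card {T : Type} (U : list T) : R := INR (length U).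
Definition avg_disp {G : Group} {X : MetricSpace} (act : G -> X -> X) (U : list G) (x : X) : R :=
  (fold_right Rplus 0 (map (fun u => dist (act u x) x) U)) / card U.
(* x0 satisfies avg_disp x0 <= E(U) + delta, with E(U) the infimum of avg_disp. *)
Definition quasi_center {G : Group} {X : MetricSpace} (act : G -> X -> X) (U : list G)
  (delta : R) (x0 : X) : Prop :=
  forall x : X, avg_disp act U x0 <= avg_disp act U x + delta.
Definition displacement {G : Group} {X : MetricSpace} (act : G -> X -> X) (U : list G) (x0 : X) : R :=
  fold_right Rmax 0 (map (fun u => dist (act u x0) x0) U).

Definition log2 (x : R) : R := ln x / ln 2.

Definition card_ge {T : Type} (A : T -> Prop) (b : R) : Prop :=
  exists L : list T, NoDup L /\ (forall x, In x L <-> A x) /\ INR (length L) >= b.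

(* Main.v *)
(** Writing [o] for the base point, we look for [S] inside [U] of proportional size and [b] in [U] such
    that the product of a word [s1 b s2 b ... sk] with letters in [S] determines [s1], hence the whole
    word, up to boundedly many choices.

    If a definite part of [U] moves [o] little, take [b] of maximal displacement. Otherwise almost
    all elements move [o] far, and the choice of [o] forbids most of them to have [u o] and [u^-1 o] in
    a common direction; this yields subsets [U0], [V] of [U], the elements of [V] being the longer ones,
    for which the words [u v u v ...] are broken geodesics. If [u v ...] and [u' v ...] run along one
    geodesic from [o], then [u^-1 u'] translates along [v]; when many [u] do so, [v] is periodic, with
    period [h] of short translation length. If all [v] are periodic, a common [u] is put between elements
    of [V] instead, which can only fail if [u] is periodic as well; then [u v] lies, for many [v], in one
    maximal elementary subgroup [E]. But if a coset of some such [E] contains a definite part of [U], then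
    an element of [U] outside the appropriate coset of [E], which exists because [U] is not contained in
    [E], separates ping-pong words. All losses are constants, so the powers of [log2] are not needed. *)
From Stdlib Require Import Reals List ZArith Lra Lia Psatz Classical ClassicalEpsilon Arith FinFun.
Require Import Defs.
Import ListNotations.
Open Scope R_scope.

(** No boundary at infinity and no quasi-axes are constructed. The axis of a loxodromic [h] enters
    through the predicate [online], that is, through Gromov products of far powers of [h]. It passes
    to commensurable elements with the same error, so errors do not pile up when one period is
    exchanged for another. Acylindricity is used in two ways only: to bound the number of elements
    that put two distant points at prescribed places of a geodesic ([spot]), and to show that two
    elements whose axes overlap for long commute up to a power ([commute_of_overlap]). The latter
    needs an overlap of about [2 N] periods, which is why [fineness] is a multiple of [N + 1]. The
    constants form a ladder: errors on axes are at most a few thousand [delta], periods are at least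
    [100000 kappa], letters of reduced words at least [10^8 kappa], the separator of the
    concentrated case at least [10^14 kappa]. The obstacle in the periodic case is that letters of
    very different lengths may start one and the same product; the relation [al] between consecutive
    letters is there to exclude this. *)

(** * Counting in lists with classical predicates *)

Definition sel {T : Type} (P : T -> Prop) (l : list T) : list T :=
  filter (fun x => if excluded_middle_informative (P x) then true else false) l.

Lemma in_sel {T} (P : T -> Prop) l x : In x (sel P l) <-> In x l /\ P x.
Proof.
  unfold sel; rewrite filter_In.
  destruct (excluded_middle_informative (P x)); intuition congruence.
Qed.

Lemma incl_sel {T} (P : T -> Prop) l : incl (sel P l) l.
Proof. intros x hx; apply in_sel in hx; tauto. Qed.

Lemma NoDup_sel {T} (P : T -> Prop) l : NoDup l -> NoDup (sel P l).
Proof. apply NoDup_filter. Qed.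

Lemma sel_cons {T} (P : T -> Prop) a l :
  (P a /\ sel P (a :: l) = a :: sel P l) \/ (~ P a /\ sel P (a :: l) = sel P l).
Proof. unfold sel; simpl; destruct (excluded_middle_informative (P a)); auto. Qed.

Lemma length_sel_split {T} (P : T -> Prop) l :
  length l = (length (sel P l) + length (sel (fun x => ~ P x) l))%nat.
Proof.
  induction l as [|a l IH]; [reflexivity|].
  destruct (sel_cons P a l) as [[h1 ->]|[h1 ->]];
  destruct (sel_cons (fun x => ~ P x) a l) as [[h2 ->]|[h2 ->]]; simpl; try tauto; lia.
Qed.

Lemma length_sel_mono {T} (P Q : T -> Prop) l :
  (forall x, In x l -> P x -> Q x) -> (length (sel P l) <= length (sel Q l))%nat.
Proof.
  induction l as [|a l IH]; intros h; [simpl; lia|].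
  assert (IH' : (length (sel P l) <= length (sel Q l))%nat) by (apply IH; intros; apply h; simpl; auto).
  destruct (sel_cons P a l) as [[h1 ->]|[h1 ->]];
  destruct (sel_cons Q a l) as [[h2 ->]|[h2 ->]]; simpl; try lia.
  exfalso; apply h2, h; simpl; auto.
Qed.

Lemma length_sel_le {T} (P : T -> Prop) l : (length (sel P l) <= length l)%nat.
Proof. rewrite (length_sel_split P l); lia. Qed.

Lemma length_sel_or {T} (P Q S : T -> Prop) l :
  (forall x, In x l -> P x -> Q x \/ S x) ->
  (length (sel P l) <= length (sel Q l) + length (sel S l))%nat.
Proof.
  induction l as [|a l IH]; intros h; [simpl; lia|].
  assert (IH' : (length (sel P l) <= length (sel Q l) + length (sel S l))%nat)
    by (apply IH; intros; apply h; simpl; auto).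
  pose proof (h a (or_introl eq_refl)) as ha.
  destruct (sel_cons P a l) as [[h1 ->]|[h1 ->]];
  destruct (sel_cons Q a l) as [[h2 ->]|[h2 ->]];
  destruct (sel_cons S a l) as [[h3 ->]|[h3 ->]]; simpl; try lia; tauto.
Qed.

Lemma fiber_bound {T A} (f : T -> A) (L : list T) (Q : list A) (B : nat) :
  (forall x, In x L -> In (f x) Q) ->
  (forall a, In a Q -> (length (sel (fun x => f x = a) L) <= B)%nat) ->
  (length L <= length Q * B)%nat.
Proof.
  revert L; induction Q as [|a Q IH]; intros L h1 h2.
  - destruct L as [|x L]; [simpl; lia|]. destruct (h1 x (or_introl eq_refl)).
  - rewrite (length_sel_split (fun x => f x = a) L).
    pose proof (h2 a (or_introl eq_refl)).
    assert (length (sel (fun x => f x <> a) L) <= length Q * B)%nat; [|simpl; lia].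
    apply IH.
    + intros x hx. apply in_sel in hx as [hx hn]. destruct (h1 x hx) as [e|e]; [exfalso; apply hn; symmetry; exact e|exact e].
    + intros c hc. eapply Nat.le_trans; [|apply (h2 c); simpl; auto].
      clear. induction L as [|x L IHL]; [simpl; lia|].
      destruct (sel_cons (fun x => f x <> a) x L) as [[e1 ->]|[e1 ->]];
      destruct (sel_cons (fun x => f x = c) x L) as [[e2 ->]|[e2 ->]];
      try (destruct (sel_cons (fun x => f x = c) x (sel (fun x => f x <> a) L)) as [[e3 ->]|[e3 ->]]);
      cbn [length]; try lia; tauto.
Qed.

Lemma pigeonhole {T} (f : T -> nat) (K M : nat) (l : list T) :
  (forall x, In x l -> (f x < K)%nat) ->
  (forall k, (k < K)%nat -> (length (sel (fun x => f x = k) l) <= M)%nat) ->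
  (length l <= K * M)%nat.
Proof.
  intros h1 h2. rewrite <- (length_seq K 0). apply (fiber_bound f).
  - intros x hx. apply in_seq. specialize (h1 x hx). lia.
  - intros k hk. apply in_seq in hk. apply h2. lia.
Qed.

Lemma exists_max {T} (f : T -> R) (l : list T) :
  l <> [] -> exists x, In x l /\ forall y, In y l -> f y <= f x.
Proof.
  induction l as [|a l IH]; [congruence|]; intros _.
  destruct l as [|b l].
  - exists a; split; [simpl; auto|]. intros y [->|[]]; lra.
  - destruct IH as [x [hx hm]]; [congruence|].
    destruct (Rle_dec (f a) (f x)).
    + exists x; split; [right; auto|]. intros y [->|hy]; auto.
    + exists a; split; [left; auto|]. intros y [->|hy]; [lra|]. specialize (hm y hy); lra.
Qed.

Lemma exists_min {T} (f : T -> R) (l : list T) :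
  l <> [] -> exists x, In x l /\ forall y, In y l -> f x <= f y.
Proof.
  intros h; destruct (exists_max (fun x => - f x) l h) as [x [hx hm]].
  exists x; split; auto. intros y hy; specialize (hm y hy); lra.
Qed.

(** The value taken is the least one whose sublevel set holds half of the list. Elements of median
    value count on both sides. *)
Lemma median {T} (f : T -> R) (l : list T) :
  l <> [] -> exists m, (length l <= 2 * length (sel (fun x => (f x <= m)%R) l))%nat /\
                  (length l <= 2 * length (sel (fun x => (m <= f x)%R) l))%nat.
Proof.
  intros hl.
  set (B := sel (fun x => (length l <= 2 * length (sel (fun y => (f y <= f x)%R) l))%nat) l).
  assert (hB : B <> []).
  { destruct (exists_max f l hl) as [x [hx hm]].
    assert (In x B).
    { apply in_sel; split; auto.
      rewrite (length_sel_split (fun y => f y <= f x) l) at 1.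
      assert (length (sel (fun y => ~ (f y <= f x)%R) l) = 0%nat); [|lia].
      destruct (sel (fun y => ~ f y <= f x) l) as [|z q] eqn:e; [reflexivity|].
      assert (hz : In z (z :: q)) by (simpl; auto).
      rewrite <- e in hz; apply in_sel in hz as [hz hz']. exfalso; auto. }
    intros e; rewrite e in H; destruct H. }
  destruct (exists_min f B hB) as [x [hx hm]].
  apply in_sel in hx as [hx hx2].
  exists (f x); split; auto.
  destruct (sel (fun y => f y < f x) l) as [|z0 q] eqn:e.
  - rewrite (length_sel_split (fun y => f x <= f y) l) at 1.
    assert ((length (sel (fun y => ~ (f x <= f y)%R) l) <= length (sel (fun y => (f y < f x)%R) l))%nat).
    { apply length_sel_mono; intros; lra. }
    rewrite e in H; simpl in H; lia.
  - destruct (exists_max f (sel (fun y => f y < f x) l)) as [z [hz hzm]]; [rewrite e; congruence|].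
    apply in_sel in hz as [hz hz2].
    assert (hzB : ~ In z B) by (intros hzB; specialize (hm z hzB); lra).
    assert (h3 : ~ (length l <= 2 * length (sel (fun y => (f y <= f z)%R) l))%nat)
      by (intros h; apply hzB, in_sel; auto).
    assert ((length (sel (fun y => ~ (f x <= f y)%R) l) <= length (sel (fun y => (f y <= f z)%R) l))%nat).
    { apply length_sel_mono; intros y hy hy2. apply hzm, in_sel; split; auto; lra. }
    pose proof (length_sel_split (fun y => f x <= f y) l). lia.
Qed.

(** Averaging: there are at least [length V * c] related pairs, and the [u] with the most partners
    has at least the average number. *)
Lemma double_count {A B} (Q : A -> B -> Prop) (U : list A) (V : list B) (c : nat) :
  (forall v, In v V -> (c <= length (sel (fun u => Q u v) U))%nat) -> U <> [] ->
  exists u, In u U /\ (length V * c <= length U * length (sel (Q u) V))%nat.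
Proof.
  intros h hU.
  assert (hs : (length V * c <= list_sum (map (fun u => length (sel (Q u) V)) U))%nat).
  { induction V as [|v V IH]; [simpl; lia|].
    assert (e : (list_sum (map (fun u => length (sel (Q u) (v :: V))) U) =
       length (sel (fun u => Q u v) U) + list_sum (map (fun u => length (sel (Q u) V)) U))%nat).
    { clear. induction U as [|u U IH]; [reflexivity|]. unfold list_sum in *; cbn [map fold_right].
      destruct (sel_cons (Q u) v V) as [[h1 ->]|[h1 ->]];
      destruct (sel_cons (fun u => Q u v) u U) as [[h2 ->]|[h2 ->]]; cbn [length]; try tauto; lia. }
    rewrite e. cbn [length]. pose proof (h v (or_introl eq_refl)).
    assert (length V * c <= list_sum (map (fun u => length (sel (Q u) V)) U))%nat
      by (apply IH; intros; apply h; simpl; auto). lia. }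
  destruct (exists_max (fun u => INR (length (sel (Q u) V))) U hU) as [u [hu hm]].
  exists u; split; auto.
  eapply Nat.le_trans; [exact hs|].
  clear - hm. revert hm. generalize (length (sel (Q u) V)) as m; intros m.
  induction U as [|a U IH]; intros hm; [simpl; lia|].
  simpl. pose proof (INR_le _ _ (hm a (or_introl eq_refl))).
  assert (list_sum (map (fun u => length (sel (Q u) V)) U) <= length U * m)%nat
    by (apply IH; intros; apply hm; simpl; auto). lia.
Qed.

Lemma finite_of_bounded {T} (P : T -> Prop) (K : nat) :
  (forall l, NoDup l -> (forall x, In x l -> P x) -> (length l <= K)%nat) ->
  exists L, NoDup L /\ forall x, In x L <-> P x.
Proof.
  intros h.
  assert (hh : forall n, (exists L, NoDup L /\ forall x, In x L <-> P x) \/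
     exists L, NoDup L /\ (forall x, In x L -> P x) /\ length L = n).
  { induction n as [|n [IH|[L [h1 [h2 h3]]]]].
    - right; exists []; split; [constructor|]. split; [simpl; tauto|reflexivity].
    - auto.
    - destruct (classic (forall x, P x -> In x L)) as [ha|ha].
      + left; exists L; split; auto. intros x; split; auto.
      + right. apply not_all_ex_not in ha as [x hx]. apply imply_to_and in hx as [hx hx2].
        exists (x :: L). split; [constructor; auto|]. split; [|simpl; auto].
        intros y [<-|hy]; auto. }
  destruct (hh (S K)) as [|[L [h1 [h2 h3]]]]; auto.
  specialize (h L h1 h2); lia.
Qed.

Lemma collision {T} (P : T -> Prop) (K : nat) (f : nat -> T) :
  (forall l, NoDup l -> (forall x, In x l -> P x) -> (length l <= K)%nat) ->
  (forall n, (n <= K)%nat -> P (f n)) ->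
  exists i j, (i < j)%nat /\ (j <= K)%nat /\ f i = f j.
Proof.
  intros h hf. apply NNPP; intros hn.
  assert (hl : forall n, (n <= S K)%nat -> NoDup (map f (seq 0 n))).
  { induction n as [|n IH]; intros hn2; [constructor|].
    rewrite seq_S, map_app. simpl. apply NoDup_app; [apply IH; lia| constructor; [simpl; tauto|constructor]|].
    intros x hx [<-|[]]. apply in_map_iff in hx as [i [e hi]]. apply in_seq in hi.
    apply hn; exists i, n; repeat split; auto; lia. }
  specialize (h _ (hl (S K) ltac:(lia))).
  rewrite length_map, length_seq in h.
  assert (S K <= K)%nat; [|lia]. apply h.
  intros x hx; apply in_map_iff in hx as [i [<- hi]]. apply in_seq in hi. apply hf; lia.
Qed.

(** Stands in for an infimum: as long as the conclusion fails, [f] can be lowered by more than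
    [eps], which happens only finitely often for a nonnegative [f]. *)
Lemma near_min {I : Type} (f : I -> R) (eps : R) :
  inhabited I -> 0 < eps -> (forall i, 0 <= f i) -> exists i, forall j, f i <= f j + eps.
Proof.
  intros [i0] he hf.
  assert (h : forall n i, f i <= INR n * eps -> exists i, forall j, f i <= f j + eps).
  { induction n as [|n IH]; intros i hi.
    - exists i; intros j. simpl in hi. specialize (hf j). lra.
    - destruct (classic (forall j, f i <= f j + eps)) as [|hn]; [eauto|].
      apply not_all_ex_not in hn as [j hj]. apply (IH j). rewrite S_INR in hi. lra. }
  destruct (INR_unbounded (f i0 / eps)) as [n hn].
  apply (h n i0). apply Rmult_lt_compat_r with (r := eps) in hn; auto.
  replace (f i0 / eps * eps) with (f i0) in hn by (field; lra). lra.
Qed.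

Lemma exists_nat_ge (x : R) : exists n : nat, x <= INR n.
Proof. destruct (INR_unbounded x) as [n hn]; exists n; lra. Qed.

Lemma bucket (x w : R) (K : nat) :
  0 < w -> 0 <= x -> x < INR K * w ->
  exists k : nat, (k < K)%nat /\ INR k * w <= x < INR k * w + w.
Proof.
  intros hw hx. induction K as [|K IH]; intros hK; [simpl in hK; lra|].
  destruct (Rlt_le_dec x (INR K * w)) as [h|h].
  - destruct (IH h) as [k [h1 h2]]; exists k; split; auto; lia.
  - exists K; split; [lia|]. rewrite S_INR in hK. lra.
Qed.

(** The hypothesis on [F] concerns windows at every position [t], not only those of the grid; this
    is the form in which the geometric counts are available. *)
Lemma bucket_pigeonhole {T} (f : T -> R) (c w : R) (K M : nat) (l : list T) : 0 < w -> NoDup l ->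
  (forall x, In x l -> c <= f x < c + INR K * w) ->
  (forall F t, NoDup F -> incl F l -> (forall x, In x F -> t <= f x < t + w) -> (length F <= M)%nat) ->
  (length l <= K * M)%nat.
Proof.
  intros hw hl hf hF.
  assert (hb : forall x, exists k : nat, In x l -> (k < K)%nat /\ INR k * w <= f x - c < INR k * w + w).
  { intros x. destruct (classic (In x l)) as [hi|hi]; [|exists 0%nat; tauto].
    specialize (hf x hi). destruct (bucket (f x - c) w K) as [k hk]; try lra. exists k; auto. }
  apply (pigeonhole (fun x => proj1_sig (constructive_indefinite_description _ (hb x)))).
  - intros x hi. destruct (constructive_indefinite_description _ (hb x)) as [k hk]; simpl. apply hk; auto.
  - intros k _. apply (hF _ (c + INR k * w)); [apply NoDup_sel; auto| |].
    + apply incl_sel.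
    + intros x hx. apply in_sel in hx as [hx e].
      destruct (constructive_indefinite_description _ (hb x)) as [k' hk]; simpl in e. subst k'.
      specialize (hk hx). lra.
Qed.

(* Powers and commensurability in a group *)
Declare Scope group_scope.
Delimit Scope group_scope with g.
Infix "*" := gmul : group_scope.
Notation "1" := gone : group_scope.
Notation "x ^-1" := (ginv x) (at level 3, left associativity, format "x ^-1") : group_scope.

Section GroupTheory.
Context {G : Group}.
Implicit Types a b c g h x : G.
Local Open Scope group_scope.

Lemma gmul_Vr a : a * a^-1 = 1.
Proof.
  rewrite <- (gmul_1l _ (a * a^-1)), <- (gmul_Vl _ (a^-1)) at 1.
  rewrite <- gmul_assoc, (gmul_assoc _ a^-1), gmul_Vl, gmul_1l. apply gmul_Vl.
Qed.
Lemma gmul_1r a : a * 1 = a.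
Proof. rewrite <- (gmul_Vl _ a), gmul_assoc, gmul_Vr. apply gmul_1l. Qed.
Lemma gmul_KV a b : a * (a^-1 * b) = b.
Proof. rewrite gmul_assoc, gmul_Vr. apply gmul_1l. Qed.
Lemma gmul_VK a b : a^-1 * (a * b) = b.
Proof. rewrite gmul_assoc, gmul_Vl. apply gmul_1l. Qed.
Lemma gmul_eq_l a b c : a * b = a * c -> b = c.
Proof. intros h. rewrite <- (gmul_VK a b), h. apply gmul_VK. Qed.
Lemma gmul_eq_r a b c : b * a = c * a -> b = c.
Proof.
  intros h. rewrite <- (gmul_1r b), <- (gmul_Vr a), gmul_assoc, h, <- gmul_assoc, gmul_Vr.
  apply gmul_1r.
Qed.
Lemma ginv_unique a b : a * b = 1 -> b = a^-1.
Proof. intros h; apply (gmul_eq_l a); rewrite h, gmul_Vr; reflexivity. Qed.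
Lemma ginv_inv a : a^-1^-1 = a.
Proof. symmetry; apply ginv_unique, gmul_Vl. Qed.
Lemma ginv_mul a b : (a * b)^-1 = b^-1 * a^-1.
Proof.
  symmetry; apply ginv_unique.
  rewrite <- gmul_assoc, gmul_KV. apply gmul_Vr.
Qed.
Lemma ginv_1 : @ginv G 1 = 1.
Proof. symmetry; apply ginv_unique, gmul_1l. Qed.
End GroupTheory.

#[export] Hint Rewrite @gmul_1l @gmul_1r @gmul_Vl @gmul_Vr @gmul_KV @gmul_VK @ginv_inv @ginv_mul @ginv_1 : grp.
#[export] Hint Rewrite <- @gmul_assoc : grp.
Ltac grp := autorewrite with grp; try reflexivity.
Ltac grp_in H := autorewrite with grp in H.

Section Powers.
Context {G : Group}.
Implicit Types a b c g h x : G.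
Local Open Scope group_scope.

Lemma gpow_nat_S g n : gpow_nat g (S n) = g * gpow_nat g n.
Proof. reflexivity. Qed.

Lemma gpow_succ g k : gpow g (k + 1) = g * gpow g k.
Proof.
  destruct k as [|p|p].
  - reflexivity.
  - simpl gpow. rewrite Pos2Nat.inj_add. replace (Pos.to_nat p + Pos.to_nat 1)%nat with (S (Pos.to_nat p)) by lia.
    reflexivity.
  - destruct (Pos.eq_dec p 1) as [->|hp].
    + simpl. unfold gpow_nat; simpl. grp.
    + assert (e : (Z.neg p + 1 = Z.neg (p - 1))%Z) by lia. rewrite e. simpl gpow.
      replace (Pos.to_nat p) with (S (Pos.to_nat (p - 1))) by lia.
      rewrite gpow_nat_S. grp.
Qed.

Lemma gpow_add g k l : gpow g (k + l) = gpow g k * gpow g l.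
Proof.
  revert k; apply Z.peano_ind.
  - simpl. grp.
  - intros k IH. replace (Z.succ k + l)%Z with ((k + l) + 1)%Z by lia.
    unfold Z.succ. rewrite !gpow_succ, IH. grp.
  - intros k IH. apply (gmul_eq_l g). rewrite <- gpow_succ, gmul_assoc, <- gpow_succ.
    replace (Z.pred k + l + 1)%Z with (k + l)%Z by lia.
    replace (Z.pred k + 1)%Z with k by lia. exact IH.
Qed.

Lemma gpow_0 g : gpow g 0 = 1.
Proof. reflexivity. Qed.
Lemma gpow_1 g : gpow g 1 = g.
Proof. unfold gpow, gpow_nat; simpl. grp. Qed.
Lemma gpow_opp g k : gpow g (- k) = (gpow g k)^-1.
Proof. apply ginv_unique. rewrite <- gpow_add, Z.add_opp_diag_r. reflexivity. Qed.
Lemma gpow_m1 g : gpow g (-1) = g^-1.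
Proof. change (-1)%Z with (- (1))%Z. rewrite gpow_opp, gpow_1. reflexivity. Qed.

Lemma gpow_mul g k l : gpow g (k * l) = gpow (gpow g k) l.
Proof.
  revert l; apply Z.peano_ind.
  - rewrite Z.mul_0_r; reflexivity.
  - intros l IH. rewrite Z.mul_succ_r, Z.add_comm, gpow_add. unfold Z.succ.
    rewrite gpow_succ, IH. reflexivity.
  - intros l IH. apply (gmul_eq_l (gpow g k)). rewrite <- gpow_add, <- gpow_succ.
    replace (k + k * Z.pred l)%Z with (k * l)%Z by lia.
    replace (Z.pred l + 1)%Z with l by lia. exact IH.
Qed.

Lemma gpow_conj x g k : gpow (x * g * x^-1) k = x * gpow g k * x^-1.
Proof.
  revert k; apply Z.peano_ind.
  - simpl. grp.
  - intros k IH. unfold Z.succ. rewrite !gpow_succ, IH. grp.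
  - intros k IH. apply (gmul_eq_l (x * g * x^-1)). rewrite <- gpow_succ.
    replace (Z.pred k + 1)%Z with k by lia. rewrite IH.
    transitivity (x * (g * gpow g (Z.pred k)) * x^-1); [|grp].
    rewrite <- gpow_succ. replace (Z.pred k + 1)%Z with k by lia. reflexivity.
Qed.

Lemma gpow_conj_r x g k : gpow (x^-1 * g * x) k = x^-1 * gpow g k * x.
Proof. pose proof (gpow_conj (x^-1) g k) as e. rewrite !ginv_inv in e. exact e. Qed.

Lemma gpow_inv g k : gpow (g^-1) k = gpow g (-k).
Proof. rewrite <- gpow_m1, <- gpow_mul. f_equal; lia. Qed.

(** The exponents may differ in sign, so that an element reversing an axis still belongs to
    [stab]. *)
Definition commensurable h h' := exists i j, i <> 0%Z /\ j <> 0%Z /\ gpow h' i = gpow h j.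

Lemma commens_refl h : commensurable h h.
Proof. exists 1%Z, 1%Z. repeat split; lia. Qed.
Lemma commens_sym h h' : commensurable h h' -> commensurable h' h.
Proof. intros [i [j [hi [hj e]]]]; exists j, i; auto. Qed.
Lemma commens_trans a b c : commensurable a b -> commensurable b c -> commensurable a c.
Proof.
  intros [i [j [hi [hj e]]]] [k [l [hk [hl e']]]].
  exists (k * i)%Z, (j * l)%Z. repeat split; try (intros h; apply Z.mul_eq_0 in h; tauto).
  rewrite gpow_mul, e', <- gpow_mul, Z.mul_comm, gpow_mul, e, <- gpow_mul. reflexivity.
Qed.
Lemma commens_conj x h h' :
  commensurable h h' -> commensurable (x * h * x^-1) (x * h' * x^-1).
Proof.
  intros [i [j [hi [hj e]]]]; exists i, j; repeat split; auto. rewrite !gpow_conj, e. reflexivity.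
Qed.

(* For loxodromic [h] this is the maximal elementary subgroup containing [h]. *)
Definition stab h g := commensurable h (g * h * g^-1).

Lemma stab_mul h a b : stab h a -> stab h b -> stab h (a * b).
Proof.
  unfold stab; intros ha hb. apply (commens_conj a) in hb.
  apply (commens_trans _ _ _ ha) in hb.
  replace (a * b * h * (a * b)^-1) with (a * (b * h * b^-1) * a^-1) by grp. exact hb.
Qed.
Lemma stab_inv h a : stab h a -> stab h (a^-1).
Proof.
  unfold stab; intros ha. apply (commens_conj (a^-1)) in ha.
  replace (a^-1 * (a * h * a^-1) * a^-1^-1) with h in ha by grp. apply commens_sym, ha.
Qed.
Lemma stab_1 h : stab h 1.
Proof. unfold stab. replace (1 * h * 1^-1) with h by grp. apply commens_refl. Qed.
Lemma stab_subgroup h : is_subgroup (stab h).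
Proof. repeat split; [apply stab_1 | apply stab_mul | apply stab_inv]. Qed.
Lemma stab_pow h k : stab h (gpow h k).
Proof.
  unfold stab. replace (gpow h k * h * (gpow h k)^-1) with h; [apply commens_refl|].
  rewrite <- gpow_opp. rewrite <- (gpow_1 h) at 3. rewrite <- !gpow_add.
  rewrite <- (gpow_1 h) at 1. f_equal; lia.
Qed.
Lemma stab_commens h h' g : commensurable h h' -> stab h g -> stab h' g.
Proof.
  unfold stab; intros c s. apply commens_sym in c.
  eapply commens_trans; [exact c|]. eapply commens_trans; [exact s|].
  apply commens_conj, commens_sym, c.
Qed.
Lemma stab_conj x h g : stab h g -> stab (x * h * x^-1) (x * g * x^-1).
Proof.
  unfold stab; intros s. apply (commens_conj x) in s.
  replace (x * g * x^-1 * (x * h * x^-1) * (x * g * x^-1)^-1) with (x * (g * h * g^-1) * x^-1) by grp.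
  exact s.
Qed.

(* Elements of [stab h] that do not exchange the two ends of the axis of [h]. *)
Definition pos_stab h g := exists i j, (0 < i * j)%Z /\ gpow (g * h * g^-1) i = gpow h j.

Lemma pos_stab_stab h g : pos_stab h g -> stab h g.
Proof. intros [i [j [hp e]]]; exists i, j; repeat split; auto; nia. Qed.
Lemma pos_stab_commens h h' g : commensurable h h' -> pos_stab h g -> pos_stab h' g.
Proof.
  intros [p [q [hp [hq e]]]] [i [j [hij e']]]. exists (p * i)%Z, (p * j)%Z. split; [nia|].
  rewrite gpow_mul, gpow_conj, e, <- gpow_conj, <- gpow_mul, Z.mul_comm, gpow_mul, e', <- gpow_mul.
  rewrite (gpow_mul h' p j), e, <- gpow_mul. f_equal; lia.
Qed.
(** The sign of [i * j] tells whether [a] keeps or exchanges the ends of the axis. Signs multiply,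
    and here those of [a] and [b] agree. *)
Lemma pos_stab_quotient h a b i j k l : (0 < (i * j) * (k * l))%Z ->
  gpow (a * h * a^-1) i = gpow h j -> gpow (b * h * b^-1) k = gpow h l -> pos_stab h (a^-1 * b).
Proof.
  intros hs e e'. exists (k * j)%Z, (i * l)%Z. split; [nia|].
  replace (a^-1 * b * h * (a^-1 * b)^-1) with (a^-1 * (b * h * b^-1) * a) by grp.
  rewrite gpow_conj_r, gpow_mul, e', <- gpow_mul, Z.mul_comm, gpow_mul, <- e, <- gpow_mul, gpow_conj.
  grp.
Qed.
Lemma pos_stab_mul_inv h a b : pos_stab h a -> pos_stab h b -> pos_stab h (a^-1 * b).
Proof.
  intros [i [j [h1 e]]] [k [l [h2 e']]]. apply (pos_stab_quotient h a b i j k l); auto. nia.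
Qed.
Lemma stab_sign h a b : stab h a -> stab h b -> ~ pos_stab h a -> ~ pos_stab h b ->
  pos_stab h (a^-1 * b).
Proof.
  intros [i [j [hi [hj e]]]] [k [l [hk [hl e']]]] na nb.
  assert (h1 : (i * j < 0)%Z) by (destruct (Z_lt_le_dec (i*j) 0); auto; exfalso; apply na; exists i, j; split; auto; nia).
  assert (h2 : (k * l < 0)%Z) by (destruct (Z_lt_le_dec (k*l) 0); auto; exfalso; apply nb; exists k, l; split; auto; nia).
  apply (pos_stab_quotient h a b i j k l); auto. nia.
Qed.
End Powers.

Record acyl_action := {
  grp : Group;
  spc : MetricSpace;
  aact : grp -> spc -> spc;
  delta : R;
  kappa : R;
  acylN : nat;
  delta_pos : 0 < delta;
  delta_le_kappa : delta <= kappa;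
  spc_geodesic : geodesic_space spc;
  spc_hyperbolic : hyperbolic spc delta;
  aact_isometric : isometric_action grp spc aact;
  aact_acylindrical : acylindrical grp spc aact delta kappa acylN }.

Definition act {H : acyl_action} : grp H -> spc H -> spc H := aact H.
Notation "g $ x" := (act g%g x) (at level 41, right associativity).

Ltac consts := match goal with H : acyl_action |- _ =>
  pose proof (conj (delta_pos H) (delta_le_kappa H)) as [dp dk] end.

(** * Hyperbolic geometry *)

Section Hyperbolic.
Context {H : acyl_action}.
Local Notation X := (spc H).
Local Notation G := (grp H).
Local Notation d := (delta H).
Implicit Types p q x y z m P Q : X.
Implicit Types g h : G.

Lemma act_1 x : 1 $ x = x.
Proof. apply (aact_isometric H). Qed.
Lemma act_mul g h x : (g * h) $ x = g $ h $ x.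
Proof. apply (aact_isometric H). Qed.
Lemma act_dist g x y : dist (g $ x) (g $ y) = dist x y.
Proof. apply (aact_isometric H). Qed.
Lemma act_VK g x : (g^-1) $ g $ x = x.
Proof. rewrite <- act_mul, gmul_Vl. apply act_1. Qed.
Lemma act_KV g x : g $ (g^-1) $ x = x.
Proof. rewrite <- act_mul, gmul_Vr. apply act_1. Qed.
Lemma dist_act_l g x y : dist (g $ x) y = dist x ((g^-1) $ y).
Proof. rewrite <- (act_dist g x ((g^-1) $ y)), act_KV. reflexivity. Qed.
Lemma dist_refl x : dist x x = 0.
Proof. apply (dist_eq0 X); reflexivity. Qed.

Lemma gromov_act g p q x : gromov (g $ p) (g $ q) (g $ x) = gromov p q x.
Proof. unfold gromov. rewrite !act_dist. reflexivity. Qed.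
Lemma gromov_act_x g p q x : gromov p q (g $ x) = gromov ((g^-1) $ p) ((g^-1) $ q) x.
Proof. rewrite <- (gromov_act g ((g^-1) $ p)), !act_KV. reflexivity. Qed.
Lemma gromov_sym p q x : gromov p q x = gromov q p x.
Proof. unfold gromov. rewrite (dist_sym _ p q). lra. Qed.
Lemma gromov_ge0 p q x : 0 <= gromov p q x.
Proof. unfold gromov. pose proof (dist_tri _ p x q). rewrite (dist_sym _ x q) in *. lra. Qed.
Lemma gromov_le_l p q x : gromov p q x <= dist p x.
Proof. unfold gromov. pose proof (dist_tri _ q p x). rewrite (dist_sym _ q p) in *. lra. Qed.
Lemma gromov_le_r p q x : gromov p q x <= dist q x.
Proof. rewrite gromov_sym. apply gromov_le_l. Qed.
Lemma gromov_swap p q x : gromov p q x + gromov x q p = dist x p.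
Proof. unfold gromov. rewrite (dist_sym _ p x), (dist_sym _ q x), (dist_sym _ q p). lra. Qed.
Lemma gromov_lip p p' q x : gromov p q x <= gromov p' q x + dist p p'.
Proof.
  unfold gromov. pose proof (dist_tri _ p p' x). pose proof (dist_tri _ p' p q).
  rewrite (dist_sym _ p' p) in *. lra.
Qed.
Lemma gromov_lip_x p q x y : gromov p q x <= gromov p q y + dist x y.
Proof.
  unfold gromov. pose proof (dist_tri _ p y x). pose proof (dist_tri _ q y x).
  rewrite (dist_sym _ y x) in *. lra.
Qed.
Lemma gromov_dist p q x : dist p q = dist p x + dist q x - 2 * gromov p q x.
Proof. unfold gromov. lra. Qed.
Lemma gromov_id_l q x : gromov x q x = 0.
Proof. unfold gromov. rewrite dist_refl, (dist_sym _ q x). lra. Qed.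

Lemma hyp_min p q r x c : c <= gromov p q x -> c <= gromov q r x -> c - d <= gromov p r x.
Proof.
  intros h1 h2. pose proof (spc_hyperbolic H p q r x) as h.
  pose proof (Rmin_glb _ _ _ h1 h2). lra.
Qed.

(** The form in which hyperbolicity is mostly used: points [q] and [r] in a common direction from
    [x] may be exchanged in an upper bound at the cost of [d]. If [gromov p r x] exceeded [a + d] as
    well, [gromov p q x] would exceed [a]. *)
Lemma hyp_cut p q r x a : gromov p q x <= a -> a + d < gromov q r x -> gromov p r x <= a + d.
Proof.
  intros h1 h2. destruct (Rle_dec (gromov p r x) (a + d)) as [|hn]; auto. exfalso.
  apply Rnot_le_lt in hn.
  assert (h : exists c, a + d < c /\ c <= gromov p r x /\ c <= gromov r q x).
  { exists (Rmin (gromov p r x) (gromov q r x)). rewrite (gromov_sym r q).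
    repeat split; [apply Rmin_glb_lt; auto | apply Rmin_l | apply Rmin_r]. }
  destruct h as [c [h3 [h4 h5]]]. pose proof (hyp_min p r q x c h4 h5). lra.
Qed.

(** Symmetric form of the Gromov inequality based at [x]: among the three ways to pair the points
    none beats both others by more than [2 * d]. *)
Lemma four_point x y z t :
  dist x z + dist y t <= dist x y + dist z t + 2 * d \/
  dist x z + dist y t <= dist x t + dist y z + 2 * d.
Proof.
  pose proof (spc_hyperbolic H y z t x) as h.
  unfold gromov in h.
  rewrite (dist_sym _ y x), (dist_sym _ z x), (dist_sym _ t x) in h.
  unfold Rmin in h; destruct (Rle_dec _ _); [right|left]; lra.
Qed.

(** [gromov P Q z <= e] expresses that [z] is close to a geodesic from [P] to [Q]. The sums of the
    distances to [P] and [Q] are then nearly equal for [z] and [z'], and the four points [z], [P],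
    [z'], [Q] leave only the difference of the positions. *)
Lemma line_dist P Q z z' e : gromov P Q z <= e -> gromov P Q z' <= e ->
  dist z z' <= Rabs (dist z P - dist z' P) + 2 * e + 2 * d.
Proof.
  intros h1 h2. unfold gromov in h1, h2.
  rewrite (dist_sym _ P z), (dist_sym _ Q z) in h1. rewrite (dist_sym _ P z'), (dist_sym _ Q z') in h2.
  destruct (four_point z P z' Q) as [h|h]; rewrite ?(dist_sym _ P z') in h;
  unfold Rabs; destruct (Rcase_abs _); lra.
Qed.

Lemma line_dist_ge P z z' : Rabs (dist z P - dist z' P) <= dist z z'.
Proof.
  pose proof (dist_tri _ z z' P). pose proof (dist_tri _ z' z P).
  rewrite (dist_sym _ z' z) in *. apply Rabs_le. lra.
Qed.

(* [m] near a geodesic [p, q] between two points of the line [P, Q]: at [p] one end is on the side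
   of [m], so the other end is seen from [m] in the direction of [p]; the same holds at [q]. *)
Lemma line_between P Q p q m e eps : 0 <= e ->
  gromov P Q p <= e -> gromov P Q q <= e -> gromov p q m <= eps ->
  e + eps + 4 * d <= dist p m -> e + eps + 4 * d <= dist q m ->
  gromov P Q m <= eps + 2 * d.
Proof.
  intros he h1 h2 h3 hp hq. consts.
  assert (side : forall R R' u, gromov R R' u <= e -> e + eps + 4 * d <= dist u m ->
      eps + 2 * d < gromov u R m \/ eps + 2 * d < gromov u R' m).
  { intros R R' u hu hum.
    destruct (Rle_dec (gromov R m u) (e + d)) as [h|h].
    - left. pose proof (gromov_swap u R m). rewrite (gromov_sym m R u), (dist_sym _ m u) in *. lra.
    - right. assert (gromov R' m u <= e + d).
      { rewrite gromov_sym in hu. apply (hyp_cut R' R m u e); auto; lra. }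
      pose proof (gromov_swap u R' m). rewrite (gromov_sym m R' u), (dist_sym _ m u) in *. lra. }
  assert (fin : forall R R', eps + 2 * d < gromov p R m -> eps + 2 * d < gromov q R' m ->
     gromov R R' m <= eps + 2 * d).
  { intros R R' a1 a2.
    assert (a3 : gromov q R m <= eps + d).
    { apply (hyp_cut q p R m eps); [rewrite gromov_sym; auto | lra]. }
    rewrite gromov_sym in a3.
    pose proof (hyp_cut R q R' m (eps + d) a3). lra. }
  assert (nosame : forall R, eps + 2 * d < gromov p R m -> eps + 2 * d < gromov q R m -> False).
  { intros R a1 a2. rewrite (gromov_sym q R) in a2.
    pose proof (hyp_min p R q m (eps + 2 * d)). lra. }
  destruct (side P Q p h1 hp) as [b1|b1]; destruct (side P Q q h2 hq) as [b2|b2].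
  - exfalso; eauto.
  - apply fin; auto.
  - rewrite gromov_sym. apply fin; auto.
  - exfalso; eauto.
Qed.

(** If [P] and [P'] lie in one direction from [p], well beyond [m], the difference of the distances
    to them hardly depends on the point. With [P'] the preimage of [P] under an isometry, this
    difference is the amount by which the isometry shifts points along lines to [P]. *)
Lemma busemann_shift P P' p m : dist p m + d < gromov P P' p ->
  Rabs ((dist m P' - dist m P) - (dist p P' - dist p P)) <= 2 * d.
Proof.
  intros h. unfold gromov in h. consts.
  rewrite (dist_sym _ P p), (dist_sym _ P' p) in h.
  pose proof (dist_tri _ p m P). pose proof (dist_tri _ p m P').
  apply Rabs_le.
  destruct (four_point m p P' P) as [a|a]; destruct (four_point m p P P') as [b|b];
  rewrite ?(dist_sym _ m p), ?(dist_sym _ P' P) in *; lra.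
Qed.

Lemma geodesic_fun p q : exists sg : R -> X, forall s, 0 <= s <= dist p q ->
  dist p (sg s) = s /\ dist q (sg s) = dist p q - s.
Proof.
  destruct (spc_geodesic H p q) as [gam [h0 [h1 h2]]]. exists gam. intros s hs. split.
  - rewrite <- h0 at 1. rewrite h2 by lra. unfold Rabs; destruct (Rcase_abs _); lra.
  - rewrite <- h1 at 1. rewrite h2 by lra. unfold Rabs; destruct (Rcase_abs _); lra.
Qed.

Lemma gromov_geo p q m s : dist p m = s -> dist q m = dist p q - s -> gromov p q m = 0.
Proof. intros e1 e2. unfold gromov. lra. Qed.

(* Two such isometries with [delta]-close positions of [g $ z1] and the same order of [g $ z1], [g $ z2]
   along the line differ by an element moving [z1] and [z2] by at most [100 delta]. *)
Lemma spot P Q z1 z2 e c Delta (K : nat) (S : list G) :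
  kappa H <= dist z1 z2 -> e <= 20 * d -> 0 <= Delta -> Delta < INR K * d -> NoDup S ->
  (forall g, In g S -> gromov P Q (g $ z1) <= e /\ gromov P Q (g $ z2) <= e /\
      c <= dist (g $ z1) P <= c + Delta) ->
  (length S <= (2 * K) * acylN H)%nat.
Proof.
  intros hk he hD hK hS hg. consts.
  (* [up] records whether [g] keeps or reverses the order of the two points; splitting by it costs
     the factor 2. *)
  set (up := fun g => dist (g $ z1) P <= dist (g $ z2) P).
  assert (main : forall S', NoDup S' -> incl S' S -> (forall g g', In g S' -> In g' S' -> up g <-> up g') ->
     (length S' <= K * acylN H)%nat).
  { intros S' hS' hi hup.
    apply (bucket_pigeonhole (fun g => dist (g $ z1) P) c d); auto.
    { intros g hin. destruct (hg g (hi g hin)) as [_ [_ h]]. lra. }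
    intros F t hF hFi hFt. destruct F as [|g0 q]; [simpl; lia|]. set (F := g0 :: q) in *.
    assert (hi0 : In g0 F) by (simpl; auto).
    rewrite <- (length_map (fun g => (g0^-1 * g)%g)).
    apply (aact_acylindrical H z1 z2); [apply Rle_ge; exact hk| |].
    - apply Injective_map_NoDup; auto. intros a b hab. apply gmul_eq_l in hab; exact hab.
    - intros u hu. apply in_map_iff in hu as [g [<- hu]].
      change (aact H) with (@act H). rewrite !act_mul.
      rewrite 2!(dist_act_l (g0^-1)%g), !ginv_inv.
      destruct (hg g (hi g (hFi g hu))) as [a1 [a2 _]]. destruct (hg g0 (hi g0 (hFi g0 hi0))) as [b1 [b2 _]].
      pose proof (hup g g0 (hFi g hu) (hFi g0 hi0)) as hs. unfold up in hs.
      pose proof (hFt g hu). pose proof (hFt g0 hi0).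
      pose proof (line_dist P Q (g $ z1) (g0 $ z1) e a1 b1) as l1.
      pose proof (line_dist P Q (g $ z2) (g0 $ z2) e a2 b2) as l2.
      pose proof (line_dist P Q (g $ z1) (g $ z2) e a1 a2) as l3.
      pose proof (line_dist P Q (g0 $ z1) (g0 $ z2) e b1 b2) as l4.
      pose proof (line_dist_ge P (g $ z1) (g $ z2)) as l5.
      pose proof (line_dist_ge P (g0 $ z1) (g0 $ z2)) as l6.
      rewrite !act_dist in l3, l4, l5, l6.
      (* Equal order and first positions within [d] put the second positions within [43 * d], hence
         the points themselves within [85 * d]. *)
      destruct (Rle_dec (dist (g $ z1) P) (dist (g $ z2) P)) as [p1|p1];
      [apply hs in p1 as p2|assert (p2 : ~ dist (g0 $ z1) P <= dist (g0 $ z2) P) by tauto];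
      unfold Rabs in *; repeat destruct (Rcase_abs _); lra. }
  rewrite (length_sel_split up S).
  assert (length (sel up S) <= K * acylN H)%nat.
  { apply main; [apply NoDup_sel; auto| |]; [apply incl_sel|].
    intros g g' hi hi'. apply in_sel in hi. apply in_sel in hi'. tauto. }
  assert (length (sel (fun g => ~ up g) S) <= K * acylN H)%nat; [|lia].
  apply main; [apply NoDup_sel; auto| |]; [apply incl_sel|].
  intros g g' hi hi'. apply in_sel in hi. apply in_sel in hi'. tauto.
Qed.

End Hyperbolic.

(** * Axes of loxodromic elements *)

Section Axes.
Context {H : acyl_action}.
Local Notation X := (spc H).
Local Notation G := (grp H).
Local Notation d := (delta H).
Implicit Types p q x y z : X.
Implicit Types g h : G.

(** A broken geodesic given by its letters: at each corner the adjacent sides part after at most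
    [a]. Only inner letters have to be long; the first one serves as a direction and the last one
    may be short. *)
Fixpoint linked (y : X) (a : R) (l : list G) : Prop :=
  match l with
  | g1 :: ((g2 :: l') as l1) =>
      gromov ((g1^-1) $ y) (g2 $ y) y <= a /\
      (l' <> [] -> 2 * a + 2 * d < dist (g2 $ y) y) /\ linked y a l1
  | _ => True
  end.

(** Local to global, by induction from the end of the word: the rest of the word returns along [g2]
    by at most [a + d], so it is seen from [y] in the direction of [g2] beyond [a + d], and
    [hyp_cut] transfers the bound at the corner. *)
Lemma linked_gromov y a g1 g2 l : linked y a (g1 :: g2 :: l) ->
  gromov ((g1^-1) $ y) (prod_list (g2 :: l) $ y) y <= a + d.
Proof.
  consts.
  revert g1 g2; induction l as [|g3 l IH]; intros g1 g2 [h1 [h2 h3]].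
  - simpl. rewrite gmul_1r. lra.
  - specialize (IH _ _ h3). specialize (h2 ltac:(congruence)).
    eapply hyp_cut; [exact h1|].
    change (prod_list (g2 :: g3 :: l)) with (g2 * prod_list (g3 :: l))%g. rewrite act_mul.
    set (w := prod_list (g3 :: l) $ y) in *.
    pose proof (gromov_swap (g2 $ y) (g2 $ w) y) as e.
    rewrite gromov_act_x, !act_VK in e. rewrite (dist_sym _ y) in e. lra.
Qed.

(** Loxodromic is weakened to divergence of the powers in both directions; unlike [axial] this does
    not single out a point. *)
Definition lox h := forall y z (B : R), exists n0 : Z, forall n, (n0 <= n)%Z ->
  B <= dist (gpow h n $ y) z /\ B <= dist (gpow h (-n) $ y) z.

(* [z] is [e]-close to the axis of [h]. Allowing all base points [y], [y'] makes this invariant under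
   commensurability, and so under [stab h], without any loss in [e]. *)
Definition online h (e : R) z := forall y y', exists n0 : Z, forall n m, (n0 <= n)%Z -> (n0 <= m)%Z ->
  gromov (gpow h (-n) $ y) (gpow h m $ y') z <= e.

(** For [a] up to [7000 * d] the orbit of [y] under the powers of [h] is a broken geodesic with long
    sides, so [h] is loxodromic and [y] is close to its axis. The condition is checked at one
    point. *)
Definition axial (a : R) h y :=
  gromov ((h^-1) $ y) (h $ y) y <= a /\ 100000 * kappa H <= dist (h $ y) y.

Lemma axial_inv a h y : axial a h y -> axial a (h^-1)%g y.
Proof.
  intros [h1 h2]; split.
  - rewrite ginv_inv, gromov_sym. exact h1.
  - rewrite dist_act_l, ginv_inv, dist_sym. exact h2.
Qed.

Lemma axial_conj a h y g : axial a h y -> axial a (g * h * g^-1)%g (g $ y).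
Proof.
  intros [h1 h2]; split.
  - rewrite !ginv_mul, ginv_inv, <- !act_mul. grp. rewrite !act_mul, gromov_act. exact h1.
  - rewrite <- !act_mul. grp. rewrite !act_mul, act_dist. exact h2.
Qed.

Lemma gpow_S h (n : nat) : gpow h (Z.of_nat (S n)) = (h * gpow h (Z.of_nat n))%g.
Proof. rewrite Nat2Z.inj_succ. apply gpow_succ. Qed.

Lemma axial_forward a h y (n : nat) : a <= 7000 * d -> axial a h y ->
  gromov ((h^-1) $ y) (gpow h (Z.of_nat (S n)) $ y) y <= a + d.
Proof.
  intros ha [h1 h2]. consts.
  induction n as [|n IH].
  - rewrite gpow_1. lra.
  - eapply hyp_cut; [exact h1|].
    rewrite gpow_S, act_mul. set (w := gpow h _ $ y) in *.
    pose proof (gromov_swap (h $ y) (h $ w) y) as e.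
    rewrite gromov_act_x, !act_VK in e. rewrite (dist_sym _ y) in e. lra.
Qed.

Lemma axial_growth a h y (n : nat) : a <= 7000 * d -> axial a h y ->
  INR n * d <= dist (gpow h (Z.of_nat n) $ y) y.
Proof.
  intros ha hx. consts.
  assert (st : forall n, dist (gpow h (Z.of_nat n) $ y) y + d <= dist (gpow h (Z.of_nat (S n)) $ y) y).
  { intros [|k].
    - rewrite gpow_1. change (Z.of_nat 0) with 0%Z. rewrite gpow_0, act_1, dist_refl. destruct hx; lra.
    - rewrite (gpow_S h (S k)), act_mul. pose proof (axial_forward a h y k ha hx) as f.
      destruct hx as [h1 h2].
      set (w := gpow h _ $ y) in *.
      pose proof (gromov_dist ((h^-1) $ y) w y) as e.
      rewrite (dist_act_l (h^-1)%g y w), (dist_act_l (h^-1)%g y y), !ginv_inv,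
        (dist_sym _ y (h $ w)), (dist_sym _ y (h $ y)) in e. lra. }
  induction n as [|n IH].
  - simpl INR. pose proof (dist_ge0 _ (gpow h (Z.of_nat 0) $ y) y). lra.
  - rewrite S_INR. specialize (st n). lra.
Qed.

Lemma dist_gpow_opp h y n : dist (gpow h (- n) $ y) y = dist (gpow h n $ y) y.
Proof. rewrite gpow_opp, dist_act_l, ginv_inv, dist_sym. reflexivity. Qed.

Lemma axial_lox a h y : a <= 7000 * d -> axial a h y -> lox h.
Proof.
  intros ha hx y1 z B. consts.
  destruct (exists_nat_ge ((B + dist y y1 + dist y z) / d)) as [n0 hn0].
  assert (hB : B + dist y y1 + dist y z <= INR n0 * d).
  { apply Rmult_le_compat_r with (r := d) in hn0; [|lra]. unfold Rdiv in hn0.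
    rewrite Rmult_assoc, Rinv_l in hn0 by lra. lra. }
  exists (Z.of_nat n0). intros n hn.
  assert (hg : B + dist y y1 + dist y z <= dist (gpow h n $ y) y).
  { replace n with (Z.of_nat (Z.to_nat n)) by lia.
    eapply Rle_trans; [|apply (axial_growth a); auto].
    eapply Rle_trans; [exact hB|]. apply Rmult_le_compat_r; [lra|]. apply le_INR; lia. }
  assert (hb : forall k, dist (gpow h k $ y) y <= dist y y1 + dist (gpow h k $ y1) z + dist y z).
  { intros k. pose proof (dist_tri _ (gpow h k $ y) (gpow h k $ y1) y).
    pose proof (dist_tri _ (gpow h k $ y1) z y). rewrite act_dist in *. rewrite (dist_sym _ z y) in *. lra. }
  split.
  - specialize (hb n). lra.
  - specialize (hb (-n)%Z). rewrite dist_gpow_opp in hb. lra.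
Qed.

Lemma axial_two_sided a h y (n m : nat) : a <= 7000 * d -> axial a h y ->
  gromov (gpow h (- Z.of_nat (S n)) $ y) (gpow h (Z.of_nat (S m)) $ y) y <= a + 2 * d.
Proof.
  intros ha hx. consts.
  pose proof (axial_forward a h y m ha hx) as f1.
  rewrite gromov_sym in f1 |- *.
  replace (a + 2 * d) with ((a + d) + d) by lra.
  eapply hyp_cut; [exact f1|].
  rewrite <- gpow_inv, gpow_S, act_mul.
  pose proof hx as [h1 h2].
  destruct n as [|k].
  - change (Z.of_nat 0) with 0%Z. rewrite gpow_0, act_1. unfold gromov. rewrite dist_refl, (dist_act_l (h^-1)%g y y), ginv_inv, (dist_sym _ y). lra.
  - pose proof (axial_forward a _ y k ha (axial_inv _ _ _ hx)) as f2.
    set (w := gpow (h^-1)%g (Z.of_nat (S k)) $ y) in *.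
    pose proof (gromov_swap ((h^-1) $ y) ((h^-1) $ w) y) as e.
    rewrite (gromov_act_x (h^-1)%g), !act_VK, ginv_inv in e. rewrite ginv_inv in f2.
    rewrite (dist_sym _ y), (dist_act_l (h^-1)%g y y), ginv_inv, (dist_sym _ y) in e. lra.
Qed.

(** Far out, the powers of [h] applied to [y] and to another point lie in one direction from [z];
    exchanging the two ends costs [d] each. *)
Lemma online_of_base h e z y n1 : lox h ->
  (forall n m, (n1 <= n)%Z -> (n1 <= m)%Z -> gromov (gpow h (-n) $ y) (gpow h m $ y) z <= e) ->
  online h (e + 2 * d) z.
Proof.
  intros hl hb y1 y2. consts.
  destruct (hl y z (e + 3 * d + dist y y1 + dist y y2)) as [n0 hn].
  exists (Z.max n0 n1). intros n m h1 h2.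
  specialize (hb n m ltac:(lia) ltac:(lia)).
  assert (A : forall k y', dist (gpow h k $ y) z - dist y y' <= gromov (gpow h k $ y) (gpow h k $ y') z).
  { intros k y'. pose proof (gromov_lip (gpow h k $ y) (gpow h k $ y') (gpow h k $ y) z).
    rewrite act_dist in *.
    assert (e0 : gromov (gpow h k $ y) (gpow h k $ y) z = dist (gpow h k $ y) z).
    { unfold gromov; rewrite dist_refl; lra. }
    rewrite (gromov_sym (gpow h k $ y') (gpow h k $ y)) in *. lra. }
  pose proof (dist_ge0 _ y y1). pose proof (dist_ge0 _ y y2).
  replace (e + 2 * d) with ((e + d) + d) by lra.
  apply (hyp_cut _ (gpow h m $ y)).
  - rewrite gromov_sym. apply (hyp_cut _ (gpow h (-n) $ y)); [rewrite gromov_sym; auto|].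
    pose proof (A (-n)%Z y1). destruct (hn n ltac:(lia)). lra.
  - pose proof (A m y2). destruct (hn m ltac:(lia)). lra.
Qed.

Lemma axial_online a h y : a <= 7000 * d -> axial a h y -> online h (a + 4 * d) y.
Proof.
  intros ha hx. replace (a + 4 * d) with ((a + 2 * d) + 2 * d) by lra.
  apply (online_of_base h (a + 2 * d) y y 1 (axial_lox _ _ _ ha hx)).
  intros n m hn hm.
  replace n with (Z.of_nat (S (Z.to_nat (n - 1)))) by lia.
  replace m with (Z.of_nat (S (Z.to_nat (m - 1)))) by lia.
  apply axial_two_sided; auto.
Qed.

Lemma online_mono h e e' z : e <= e' -> online h e z -> online h e' z.
Proof.
  intros he ho y y'. destruct (ho y y') as [n0 hn]. exists n0. intros n m a b.
  specialize (hn n m a b). lra.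
Qed.

Lemma online_between h e eps p q m : 0 <= e -> online h e p -> online h e q ->
  gromov p q m <= eps -> e + eps + 4 * d <= dist p m -> e + eps + 4 * d <= dist q m ->
  online h (eps + 2 * d) m.
Proof.
  intros he hp hq hm h1 h2 y y'.
  destruct (hp y y') as [n0 hn]. destruct (hq y y') as [n1 hn1].
  exists (Z.max n0 n1). intros n k a b.
  apply (line_between _ _ p q m e eps); auto; [apply hn | apply hn1]; lia.
Qed.

Lemma online_conj g h e z : online h e z -> online (g * h * g^-1)%g e (g $ z).
Proof.
  intros ho y y'. destruct (ho ((g^-1) $ y) ((g^-1) $ y')) as [n0 hn].
  exists n0. intros n m a b. rewrite !gpow_conj, !act_mul, gromov_act. apply hn; auto.
Qed.

Lemma lox_conj g h : lox h -> lox (g * h * g^-1)%g.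
Proof.
  intros hl y z B. destruct (hl ((g^-1) $ y) ((g^-1) $ z) B) as [n0 hn].
  exists n0. intros n hn0. rewrite !gpow_conj, !act_mul, !(dist_act_l g). apply hn; auto.
Qed.

Lemma eventually_list {T : Type} (l : list T) (Q : T -> Z -> Z -> Prop) :
  (forall t, In t l -> exists n0, forall n m, (n0 <= n)%Z -> (n0 <= m)%Z -> Q t n m) ->
  exists n0, forall t, In t l -> forall n m, (n0 <= n)%Z -> (n0 <= m)%Z -> Q t n m.
Proof.
  induction l as [|a l IH]; intros h.
  - exists 0%Z; simpl; tauto.
  - destruct IH as [n0 h0]; [intros; apply h; simpl; auto|].
    destruct (h a) as [n1 h1]; [simpl; auto|].
    exists (Z.max n0 n1). intros t [<-|hg] n m a1 a2; [apply h1|apply h0]; auto; lia.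
Qed.

Lemma uniform_below (i : nat) (Q : Z -> Z -> Prop) :
  (forall r, (0 <= r < Z.of_nat i)%Z -> exists k0, forall k, (k0 <= k)%Z -> Q r k) ->
  exists k0, forall r, (0 <= r < Z.of_nat i)%Z -> forall k, (k0 <= k)%Z -> Q r k.
Proof.
  intros hQ.
  destruct (eventually_list (seq 0 i) (fun r k _ => Q (Z.of_nat r) k)) as [k0 hk].
  - intros r hr. apply in_seq in hr. destruct (hQ (Z.of_nat r) ltac:(lia)) as [k0 hk]. exists k0. auto.
  - exists k0. intros r hr k hkk. specialize (hk (Z.to_nat r)). rewrite Z2Nat.id in hk by lia.
    apply (hk ltac:(apply in_seq; lia) k k0); lia.
Qed.

Lemma eventually_mod (i : Z) (Q : Z -> Z -> Prop) : (0 < i)%Z ->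
  (forall r s, exists k0, (0 <= k0)%Z /\ forall k l, (k0 <= k)%Z -> (k0 <= l)%Z -> Q (i * k + r) (i * l + s))%Z ->
  exists n0, forall n m, (n0 <= n)%Z -> (n0 <= m)%Z -> Q n m.
Proof.
  intros hi hQ.
  destruct (uniform_below (Z.to_nat i) (fun r k0 => forall s, (0 <= s < i)%Z ->
     forall k l, (k0 <= k)%Z -> (k0 <= l)%Z -> Q (i * k + r)%Z (i * l + s)%Z)) as [k0 hk].
  - intros r hr.
    destruct (uniform_below (Z.to_nat i) (fun s k0 => 
     forall k l, (k0 <= k)%Z -> (k0 <= l)%Z -> Q (i * k + r)%Z (i * l + s)%Z)) as [k0 hk].
    + intros s hs. destruct (hQ r s) as [k0 [_ hk]]. exists k0. intros k1 hk1 k l a b. apply hk; lia.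
    + exists k0. intros k1 hk1 s hs k l a b. apply (hk s ltac:(lia) k1); lia.
  - exists (i * Z.max k0 0 + i)%Z. intros n m hn hm.
    rewrite (Z.div_mod n i), (Z.div_mod m i) by lia.
    pose proof (Z.mod_pos_bound n i hi). pose proof (Z.mod_pos_bound m i hi).
    assert (k0 <= n / i)%Z by (apply Z.div_le_lower_bound; lia).
    assert (k0 <= m / i)%Z by (apply Z.div_le_lower_bound; lia).
    apply (hk (n mod i)%Z ltac:(lia) k0); lia.
Qed.

Lemma commens_pos h h' : commensurable h h' ->
  exists i j, (0 < i)%Z /\ j <> 0%Z /\ gpow h' i = gpow h j.
Proof.
  intros [i [j [hi [hj e]]]].
  destruct (Z_lt_le_dec 0 i) as [hp|hp]; [exists i, j; auto|].
  exists (-i)%Z, (-j)%Z. repeat split; try lia. rewrite !gpow_opp, e. reflexivity.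
Qed.

Lemma gpow_split h h' i j k r : gpow h' i = gpow h j ->
  gpow h' (i * k + r) = (gpow h (j * k) * gpow h' r)%g.
Proof. intros e. rewrite gpow_add, gpow_mul, e, <- gpow_mul. reflexivity. Qed.

(** Exponents of [h'] are written [i * k + r]. The remainders are absorbed into the base points,
    over which [online] quantifies, and [eventually_mod] combines the finitely many thresholds. If
    [j] is negative the two ends are exchanged. *)
Lemma online_commens h h' e z : commensurable h h' -> online h e z -> online h' e z.
Proof.
  intros c ho y y'. apply commens_pos in c as [i [j [hi [hj eq]]]].
  apply (eventually_mod i (fun n m => gromov (gpow h' (-n) $ y) (gpow h' m $ y') z <= e) hi).
  intros r s.
  destruct (Z_lt_le_dec 0 j) as [hp|hp].
  - destruct (ho (gpow h' (-r) $ y) (gpow h' s $ y')) as [n0 hn].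
    exists (Z.max n0 0). split; [lia|]. intros k l hk hl.
    replace (- (i * k + r))%Z with (i * (- k) + (- r))%Z by lia.
    rewrite !(gpow_split h h' i j _ _ eq), !act_mul.
    replace (j * - k)%Z with (- (j * k))%Z by lia. apply hn; nia.
  - destruct (ho (gpow h' s $ y') (gpow h' (-r) $ y)) as [n0 hn].
    exists (Z.max n0 0). split; [lia|]. intros k l hk hl.
    replace (- (i * k + r))%Z with (i * (- k) + (- r))%Z by lia.
    rewrite !(gpow_split h h' i j _ _ eq), !act_mul, gromov_sym.
    replace (j * l)%Z with (- ((-j) * l))%Z by lia. replace (j * - k)%Z with ((-j) * k)%Z by lia.
    apply hn; nia.
Qed.

Lemma online_stab h e z g : stab h g -> online h e z -> online h e (g $ z).
Proof.
  intros s ho. apply (online_commens (g * h * g^-1)%g); [apply commens_sym, s|].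
  apply online_conj, ho.
Qed.

Lemma lox_gpow_ne1 h n : lox h -> inhabited X -> (n <> 0)%Z -> gpow h n <> 1%g.
Proof.
  intros hl [y] hn e. destruct (hl y y 1) as [n0 h0].
  specialize (h0 (Z.abs n * Z.max n0 1)%Z ltac:(nia)) as [h0 _].
  assert (e' : gpow h (Z.abs n * Z.max n0 1) = 1%g).
  { replace (Z.abs n * Z.max n0 1)%Z with (n * (Z.sgn n * Z.max n0 1))%Z by nia.
    rewrite gpow_mul, e. generalize (Z.sgn n * Z.max n0 1)%Z as k. apply Z.peano_ind.
    - reflexivity.
    - intros k IH. unfold Z.succ. rewrite gpow_succ, IH. grp.
    - intros k IH. apply (gmul_eq_l 1%g). rewrite <- gpow_succ.
      replace (Z.pred k + 1)%Z with k by lia. rewrite IH. grp. }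
  rewrite e', act_1, dist_refl in h0. lra.
Qed.

(** Seen from [p], [g] moves the ends [P] and [Q] only within their directions, so it shifts the
    middle of the segment from [p] to [q] along itself. The shift [tau] is the Busemann displacement
    with respect to [P], which lies behind [p]; evaluating it at [y] gives its bound. *)
Lemma slide_fin P Q p q g e y :
  0 <= e -> gromov P Q p <= e -> gromov P Q q <= e -> gromov P q p <= e + d ->
  dist p q + dist p y + 10 * d < gromov P ((g^-1) $ P) p ->
  dist p q + dist p y + 10 * d < gromov Q ((g^-1) $ Q) p ->
  exists tau, Rabs tau <= dist (g $ y) y + 2 * d /\
   forall m m' s, dist p m = s -> dist q m = dist p q - s ->
     dist p m' = s + tau -> dist q m' = dist p q - (s + tau) ->
     e + 5 * d <= s <= dist p q - (e + 5 * d) ->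
     e + 5 * d <= s + tau <= dist p q - (e + 5 * d) -> dist (g $ m) m' <= 14 * d.
Proof.
  intros he h1 h2 h3 hP hQ. consts.
  pose proof (dist_ge0 _ p q) as pq0. pose proof (dist_ge0 _ p y) as py0.
  exists (dist p ((g^-1) $ P) - dist p P). split.
  - pose proof (busemann_shift P ((g^-1) $ P) p y ltac:(lra)) as b.
    pose proof (line_dist_ge P (g $ y) y) as l. rewrite (dist_act_l g y P) in l.
    unfold Rabs in *; repeat destruct (Rcase_abs _); lra.
  - assert (key : forall m s, dist p m = s -> dist q m = dist p q - s ->
        e + 5 * d <= s <= dist p q - (e + 5 * d) ->
        gromov q P m <= d /\ gromov P Q m <= 2 * d).
    { intros m s e1 e2 hs. pose proof (gromov_geo p q m s e1 e2) as e0. split.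
      - pose proof (gromov_swap p q m) as s1. rewrite (dist_sym _ m p) in s1.
        assert (a1 : gromov P m p <= e + d + d).
        { apply (hyp_cut P q m p (e + d)); auto. rewrite gromov_sym. lra. }
        pose proof (gromov_swap p P m) as s2. rewrite (dist_sym _ m p), (gromov_sym m P) in s2.
        replace d with (0 + d) by lra. apply (hyp_cut q p P m 0); [rewrite gromov_sym; lra|lra].
      - replace (2 * d) with (0 + 2 * d) by lra. apply (line_between P Q p q m e 0); lra. }
    intros m m' s e1 e2 e1' e2' hs hs'.
    destruct (key m s e1 e2 hs) as [k1 k2]. destruct (key m' _ e1' e2' hs') as [k1' k2'].
    assert (pm : dist p m <= dist p q) by lra.
    pose proof (busemann_shift P ((g^-1) $ P) p m ltac:(lra)) as b.
    assert (far : forall R, dist p q + dist p y + 10 * d < gromov R ((g^-1) $ R) p ->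
       5 * d < gromov R ((g^-1) $ R) m).
    { intros R hR. pose proof (gromov_lip_x R ((g^-1) $ R) p m). lra. }
    pose proof (far P hP) as fP. pose proof (far Q hQ) as fQ.
    assert (k3 : gromov P Q (g $ m) <= 4 * d).
    { rewrite gromov_act_x.
      assert (gromov P ((g^-1) $ Q) m <= 2 * d + d) by (apply (hyp_cut P Q); lra).
      rewrite gromov_sym. replace (4 * d) with ((2 * d + d) + d) by lra.
      apply (hyp_cut _ P); [rewrite gromov_sym; auto | lra]. }
    pose proof (line_dist P Q (g $ m) m' (4 * d) k3 ltac:(lra)) as l.
    rewrite (dist_act_l g m P) in l.
    pose proof (gromov_ge0 q P m) as k0. pose proof (gromov_ge0 q P m') as k0'.
    unfold gromov in k1, k1', k0, k0'. rewrite (dist_sym _ P m) in *. rewrite (dist_sym _ P m') in *.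
    unfold Rabs in *; repeat destruct (Rcase_abs _); lra.
Qed.

Lemma dist_gpow_le h y (i : nat) : dist (gpow h (Z.of_nat i) $ y) y <= INR i * dist (h $ y) y.
Proof.
  induction i as [|i IH].
  - simpl. rewrite act_1, dist_refl. lra.
  - rewrite gpow_S, S_INR, act_mul.
    pose proof (dist_tri _ (h $ gpow h (Z.of_nat i) $ y) (h $ y) y). rewrite act_dist in *. lra.
Qed.

(** The ends are far powers of [h] applied to [y]. As [h^i] commutes with these powers, it moves
    both ends by exactly its displacement at [y], however far they are. If [P] lies on the side of
    [q], the ends exchange their roles. *)
Lemma slide h p q e y (i : nat) : lox h -> 0 <= e -> online h e p -> online h e q ->
  exists tau, Rabs tau <= dist (gpow h (Z.of_nat i) $ y) y + 2 * d /\
   forall m m' s, dist p m = s -> dist q m = dist p q - s ->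
     dist p m' = s + tau -> dist q m' = dist p q - (s + tau) ->
     e + 5 * d <= s <= dist p q - (e + 5 * d) ->
     e + 5 * d <= s + tau <= dist p q - (e + 5 * d) -> dist (gpow h (Z.of_nat i) $ m) m' <= 14 * d.
Proof.
  intros hl he hp hq. consts.
  set (g := gpow h (Z.of_nat i)).
  set (B := dist p q + dist p y + 11 * d + dist (g $ y) y).
  destruct (hp y y) as [n0 h0]. destruct (hq y y) as [n1 h1]. destruct (hl y p B) as [n2 h2].
  set (n := Z.max n0 (Z.max n1 n2)).
  specialize (h0 n n ltac:(lia) ltac:(lia)). specialize (h1 n n ltac:(lia) ltac:(lia)).
  destruct (h2 n ltac:(lia)) as [h3 h4].
  set (P := gpow h (-n) $ y) in *. set (Q := gpow h n $ y) in *.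
  assert (far : forall k, B <= dist (gpow h k $ y) p ->
     dist p q + dist p y + 10 * d < gromov (gpow h k $ y) ((g^-1) $ gpow h k $ y) p).
  { intros k hk. pose proof (gromov_lip (gpow h k $ y) ((g^-1) $ gpow h k $ y) (gpow h k $ y) p) as l.
    rewrite (gromov_sym ((g^-1) $ _)) in l.
    assert (e0 : gromov (gpow h k $ y) (gpow h k $ y) p = dist (gpow h k $ y) p).
    { unfold gromov; rewrite dist_refl; lra. }
    assert (e1 : dist (gpow h k $ y) ((g^-1) $ gpow h k $ y) = dist (g $ y) y).
    { unfold g. rewrite <- gpow_opp, <- !act_mul, <- gpow_add.
      replace (- Z.of_nat i + k)%Z with (k + - Z.of_nat i)%Z by lia.
      rewrite gpow_add, act_mul, act_dist, gpow_opp, dist_sym, dist_act_l, ginv_inv, dist_sym. reflexivity. }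
    unfold B in hk. lra. }
  pose proof (far _ h4) as fP. pose proof (far _ h3) as fQ. fold P in fP. fold Q in fQ.
  destruct (Rle_dec (gromov P q p) (e + d)) as [hs|hs].
  - apply (slide_fin P Q p q g e y); auto.
  - apply (slide_fin Q P p q g e y); auto; [rewrite gromov_sym; auto|rewrite gromov_sym; auto|].
    apply (hyp_cut Q P q p e); [rewrite gromov_sym; auto|lra].
Qed.

End Axes.

(** * Elementary subgroups *)

Section Elementary.
Context {H : acyl_action}.
Local Notation X := (spc H).
Local Notation G := (grp H).
Local Notation d := (delta H).
Implicit Types p q x y z : X.
Implicit Types g h : G.

(** Both orders of composition bring [sg s] near [sg (s + t1 + t2)]. Each takes two slides with
    error [14 * d], whence [56 * d]. *)
Lemma commutator_shift p q e sg h1 h2 t1 t2 s :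
  (forall s, 0 <= s <= dist p q -> dist p (sg s) = s /\ dist q (sg s) = dist p q - s) ->
  0 <= e ->
  (forall m m' s, dist p m = s -> dist q m = dist p q - s ->
     dist p m' = s + t1 -> dist q m' = dist p q - (s + t1) ->
     e + 5 * d <= s <= dist p q - (e + 5 * d) ->
     e + 5 * d <= s + t1 <= dist p q - (e + 5 * d) -> dist (h1 $ m) m' <= 14 * d) ->
  (forall m m' s, dist p m = s -> dist q m = dist p q - s ->
     dist p m' = s + t2 -> dist q m' = dist p q - (s + t2) ->
     e + 5 * d <= s <= dist p q - (e + 5 * d) ->
     e + 5 * d <= s + t2 <= dist p q - (e + 5 * d) -> dist (h2 $ m) m' <= 14 * d) ->
  e + 5 * d + Rabs t1 + Rabs t2 <= s -> s <= dist p q - (e + 5 * d + Rabs t1 + Rabs t2) ->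
  dist ((h2 * h1)^-1 * (h1 * h2) $ sg s) (sg s) <= 56 * d.
Proof.
  intros hsg he H1 H2 a b. consts.
  assert (c1 : - Rabs t1 <= t1 <= Rabs t1) by (unfold Rabs; destruct (Rcase_abs _); lra).
  assert (c2 : - Rabs t2 <= t2 <= Rabs t2) by (unfold Rabs; destruct (Rcase_abs _); lra).
  pose proof (Rabs_pos t1). pose proof (Rabs_pos t2).
  rewrite act_mul, dist_act_l, ginv_inv, !act_mul.
  destruct (hsg s ltac:(lra)) as [p0 q0]. destruct (hsg (s + t1) ltac:(lra)) as [p1 q1].
  destruct (hsg (s + t2) ltac:(lra)) as [p2 q2]. destruct (hsg (s + t1 + t2) ltac:(lra)) as [p3 q3].
  pose proof (H1 (sg s) (sg (s + t1)) s p0 q0 p1 q1 ltac:(lra) ltac:(lra)) as A1.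
  pose proof (H2 (sg s) (sg (s + t2)) s p0 q0 p2 q2 ltac:(lra) ltac:(lra)) as A2.
  pose proof (H2 (sg (s + t1)) (sg (s + t1 + t2)) (s + t1) p1 q1 p3 q3 ltac:(lra) ltac:(lra)) as A3.
  pose proof (H1 (sg (s + t2)) (sg (s + t1 + t2)) (s + t2) p2 q2 ltac:(lra) ltac:(lra) ltac:(lra) ltac:(lra)) as A4.
  pose proof (dist_tri _ (h1 $ h2 $ sg s) (h1 $ sg (s + t2)) (h2 $ h1 $ sg s)) as T1.
  pose proof (dist_tri _ (h1 $ sg (s + t2)) (sg (s + t1 + t2)) (h2 $ h1 $ sg s)) as T2.
  pose proof (dist_tri _ (sg (s + t1 + t2)) (h2 $ sg (s + t1)) (h2 $ h1 $ sg s)) as T3.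
  rewrite !act_dist in *. rewrite (dist_sym _ (sg (s + t1 + t2)) (h2 $ sg (s + t1))), (dist_sym _ (sg (s+t1)) _) in T3. lra.
Qed.

(* Two isometries translating along a long common segment: all commutators [h^i, h'] move the
   middle of the segment very little, so two of them coincide by acylindricity. *)
Lemma commute_of_overlap h h' p q e y y' : lox h -> lox h' -> 0 <= e ->
  online h e p -> online h e q -> online h' e p -> online h' e q ->
  2 * (INR (acylN H) * dist (h $ y) y + dist (h' $ y') y') + kappa H + 2 * e + 20 * d <= dist p q ->
  exists n, (n <> 0)%Z /\ (h' * gpow h n)%g = (gpow h n * h')%g.
Proof.
  intros l l' he o1 o2 o1' o2' hlen. consts.
  destruct (geodesic_fun p q) as [sg hsg].
  set (N := acylN H) in *. set (T := dist (h $ y) y) in *. set (T' := dist (h' $ y') y') in *.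
  (* [M] bounds the sum of the two shifts, [slide] adding [2 * d] to each displacement. At distance
     [e + 5 * d + M] from the ends all intermediate points stay within reach of [slide]. *)
  set (M := INR N * T + T' + 4 * d).
  assert (hT : 0 <= T) by apply dist_ge0. assert (hT' : 0 <= T') by apply dist_ge0.
  assert (hNT : 0 <= INR N * T) by (apply Rmult_le_pos; auto; apply pos_INR).
  set (s1 := e + 5 * d + M). set (s2 := s1 + kappa H).
  assert (hs2 : s2 <= dist p q - (e + 5 * d + M)) by (unfold s2, s1, M; lra).
  set (f := fun i : nat => ((h' * gpow h (Z.of_nat i))^-1 * (gpow h (Z.of_nat i) * h'))%g).
  destruct (slide h' p q e y' 1 l' he o1' o2') as [t' [ht' st']].
  rewrite gpow_1 in ht', st'. fold T' in ht'.
  assert (hf : forall n, (n <= N)%nat -> dist (f n $ sg s1) (sg s1) <= 100 * d /\ dist (f n $ sg s2) (sg s2) <= 100 * d).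
  { intros n hn. destruct (slide h p q e y n l he o1 o2) as [t [ht st]].
    assert (ht2 : Rabs t <= INR N * T + 2 * d).
    { pose proof (dist_gpow_le h y n) as g. fold T in g.
      assert (INR n * T <= INR N * T) by (apply Rmult_le_compat_r; auto; apply le_INR; auto). lra. }
    assert (B : forall s, s1 <= s <= s2 -> dist (f n $ sg s) (sg s) <= 56 * d).
    { intros s hs. unfold f. apply (commutator_shift p q e sg (gpow h (Z.of_nat n)) h' t t' s); auto; unfold s1, M in *; lra. }
    split; eapply Rle_trans; try apply B; unfold s2; lra. }
  destruct (hsg s1) as [a1 _]; [unfold s2, s1, M in *; lra|].
  destruct (hsg s2) as [a2 _]; [unfold s2, s1, M in *; lra|].
  destruct (collision (fun g => dist (g $ sg s1) (sg s1) <= 100 * d /\ dist (g $ sg s2) (sg s2) <= 100 * d) N f) as [i [j [hij [hj eq]]]].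
  - intros L hL hP. apply (aact_acylindrical H (sg s1) (sg s2)); auto.
    apply Rle_ge. pose proof (dist_tri _ p (sg s1) (sg s2)). unfold s2 in *. lra.
  - exact hf.
  - exists (Z.of_nat j - Z.of_nat i)%Z. split; [lia|].
    (* [h'] has equal commutators with [h^i] and [h^j]; cancelling leaves that it commutes with
       their quotient. *)
    unfold f in eq. set (a := gpow h (Z.of_nat i)) in *.
    assert (ej : gpow h (Z.of_nat j) = (gpow h (Z.of_nat j - Z.of_nat i) * a)%g).
    { unfold a; rewrite <- gpow_add; f_equal; lia. }
    rewrite ej in eq. set (b := gpow h (Z.of_nat j - Z.of_nat i)) in *.
    assert (eb : (a * b = b * a)%g) by (unfold a, b; rewrite <- !gpow_add; f_equal; lia).
    rewrite !ginv_mul, <- !gmul_assoc in eq. apply gmul_eq_l in eq.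
    assert (e3 : (b * (h'^-1 * (a * h')) = h'^-1 * (b * (a * h')))%g).
    { rewrite eq. grp. }
    rewrite (gmul_assoc _ (h'^-1)%g b), (gmul_assoc _ b (h'^-1)%g) in e3. apply gmul_eq_r in e3.
    apply (gmul_eq_l (h'^-1)%g). rewrite gmul_VK, gmul_assoc, <- e3. grp.
Qed.

(** The base point is on the axis only up to [a + 4 * d], too coarse for [spot]. Points deep inside
    a geodesic from [y] to a far translate are on it up to [2 * d]. *)
Lemma deep_points a h y : 0 <= a <= 7000 * d -> axial a h y ->
  exists z1 z2, online h (2 * d) z1 /\ online h (2 * d) z2 /\ dist y z1 = 8000 * d /\ kappa H <= dist z1 z2.
Proof.
  intros ha hx. consts.
  destruct (axial_lox a h y ltac:(lra) hx y y (20000 * d + kappa H)) as [n hn].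
  destruct (hn n ltac:(lia)) as [hB _].
  pose proof (axial_online a h y ltac:(lra) hx) as oy.
  pose proof (online_stab h _ y _ (stab_pow h n) oy) as oq.
  set (q := gpow h n $ y) in *. rewrite (dist_sym _ q y) in hB.
  destruct (geodesic_fun y q) as [sg hsg].
  destruct (hsg (8000 * d) ltac:(lra)) as [a1 a2].
  destruct (hsg (8000 * d + kappa H) ltac:(lra)) as [b1 b2].
  exists (sg (8000 * d)), (sg (8000 * d + kappa H)).
  assert (on : forall s, 8000 * d <= s <= 8000 * d + kappa H -> online h (2 * d) (sg s)).
  { intros s hs. destruct (hsg s ltac:(lra)) as [c1 c2].
    replace (2 * d) with (0 + 2 * d) by lra.
    apply (online_between h (a + 4 * d) 0 y q); auto; try lra.
    rewrite (gromov_geo y q (sg s) s); lra. }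
  repeat split; [apply on; lra | apply on; lra | auto |].
  pose proof (dist_tri _ y (sg (8000 * d)) (sg (8000 * d + kappa H))). lra.
Qed.

(** Elements of [stab h] keep the axis without loss, so they put the two deep points onto one line;
    bounded displacement confines the positions, and [spot] counts. *)
Lemma stab_bounded a h y B (K : nat) l : 0 <= a <= 7000 * d -> axial a h y -> 0 <= B ->
  2 * B + 32000 * d < INR K * d -> NoDup l ->
  (forall g, In g l -> stab h g /\ dist (g $ y) y <= B) -> (length l <= 2 * K * acylN H)%nat.
Proof.
  intros ha hx hB hK hl hg. consts.
  destruct (deep_points a h y ha hx) as [z1 [z2 [o1 [o2 [e1 e2]]]]].
  destruct (eventually_list l (fun g n m =>
     gromov (gpow h (-n) $ y) (gpow h m $ y) (g $ z1) <= 2 * d /\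
     gromov (gpow h (-n) $ y) (gpow h m $ y) (g $ z2) <= 2 * d)) as [n0 h0].
  { intros g hi. destruct (hg g hi) as [s _].
    destruct (online_stab h _ z1 g s o1 y y) as [n1 h1].
    destruct (online_stab h _ z2 g s o2 y y) as [n2 h2].
    exists (Z.max n1 n2). intros n m c1 c2. split; [apply h1|apply h2]; lia. }
  apply (spot (gpow h (-n0) $ y) (gpow h n0 $ y) z1 z2 (2 * d)
    (dist z1 (gpow h (-n0) $ y) - (B + 16000 * d)) (2 * B + 32000 * d) K l); auto; try lra.
  intros g hi. destruct (h0 g hi n0 n0 ltac:(lia) ltac:(lia)) as [c1 c2].
  destruct (hg g hi) as [_ hd].
  split; [auto|split; [auto|]].
  pose proof (dist_tri _ (g $ z1) (g $ y) z1) as t1. pose proof (dist_tri _ (g $ y) y z1) as t2.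
  rewrite act_dist, (dist_sym _ z1 y) in t1.
  pose proof (line_dist_ge (gpow h (-n0) $ y) (g $ z1) z1) as t3.
  unfold Rabs in t3; destruct (Rcase_abs _); lra.
Qed.

Lemma stab_bound_exists a h y B : 0 <= a <= 7000 * d -> axial a h y -> 0 <= B ->
  exists K, forall l, NoDup l ->
  (forall g, In g l -> stab h g /\ dist (g $ y) y <= B) -> (length l <= K)%nat.
Proof.
  intros ha hx hB. consts.
  destruct (INR_unbounded ((2 * B + 32000 * d) / d)) as [K hK].
  exists (2 * K * acylN H)%nat. intros l hl hg. apply (stab_bounded a h y B K l ha hx hB); auto.
  apply Rmult_gt_compat_r with (r := d) in hK; [|lra]. unfold Rdiv in hK.
  rewrite Rmult_assoc, Rinv_l in hK by lra. lra.
Qed.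

Lemma toward_step a k p e z (n : nat) : 0 <= a <= 7000 * d -> 0 <= e <= 7000 * d -> axial a k p ->
  gromov (gpow k (- Z.of_nat (S (S n))) $ p) (gpow k (Z.of_nat (S (S n))) $ p) z <= e ->
  gromov (gpow k (- Z.of_nat (S (S n))) $ p) z p <= a + 3 * d ->
  dist (k $ p) p <= dist z p -> dist (k $ p) p - a - e - 2 * d <= gromov z (k $ p) p.
Proof.
  intros ha he hx h1 h2 h3. consts.
  pose proof (axial_forward a k p n ltac:(lra) hx) as hf.
  destruct hx as [hx1 hx2].
  set (P := gpow k (- _) $ p) in *.
  rewrite gpow_S, act_mul in h1. set (w := gpow k (Z.of_nat (S n)) $ p) in *.
  pose proof (gromov_swap z P p) as w1.
  assert (c1 : gromov (k $ w) p z <= e + d).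
  { apply (hyp_cut (k $ w) P p z e); [rewrite gromov_sym; auto|].
    pose proof (gromov_swap p P z) as w1'. rewrite (gromov_sym z P p) in w1'.
    rewrite (gromov_sym P p z). lra. }
  pose proof (gromov_swap z (k $ w) p) as w2.
  rewrite (gromov_sym p _ z) in w2.
  pose proof (gromov_swap p (k $ w) (k $ p)) as w3.
  rewrite (gromov_act_x k p (k $ w) p), !act_VK in w3.
  pose proof (hyp_min z (k $ w) (k $ p) p (dist (k $ p) p - a - e - d)) as hm.
  rewrite (gromov_sym z (k $ w) p), (gromov_sym (k $ w) (k $ p) p) in hm.
  rewrite (gromov_sym z (k $ w) p) in w2.
  rewrite (dist_sym _ p z) in *.
  assert (e0 : gromov z (k $ w) p + gromov (k $ w) p z = dist z p).
  { unfold gromov. rewrite (dist_sym _ p z), (dist_sym _ (k $ w) z). lra. }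
  rewrite (gromov_sym z (k $ w) p) in e0.
  assert (hm' : dist (k $ p) p - a - e - d - d <= gromov z (k $ p) p) by (apply hm; lra).
  lra.
Qed.

(** The ends of the axis lie in different directions from [p], so [z] is away from at least one of
    them, and the step by [h] or its inverse towards the other end approaches [z]. *)
Lemma toward a h p e z : 0 <= a <= 7000 * d -> 0 <= e <= 7000 * d -> axial a h p -> online h e z ->
  dist (h $ p) p <= dist z p -> exists k, dist (gpow h k $ p) p = dist (h $ p) p /\
  dist (h $ p) p - a - e - 2 * d <= gromov z (gpow h k $ p) p.
Proof.
  intros ha he hx oz hd. consts.
  destruct (oz p p) as [n0 h0]. set (n := Z.to_nat (Z.max n0 0)).
  specialize (h0 (Z.of_nat (S (S n))) (Z.of_nat (S (S n))) ltac:(lia) ltac:(lia)).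
  pose proof (axial_two_sided a h p (S n) (S n) ltac:(lra) hx) as h2.
  destruct (Rle_dec (gromov (gpow h (- Z.of_nat (S (S n))) $ p) z p) (a + 3 * d)) as [hs|hs].
  - exists 1%Z. rewrite gpow_1. split; auto. apply (toward_step a h p e z n); auto.
  - assert (hs' : gromov (gpow h (Z.of_nat (S (S n))) $ p) z p <= a + 3 * d).
    { replace (a + 3 * d) with (a + 2 * d + d) by lra.
      apply (hyp_cut _ (gpow h (- Z.of_nat (S (S n))) $ p)); [rewrite gromov_sym; auto|lra]. }
    assert (hx' := axial_inv _ _ _ hx).
    pose proof (toward_step a (h^-1)%g p e z n ha he hx') as c.
    rewrite !gpow_inv, Z.opp_involutive in c.
    rewrite (gromov_sym (gpow h (Z.of_nat (S (S n))) $ p) _ z), (dist_act_l (h^-1)%g p p), ginv_inv, (dist_sym _ p (h $ p)) in c.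
    exists (-1)%Z. split; [rewrite <- (gpow_1 h) at 2; apply (dist_gpow_opp h p 1)|].
    rewrite gpow_m1. exact (c h0 hs' hd).
Qed.

(** The powers of [h] act coboundedly on the axis: at a translate almost closest to [p], a step
    given by [toward] would gain much more than [d] if the distance exceeded one period. *)
Lemma orbit_dense a h p e z : 0 <= a <= 7000 * d -> 0 <= e <= 7000 * d -> axial a h p -> online h e z ->
  exists j, dist (gpow h j $ z) p <= dist (h $ p) p.
Proof.
  intros ha he hx oz. consts.
  destruct (near_min (fun j : Z => dist (gpow h j $ z) p) d) as [j hj].
  { exact (inhabits 0%Z). } { lra. } { intros; apply dist_ge0. }
  exists j. set (z' := gpow h j $ z) in *.
  assert (oz' : online h e z') by (apply online_stab; auto; apply stab_pow).
  destruct (Rle_dec (dist z' p) (dist (h $ p) p)) as [|hn]; auto. exfalso. apply Rnot_le_lt in hn.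
  assert (hj1 : forall k, dist z' p <= dist z' (gpow h k $ p) + d).
  { intros k. specialize (hj (j - k)%Z). unfold z' at 1. 
    replace (j - k)%Z with (- k + j)%Z in hj by lia.
    rewrite gpow_add, act_mul, gpow_opp, (dist_act_l ((gpow h k)^-1)%g), ginv_inv in hj. exact hj. }
  destruct (toward a h p e z' ha he hx oz' ltac:(lra)) as [k [ek hk]].
  specialize (hj1 k). pose proof (gromov_dist z' (gpow h k $ p) p) as gd.
  destruct hx as [_ hx]. lra.
Qed.

(** By [orbit_dense] every power of [h'] is, up to a power of [h], an element of [stab h] of bounded
    displacement. There are finitely many of these, so two powers of [h'] differ by a power of
    [h]. *)
Lemma commens_of_stab a h h' y : 0 <= a <= 7000 * d - 4 * d -> axial a h y -> lox h' ->
  stab h h' -> commensurable h h'.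
Proof.
  intros ha hx l' hs. consts.
  assert (oy : online h (a + 4 * d) y) by (apply axial_online; auto; lra).
  assert (hsk : forall k, stab h (gpow h' (Z.of_nat k))).
  { induction k as [|k IH]; [apply stab_1|]. rewrite gpow_S. apply stab_mul; auto. }
  assert (hj : forall k, exists j, dist (gpow h j $ gpow h' (Z.of_nat k) $ y) y <= dist (h $ y) y).
  { intros k. apply (orbit_dense a h y (a + 4 * d)); auto; try lra. apply online_stab; auto. }
  destruct (stab_bound_exists a h y (dist (h $ y) y) ltac:(lra) hx) as [K hK]; [apply dist_ge0|].
  set (j := fun k => proj1_sig (constructive_indefinite_description _ (hj k))).
  destruct (collision (fun g => stab h g /\ dist (g $ y) y <= dist (h $ y) y) K
     (fun k => gpow h (j k) * gpow h' (Z.of_nat k))%g hK) as [k [l [hkl [_ e]]]].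
  - intros k _. split; [apply stab_mul; [apply stab_pow|auto]|].
    rewrite act_mul. unfold j. destruct (constructive_indefinite_description _ _); auto.
  - assert (e2 : gpow h' (Z.of_nat l - Z.of_nat k) = gpow h (- j l + j k)).
    { apply (gmul_eq_r (gpow h' (Z.of_nat k))). rewrite <- gpow_add.
      apply (gmul_eq_l (gpow h (j l))). replace (Z.of_nat l - Z.of_nat k + Z.of_nat k)%Z with (Z.of_nat l) by lia.
      rewrite <- e, gmul_assoc, <- gpow_add. f_equal. f_equal. lia. }
    exists (Z.of_nat l - Z.of_nat k)%Z, (- j l + j k)%Z. repeat split; auto; try lia.
    intros e3. rewrite e3, gpow_0 in e2.
    apply (lox_gpow_ne1 h' (Z.of_nat l - Z.of_nat k) l' (inhabits y)); auto. lia.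
Qed.

Lemma commens_of_overlap a h h' p q e y y' : 0 <= a <= 6900 * d -> axial a h y -> lox h' -> 0 <= e ->
  online h e p -> online h e q -> online h' e p -> online h' e q ->
  2 * (INR (acylN H) * dist (h $ y) y + dist (h' $ y') y') + kappa H + 2 * e + 20 * d <= dist p q ->
  commensurable h h'.
Proof.
  intros ha hx l' he o1 o2 o1' o2' hl. consts.
  destruct (commute_of_overlap h h' p q e y y') as [n [hn hc]]; auto.
  - apply (axial_lox a _ y); auto; lra.
  - apply (commens_of_stab a h h' y); auto; [lra|].
    exists n, n. repeat split; auto. rewrite gpow_conj, hc. grp.
Qed.

Lemma stab_virtually_cyclic a h y : 0 <= a <= 6900 * d -> axial a h y ->
  is_infinite_set (stab h) /\ virtually_cyclic (stab h).
Proof.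
  intros ha hx. consts.
  assert (hl := axial_lox a h y ltac:(lra) hx). split.
  - intros [L hL].
    destruct (collision (stab h) (length L) (fun n => gpow h (Z.of_nat n))) as [i [j [hij [_ e]]]].
    + intros l hl1 hl2. apply NoDup_incl_length; auto. intros x hx2; auto.
    + intros; apply stab_pow.
    + apply (lox_gpow_ne1 h (Z.of_nat j - Z.of_nat i) hl (inhabits y)); [lia|].
      unfold Z.sub. rewrite gpow_add, gpow_opp, <- e. apply gmul_Vr.
  - destruct (stab_bound_exists a h y (dist (h $ y) y) ltac:(lra) hx) as [K hK]; [apply dist_ge0|].
    destruct (finite_of_bounded (fun g => stab h g /\ dist (g $ y) y <= dist (h $ y) y) K hK) as [L [_ hL]].
    (* [orbit_dense] multiplies by a power of [h] on the left, while [virtually_cyclic] has the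
       power on the right; hence it is applied to inverses and the representatives are inverted
       back. *)
    exists h, (map (fun g => (g^-1)%g) L). split; [|split].
    + rewrite <- gpow_1. apply stab_pow.
    + intros l hl2. apply in_map_iff in hl2 as [g [<- hg]]. apply stab_inv. apply hL, hg.
    + intros g hg.
      assert (og : online h (a + 4 * d) ((g^-1) $ y)).
      { apply online_stab; [apply stab_inv; auto|]. apply axial_online; auto; lra. }
      destruct (orbit_dense a h y (a + 4 * d) _ ltac:(lra) ltac:(lra) hx og) as [j hj].
      exists (gpow h j * g^-1)^-1%g, j. split.
      * apply in_map_iff. exists (gpow h j * g^-1)%g. split; auto. apply hL. split.
        -- apply stab_mul; [apply stab_pow | apply stab_inv; auto].
        -- rewrite act_mul. exact hj.
      * grp.
Qed.

(** The one place where the hypothesis on infinite virtually cyclic subgroups enters: [stab h] is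
    such a subgroup. *)
Lemma outside_stab a h y (U : list G) : 0 <= a <= 6900 * d -> axial a h y ->
  not_in_infinite_virtually_cyclic U -> exists u, In u U /\ ~ stab h u.
Proof.
  intros ha hx hU. apply NNPP; intros hn. apply hU. exists (stab h).
  destruct (stab_virtually_cyclic a h y ha hx) as [h1 h2].
  split; [apply stab_subgroup|]. split; auto. split; auto.
  intros u hu. apply NNPP; intros hs. apply hn; eauto.
Qed.
End Elementary.

(** * Counting products *)

Section Words.
Context {G : Group}.
Implicit Types U S : list G.

Definition eq_dec_cl {T : Type} (x y : T) : {x = y} + {x <> y} := excluded_middle_informative (x = y).

Fixpoint valid S (al : G -> G -> Prop) (l : list G) : Prop :=
  match l with
  | [] => True
  | s :: l' => In s S /\ match l' with [] => True | t :: _ => al s t end /\ valid S al l'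
  end.

Fixpoint sep (b : G) (l : list G) : G :=
  match l with
  | [] => gone
  | s :: l' => match l' with [] => s | _ => gmul s (gmul b (sep b l')) end
  end.

Fixpoint chains S (al : G -> G -> Prop) (k : nat) (s : G) : list (list G) :=
  match k with
  | O => [[s]]
  | Datatypes.S k => map (cons s) (flat_map (chains S al k) (sel (al s) S))
  end.

Lemma chains_spec S al k s l : In s S -> In l (chains S al k s) ->
  valid S al l /\ length l = Datatypes.S k /\ exists l', l = s :: l'.
Proof.
  revert s l; induction k as [|k IH]; intros s l hs hl.
  - destruct hl as [<-|[]]. simpl. repeat split; eauto.
  - simpl in hl. apply in_map_iff in hl as [l' [<- hl]].
    apply in_flat_map in hl as [t [ht hl]]. apply in_sel in ht as [ht hst].
    destruct (IH t l' ht hl) as [h1 [h2 [l'' h3]]]. subst l'.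
    split; [|split; [simpl in *; auto|eauto]]. simpl in *. tauto.
Qed.

Lemma NoDup_flat_map_hd {A} (f : A -> list (list A)) (L : list A) :
  NoDup L -> (forall a, In a L -> NoDup (f a)) ->
  (forall a l, In a L -> In l (f a) -> exists l', l = a :: l') -> NoDup (flat_map f L).
Proof.
  induction L as [|a L IH]; intros hL h1 h2; [constructor|].
  simpl. inversion hL as [|? ? hna hL']; subst.
  apply NoDup_app.
  - apply h1; simpl; auto.
  - apply IH; auto; intros; [apply h1|apply (h2 _ l)]; simpl; auto.
  - intros l hl hl2. apply in_flat_map in hl2 as [b [hb hl2]].
    destruct (h2 a l) as [l1 e1]; simpl; auto. destruct (h2 b l) as [l2 e2]; simpl; auto.
    congruence.
Qed.

Lemma chains_NoDup S al k s : NoDup S -> In s S -> NoDup (chains S al k s).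
Proof.
  intros hS; revert s; induction k as [|k IH]; intros s hs.
  - simpl. constructor; [simpl; tauto|constructor].
  - simpl. apply Injective_map_NoDup; [intros x y e; congruence|].
    apply NoDup_flat_map_hd.
    + apply NoDup_sel; auto.
    + intros a ha; apply in_sel in ha as [ha _]; auto.
    + intros a l ha hl; apply in_sel in ha as [ha _]. eapply chains_spec; eauto.
Qed.

Lemma length_flat_map_ge {A B} (f : A -> list B) (L : list A) c :
  (forall a, In a L -> (c <= length (f a))%nat) -> (length L * c <= length (flat_map f L))%nat.
Proof.
  induction L as [|a L IH]; intros h; [simpl; lia|].
  simpl. rewrite length_app. pose proof (h a (or_introl eq_refl)).
  assert (length L * c <= length (flat_map f L))%nat by (apply IH; intros; apply h; simpl; auto). lia.
Qed.

Lemma chains_length S al k s c : In s S ->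
  (forall t, In t S -> (c <= length (sel (al t) S))%nat) -> (c ^ k <= length (chains S al k s))%nat.
Proof.
  intros hs hc; revert s hs; induction k as [|k IH]; intros s hs; [simpl; lia|].
  simpl chains. rewrite length_map.
  eapply Nat.le_trans; [|apply (length_flat_map_ge _ _ (c ^ k))].
  - rewrite Nat.pow_succ_r'. apply Nat.mul_le_mono_r. auto.
  - intros a ha; apply in_sel in ha as [ha _]; auto.
Qed.

(** The product [g] is fixed, the length of the word is not. A word with a single letter is its own
    product, so only words containing a separator are in question. *)
Definition few_heads S al (b : G) (M : nat) := forall g P, NoDup P ->
  (forall s, In s P -> exists t l, valid S al (s :: t :: l) /\ sep b (s :: t :: l) = g) ->
  (length P <= M)%nat.

(** The first letter takes at most [M] values, and it determines the product of the remaining word.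
    The last letter is determined by its product, which leaves [k] choices. *)
Lemma sep_fiber S al b M k g L : few_heads S al b M -> NoDup L ->
  (forall l, In l L -> valid S al l /\ length l = Datatypes.S k /\ sep b l = g) ->
  (length L <= M ^ k)%nat.
Proof.
  intros hM; revert g L; induction k as [|k IH]; intros g L hL h.
  - simpl. assert (incl L [[g]]).
    { intros l hl. destruct (h l hl) as [_ [h2 h3]].
      destruct l as [|s [|t l]]; simpl in *; try lia. left; congruence. }
    apply (NoDup_incl_length (l' := [[g]])) in H; auto.
  - set (hd := fun l : list G => match l with [] => gone | s :: _ => s end).
    set (Q := nodup eq_dec_cl (map hd L)).
    assert (hQ : (length Q <= M)%nat).
    { apply (hM g); [apply NoDup_nodup|]. intros s hs. apply nodup_In in hs.
      apply in_map_iff in hs as [l [e hl]]. destruct (h l hl) as [h1 [h2 h3]].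
      destruct l as [|s' [|t l]]; simpl in h2; try lia. simpl in e; subst s'. eauto. }
    rewrite Nat.pow_succ_r'.
    eapply Nat.le_trans; [apply (fiber_bound hd L Q (M ^ k))|apply Nat.mul_le_mono_r; auto].
    + intros l hl. apply nodup_In, in_map; auto.
    + intros a _. rewrite <- (length_map (@tl G)).
      apply (IH (gmul (ginv b) (gmul (ginv a) g))).
      * assert (hn : NoDup (sel (fun x => hd x = a) L)) by (apply NoDup_sel; auto).
        assert (hh : forall l, In l (sel (fun x => hd x = a) L) -> l = a :: tl l).
        { intros l hl. apply in_sel in hl as [hl e]. destruct (h l hl) as [_ [h2 _]].
          destruct l; simpl in *; [lia|congruence]. }
        revert hn hh. generalize (sel (fun x => hd x = a) L) as L'. clear.
        induction L' as [|l L' IH]; intros hn hh; [constructor|].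
        inversion hn as [|? ? hnl hn']; subst. simpl. constructor.
        -- intros hi. apply in_map_iff in hi as [l2 [e hl2]]. apply hnl.
           rewrite (hh l) by (simpl; auto). rewrite <- e, <- (hh l2) by (simpl; auto). auto.
        -- apply IH; auto. intros; apply hh; simpl; auto.
      * intros l' hl'. apply in_map_iff in hl' as [l [<- hl]]. apply in_sel in hl as [hl e].
        destruct (h l hl) as [h1 [h2 h3]].
        destruct l as [|s [|t l]]; cbn [length] in h2; try lia. cbn [hd] in e; subst s.
        cbn [tl]. split; [apply h1|]. split; [cbn [length]; lia|].
        change (gmul a (gmul b (sep b (t :: l))) = g) in h3. rewrite <- h3. grp.
Qed.

Lemma sep_in_Upow U b l : l <> [] -> incl l U -> In b U -> Upow U (2 * length l - 1) (sep b l).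
Proof.
  intros hl hi hb. induction l as [|s l IH]; [congruence|].
  destruct l as [|t l].
  - exists [s]. simpl. split; [reflexivity|]. split; [intros u [<-|[]]; apply hi; simpl; auto|].
    rewrite gmul_1r; reflexivity.
  - destruct IH as [w [h1 [h2 h3]]]; [congruence|intros x hx; apply hi; simpl; auto|].
    exists (s :: b :: w). split; [simpl in *; lia|]. split.
    + intros u [<-|[<-|hu]]; auto. apply hi; simpl; auto.
    + change (gmul s (gmul b (sep b (t :: l))) = gmul s (gmul b (prod_list w))). rewrite h3. reflexivity.
Qed.

Lemma valid_incl S al l : valid S al l -> incl l S.
Proof.
  induction l as [|s l IH]; intros h x hx; [destruct hx|].
  destruct h as [h1 [_ h2]]. destruct hx as [<-|hx]; auto. apply IH; auto.
Qed.

Lemma many_products U S al b M k : NoDup S -> incl S U -> In b U ->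
  (forall s, In s S -> (2 * length (sel (fun t => ~ al s t) S) <= length S)%nat) ->
  few_heads S al b M ->
  exists L, NoDup L /\ (forall x, In x L -> Upow U (2 * k + 1) x) /\
    (length S ^ (k + 1) <= (2 * M) ^ k * length L)%nat.
Proof.
  intros hS hi hb hal hM.
  (* Every letter has at least [c] successors, half of [length S] rounded up; this gives
     [length S * c ^ k] words. *)
  set (c := ((length S + 1) / 2)%nat).
  assert (hc : (length S <= 2 * c)%nat).
  { unfold c. pose proof (Nat.div_mod (length S + 1) 2). pose proof (Nat.mod_upper_bound (length S + 1) 2). lia. }
  assert (hcs : forall t, In t S -> (c <= length (sel (al t) S))%nat).
  { intros t ht. specialize (hal t ht). pose proof (length_sel_split (al t) S).
    unfold c. pose proof (Nat.div_mod (length S + 1) 2). pose proof (Nat.mod_upper_bound (length S + 1) 2). lia. }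
  set (C := flat_map (chains S al k) S).
  assert (hC : NoDup C).
  { apply NoDup_flat_map_hd; auto; intros; [apply chains_NoDup; auto|eapply chains_spec; eauto]. }
  assert (hCl : (length S * c ^ k <= length C)%nat).
  { apply length_flat_map_ge. intros; apply chains_length; auto. }
  assert (hCv : forall l, In l C -> valid S al l /\ length l = Datatypes.S k).
  { intros l hl. apply in_flat_map in hl as [s [hs hl]]. destruct (chains_spec _ _ _ _ _ hs hl) as [? [? _]]; auto. }
  exists (nodup eq_dec_cl (map (sep b) C)). split; [apply NoDup_nodup|]. split.
  - intros x hx. apply nodup_In, in_map_iff in hx as [l [<- hl]]. destruct (hCv l hl) as [h1 h2].
    replace (2 * k + 1)%nat with (2 * length l - 1)%nat by lia. apply sep_in_Upow; auto.
    + intros e; subst l; simpl in h2; lia.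
    + intros y hy. apply hi. eapply valid_incl; eauto.
  - assert (hf : (length C <= length (nodup eq_dec_cl (map (sep b) C)) * M ^ k)%nat).
    { apply (fiber_bound (sep b)).
      - intros l hl. apply nodup_In, in_map; auto.
      - intros a _. apply (sep_fiber S al b M k a); auto; [apply NoDup_sel; auto|].
        intros l hl; apply in_sel in hl as [hl e]. destruct (hCv l hl); auto. }
    assert (h2 : (length S ^ k <= 2 ^ k * c ^ k)%nat) by (rewrite <- Nat.pow_mul_l; apply Nat.pow_le_mono_l; auto).
    rewrite Nat.pow_add_r, Nat.pow_1_r, Nat.pow_mul_l.
    set (A := (length S ^ k)%nat) in *. set (B := (2 ^ k)%nat) in *. set (D := (c ^ k)%nat) in *.
    set (E := (M ^ k)%nat) in *. set (F := length C) in *. set (n := length (nodup _ _)) in *.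
    set (s := length S) in *. clearbody A B D E F n s. clear - hCl hf h2.
    assert (A * s <= B * D * s)%nat by (apply Nat.mul_le_mono_r; auto).
    assert (B * (s * D) <= B * F)%nat by (apply Nat.mul_le_mono_l; auto).
    assert (B * F <= B * (n * E))%nat by (apply Nat.mul_le_mono_l; auto). lia.
Qed.

Fixpoint prods U n : list G :=
  match n with O => [gone] | Datatypes.S n => flat_map (fun u => map (gmul u) (prods U n)) U end.

Lemma in_prods U n x : In x (prods U n) <-> Upow U n x.
Proof.
  revert x; induction n as [|n IH]; intros x; split.
  - intros [<-|[]]. exists []. simpl. repeat split; auto; tauto.
  - intros [l [h1 [_ h3]]]. destruct l; simpl in *; [auto|lia].
  - simpl. intros hx. apply in_flat_map in hx as [u [hu hx]]. apply in_map_iff in hx as [y [<- hy]].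
    apply IH in hy as [l [h1 [h2 h3]]]. exists (u :: l). simpl. split; [auto|]. split.
    + intros v [<-|hv]; auto.
    + rewrite h3; reflexivity.
  - intros [l [h1 [h2 h3]]]. destruct l as [|u l]; simpl in h1; [lia|].
    simpl. apply in_flat_map. exists u. split; [apply h2; simpl; auto|].
    apply in_map_iff. exists (prod_list l). split; [auto|]. apply IH. exists l.
    repeat split; auto. intros; apply h2; simpl; auto.
Qed.

Lemma card_ge_Upow U n L r : NoDup L -> (forall x, In x L -> Upow U n x) -> r <= INR (length L) ->
  card_ge (Upow U n) r.
Proof.
  intros hL h hr. exists (nodup eq_dec_cl (prods U n)). split; [apply NoDup_nodup|]. split.
  - intros x. rewrite nodup_In. apply in_prods.
  - apply Rle_ge. eapply Rle_trans; [exact hr|]. apply le_INR. apply NoDup_incl_length; auto.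
    intros x hx. apply nodup_In, in_prods, h, hx.
Qed.

Lemma Upow_extend U n m L u : In u U -> NoDup L -> (forall x, In x L -> Upow U n x) ->
  exists L', NoDup L' /\ length L' = length L /\ forall x, In x L' -> Upow U (n + m) x.
Proof.
  intros hu hL h. induction m as [|m [L' [h1 [h2 h3]]]].
  - exists L. rewrite Nat.add_0_r. auto.
  - exists (map (gmul u) L'). split; [|split].
    + apply Injective_map_NoDup; auto. intros a b e; apply gmul_eq_l in e; auto.
    + rewrite length_map; auto.
    + intros x hx. apply in_map_iff in hx as [y [<- hy]]. destruct (h3 y hy) as [l [a1 [a2 a3]]].
      exists (u :: l). simpl. split; [lia|]. split; [intros v [<-|hv]; auto|]. rewrite a3; reflexivity.
Qed.

(** What the geometry has to deliver. In use, the loss [C] in passing to [S] and the ambiguity [M]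
    of the first letter depend on [delta], [kappa] and the acylindricity constant alone. *)
Definition good U (M C : nat) := exists S al b,
  NoDup S /\ incl S U /\ In b U /\ (length U <= C * length S)%nat /\
  (forall s, In s S -> (2 * length (sel (fun t => ~ al s t) S) <= length S)%nat) /\
  few_heads S al b M.

(** Words with [k + 1] letters from [S] have [2 * k + 1] factors, the largest odd number up to [n];
    for even [n] one factor [b] is added. *)
Lemma good_growth U M C n beta : (1 <= M)%nat -> (1 <= n)%nat -> good U M C ->
  0 <= beta -> beta * INR (2 * M * C) <= card U -> card_ge (Upow U n) (beta ^ ((n + 1) / 2)).
Proof.
  intros hM hn [S [al [b [h1 [h2 [h3 [h4 [h5 h6]]]]]]]] hb hbu.
  set (k := ((n + 1) / 2 - 1)%nat).
  assert (hk : ((n + 1) / 2 = k + 1)%nat /\ (2 * k + 1 <= n)%nat).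
  { unfold k. pose proof (Nat.div_mod (n + 1) 2). pose proof (Nat.mod_upper_bound (n + 1) 2). lia. }
  destruct hk as [-> hk].
  destruct (many_products U S al b M k h1 h2 h3 h5 h6) as [L [g1 [g2 g3]]].
  destruct (Upow_extend U _ (n - (2 * k + 1)) L b h3 g1 g2) as [L' [f1 [f2 f3]]].
  replace (2 * k + 1 + (n - (2 * k + 1)))%nat with n in f3 by lia.
  apply (card_ge_Upow U n L'); auto. rewrite f2.
  assert (hN : (length U ^ (k + 1) <= (2 * M * C) ^ (k + 1) * length L)%nat).
  { eapply Nat.le_trans; [apply Nat.pow_le_mono_l; exact h4|].
    rewrite !(Nat.pow_mul_l _ C), (Nat.pow_mul_l C).
    assert ((2 * M) ^ k <= (2 * M) ^ (k + 1))%nat by (apply Nat.pow_le_mono_r; lia).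
    assert (e : (C ^ (k+1) * length S ^ (k+1) <= C ^ (k+1) * ((2 * M) ^ (k + 1) * length L))%nat); [|lia].
    apply Nat.mul_le_mono_l. eapply Nat.le_trans; [exact g3|]. apply Nat.mul_le_mono_r; auto. }
  unfold card in hbu.
  destruct (Nat.eq_dec C 0) as [->|hC0].
  { simpl in h4. destruct U; [destruct h3|simpl in h4; lia]. }
  apply le_INR in hN. rewrite mult_INR, !pow_INR in hN.
  assert (hK : 0 < INR (2 * M * C)) by (apply lt_0_INR; nia).
  assert (hp : (beta * INR (2 * M * C)) ^ (k + 1) <= INR (length U) ^ (k + 1)).
  { apply pow_incr. split; auto. apply Rmult_le_pos; lra. }
  rewrite Rpow_mult_distr in hp.
  apply (Rmult_le_reg_r (INR (2 * M * C) ^ (k + 1))); [apply pow_lt; auto|]. lra.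
Qed.

(** For small [U], where the base of the power is at most 1 and a single product suffices. *)
Lemma trivial_growth U n beta m : U <> [] -> 0 <= beta <= 1 -> card_ge (Upow U n) (beta ^ m).
Proof.
  intros hU hb. destruct U as [|u U]; [congruence|].
  apply (card_ge_Upow _ n [prod_list (repeat u n)]).
  - constructor; [simpl; tauto|constructor].
  - intros x [<-|[]]. exists (repeat u n). split; [apply repeat_length|]. split; auto.
    intros v hv. apply repeat_spec in hv. subst; simpl; auto.
  - simpl. rewrite <- (pow1 m). apply pow_incr; auto.
Qed.
End Words.

Definition natceil (x : R) : nat := Z.to_nat (up x).
Lemma natceil_gt x : x < INR (natceil x).
Proof.
  unfold natceil. destruct (archimed x) as [h _].
  destruct (Z_lt_le_dec (up x) 0) as [hn|hn].
  - apply IZR_lt in hn. pose proof (pos_INR (Z.to_nat (up x))). lra.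
  - rewrite INR_IZR_INZ, Z2Nat.id by lia. lra.
Qed.

(** * Translation by elements that keep the ends of an axis *)

Section Shift.
Context {H : acyl_action}.
Local Notation X := (spc H).
Local Notation G := (grp H).
Local Notation d := (delta H).
Implicit Types p q x y z : X.
Implicit Types g h : G.

Lemma same_end a h y (n m : nat) : a <= 7000 * d -> axial a h y -> (n <= m)%nat ->
  INR n * d - a - 2 * d <= gromov (gpow h (- Z.of_nat n) $ y) (gpow h (- Z.of_nat m) $ y) y.
Proof.
  intros ha hx hnm. consts.
  pose proof (axial_growth a h y n ha hx) as gr.
  pose proof (gromov_swap (gpow h (- Z.of_nat n) $ y) (gpow h (- Z.of_nat m) $ y) y) as sw.
  rewrite (dist_sym _ y), dist_gpow_opp in sw.
  assert (ha0 : 0 <= a) by (destruct hx; eapply Rle_trans; [apply (@gromov_ge0 H)|eassumption]).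
  assert (gromov y (gpow h (- Z.of_nat m) $ y) (gpow h (- Z.of_nat n) $ y) <= a + 2 * d); [|lra].
  rewrite gromov_act_x, <- gpow_opp, <- !act_mul, <- gpow_add.
  destruct n as [|n].
  - simpl. rewrite act_1, gromov_id_l. lra.
  - destruct (Nat.eq_dec (S n) m) as [<-|hne].
    + replace (- - Z.of_nat (S n) + - Z.of_nat (S n))%Z with 0%Z by lia.
      rewrite gpow_0, act_1, gromov_sym, gromov_id_l. lra.
    + replace (- - Z.of_nat (S n))%Z with (Z.of_nat (S n)) by lia.
      replace (Z.of_nat (S n) + - Z.of_nat m)%Z with (- Z.of_nat (S (m - S n - 1)))%Z by lia.
      rewrite gromov_sym. apply axial_two_sided; auto.
Qed.

(** The relation between powers of [g h g^-1] and [h], with positive exponents, takes the point [P]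
    far out at the negative end to another point at the same end, see [eP]. By [busemann_shift] all
    points of the axis are then shifted by one [tau]. *)
Lemma pos_shift a h y g (zs : list X) e0 : a <= 7000 * d -> axial a h y -> pos_stab h g ->
  (forall z, In z zs -> online h e0 z) ->
  exists P Q tau, (forall z, In z zs -> gromov P Q z <= e0) /\
    forall z, In z zs -> Rabs (dist (g $ z) P - dist z P - tau) <= 2 * d.
Proof.
  intros ha hx [i [j [hij eq]]] hz. consts.
  assert (hij' : exists i j : nat, (0 < i)%nat /\ (0 < j)%nat /\
     gpow (g * h * g^-1)%g (Z.of_nat i) = gpow h (Z.of_nat j)).
  { destruct (Z_lt_le_dec 0 i).
    - assert (0 < j)%Z by nia.
      exists (Z.to_nat i), (Z.to_nat j). rewrite !Z2Nat.id by lia. repeat split; auto; lia.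
    - assert (j < 0)%Z by nia. assert (i <> 0)%Z by nia.
      exists (Z.to_nat (-i)), (Z.to_nat (-j)). rewrite !Z2Nat.id by lia.
      rewrite !gpow_opp, eq. repeat split; auto; lia. }
  clear i j hij eq. destruct hij' as [i [j [hi [hj eq]]]].
  destruct (eventually_list zs (fun z n m => gromov (gpow h (-n) $ y) (gpow h m $ y) z <= e0)) as [n0 hn0].
  { intros z hin. apply (hz z hin). }
  destruct (exists_nat_ge ((fold_right Rmax 0 (map (fun z => dist y z) zs) + a + 4 * d + dist y ((g^-1) $ y)) / d)) as [k0 hk0].
  set (B := fold_right Rmax 0 (map (fun z => dist y z) zs)) in *.
  assert (hB : forall z, In z zs -> dist y z <= B).
  { unfold B. clear. induction zs as [|z0 zs IH]; simpl; [tauto|]. intros z [<-|hin].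
    - apply Rmax_l.
    - eapply Rle_trans; [apply IH; auto|apply Rmax_r]. }
  set (k := (k0 + Z.to_nat n0)%nat).
  assert (hk : B + a + 4 * d + dist y ((g^-1) $ y) <= INR k * d).
  { apply Rmult_le_compat_r with (r := d) in hk0; [|lra]. unfold Rdiv in hk0.
    rewrite Rmult_assoc, Rinv_l in hk0 by lra. unfold k. rewrite plus_INR.
    pose proof (pos_INR (Z.to_nat n0)). nra. }
  set (P := gpow h (- Z.of_nat (j * k)) $ y).
  exists P, (gpow h (Z.of_nat (j * k)) $ y), (dist y ((g^-1) $ P) - dist y P).
  split.
  - intros z hin. apply hn0; auto; unfold k; nia.
  - assert (eP : (g^-1) $ P = gpow h (- Z.of_nat (i * k)) $ (g^-1) $ y).
    { unfold P. rewrite <- !act_mul. f_equal.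
      rewrite (Nat2Z.inj_mul j), (Nat2Z.inj_mul i), <- !Z.mul_opp_r, !gpow_mul, <- eq, gpow_conj, gpow_conj. grp. }
    assert (big : B + d < gromov P ((g^-1) $ P) y).
    { rewrite eP. pose proof (gromov_lip (gpow h (- Z.of_nat (i * k)) $ y) (gpow h (- Z.of_nat (i * k)) $ (g^-1) $ y) P y) as l.
      rewrite act_dist, (gromov_sym _ P y), (gromov_sym _ P y) in l.
      assert (hs : INR k * d - a - 2 * d <= gromov P (gpow h (- Z.of_nat (i * k)) $ y) y).
      { assert (INR k <= INR (j * k) /\ INR k <= INR (i * k)) as [] by (split; apply le_INR; nia).
        unfold P. destruct (Nat.le_ge_cases (j * k) (i * k)) as [hle|hle].
        - pose proof (same_end a h y _ _ ha hx hle). nra.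
        - pose proof (same_end a h y _ _ ha hx hle). rewrite gromov_sym. nra. }
      lra. }
    intros z hin. rewrite (dist_act_l g z P).
    apply (busemann_shift P ((g^-1) $ P) y z). specialize (hB z hin). lra.
Qed.

Lemma pos_disp a h y g z1 z2 e0 : a <= 7000 * d -> axial a h y -> pos_stab h g ->
  online h e0 z1 -> online h e0 z2 -> dist (g $ z1) z1 <= dist (g $ z2) z2 + 2 * e0 + 6 * d.
Proof.
  intros ha hx hg o1 o2.
  assert (s := pos_stab_stab _ _ hg).
  destruct (pos_shift a h y g [z1; z2; g $ z1; g $ z2] e0 ha hx hg) as [P [Q [tau [h1 h2]]]].
  - intros z [<-|[<-|[<-|[<-|[]]]]]; auto; apply online_stab; auto.
  - pose proof (line_dist P Q (g $ z1) z1 e0) as l1.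
    pose proof (line_dist_ge P (g $ z2) z2) as l2.
    pose proof (h2 z1 ltac:(simpl; auto)). pose proof (h2 z2 ltac:(simpl; auto)).
    specialize (l1 ltac:(apply h1; simpl; auto) ltac:(apply h1; simpl; auto)).
    unfold Rabs in *; repeat destruct (Rcase_abs _); lra.
Qed.

(** [g] and its inverse shift [y] by [tau] in opposite directions, so [y] lies between its two
    images. For an element exchanging the ends the two images would be close to each other. *)
Lemma pos_axial a h y g : a <= 2990 * d -> axial a h y -> pos_stab h g ->
  100000 * kappa H <= dist (g $ y) y -> axial (6000 * d) g y.
Proof.
  intros ha hx hg hd. split; auto. consts.
  assert (s := pos_stab_stab _ _ hg).
  assert (oy : online h (a + 4 * d) y) by (apply axial_online; auto; lra).
  destruct (pos_shift a h y g [y; (g^-1) $ y; g $ y] (a + 4 * d) ltac:(lra) hx hg) as [P [Q [tau [h1 h2]]]].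
  - intros z [<-|[<-|[<-|[]]]]; auto; apply online_stab; auto. apply stab_inv; auto.
  - pose proof (line_dist P Q (g $ y) y (a + 4 * d)) as l1.
    pose proof (line_dist_ge P ((g^-1) $ y) (g $ y)) as l2.
    pose proof (h2 y ltac:(simpl; auto)) as b1. pose proof (h2 ((g^-1) $ y) ltac:(simpl; auto)) as b2.
    rewrite act_KV in b2.
    specialize (l1 ltac:(apply h1; simpl; auto) ltac:(apply h1; simpl; auto)).
    unfold gromov. rewrite (dist_act_l (g^-1)%g y y), ginv_inv, (dist_sym _ y (g $ y)).
    unfold Rabs in *; repeat destruct (Rcase_abs _); lra.
Qed.

Lemma pos_axial_commens a h y g : 0 <= a <= 2990 * d -> axial a h y -> pos_stab h g ->
  100000 * kappa H <= dist (g $ y) y -> commensurable h g.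
Proof.
  intros ha hx hg hd. consts.
  apply (commens_of_stab a h g y); auto; [lra| |apply pos_stab_stab; auto].
  apply (axial_lox (6000 * d) g y); [lra|]. apply (pos_axial a h y g); auto; lra.
Qed.

End Shift.

(** * Large subsets of cosets of elementary subgroups *)

Section PingPong.
Context {H : acyl_action}.
Local Notation X := (spc H).
Local Notation G := (grp H).
Local Notation d := (delta H).
Implicit Types p q x y z : X.
Implicit Types g h b f : G.

(** Up to [d], the points [y] and [b $ y] are the feet of the bridge between the orbit of [y] under
    [h] and the image of this orbit under [b]. *)
Definition nearest h b y := forall n m, dist y (b $ y) <= dist (gpow h n $ y) (b $ gpow h m $ y) + d.

Lemma nearest_inv h b y : nearest h b y -> nearest h (b^-1)%g y.
Proof.
  intros hn n m. specialize (hn m n).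
  rewrite (dist_sym _ y), dist_act_l, ginv_inv.
  rewrite (dist_sym _ (gpow h n $ y)), (dist_act_l (b^-1)%g), ginv_inv. exact hn.
Qed.

(** Were the bridge to follow the axis for more than one period, the step given by [toward] would
    shorten it. *)
Lemma nearest_bridge h b y z : axial (6000 * d) h y -> nearest h b y -> online h (6010 * d) z ->
  gromov z (b $ y) y <= dist (h $ y) y.
Proof.
  intros hx hn oz. consts.
  destruct (Rle_dec (gromov z (b $ y) y) (dist (h $ y) y)) as [|hc]; auto. exfalso.
  apply Rnot_le_lt in hc. pose proof (gromov_le_l z (b $ y) y).
  destruct (toward (6000 * d) h y (6010 * d) z ltac:(lra) ltac:(lra) hx oz ltac:(lra)) as [k [ek hk]].
  destruct hx as [_ hx].
  pose proof (hyp_min (b $ y) z (gpow h k $ y) y (dist (h $ y) y - 6000 * d - 6010 * d - 2 * d)) as hm.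
  rewrite (gromov_sym (b $ y) z y) in hm. specialize (hm ltac:(lra) hk).
  pose proof (gromov_dist (b $ y) (gpow h k $ y) y) as gd.
  specialize (hn k 0%Z). rewrite gpow_0, act_1 in hn.
  rewrite (dist_sym _ (gpow h k $ y)), (dist_sym _ y (b $ y)) in hn. lra.
Qed.

(** A long bridge keeps the axis apart from its image. If the bridge is short, directions staying
    together for [2 N + 30] periods would make [h] and [b h b^-1] commensurable, against
    [~ stab h b]. Ten periods are cut off at either end to get away from the bridge and from the end
    points. *)
Lemma nearest_gromov h b y z z' : axial (6000 * d) h y -> nearest h b y -> ~ stab h b ->
  online h (6010 * d) z -> online h (6010 * d) z' ->
  gromov z (b $ z') y <= (2 * INR (acylN H) + 30) * dist (h $ y) y.
Proof.
  intros hx hn hb oz oz'. consts.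
  set (T := dist (h $ y) y).
  assert (hT : 100000 * kappa H <= T) by apply hx.
  assert (hN : 0 <= INR (acylN H) * T) by (apply Rmult_le_pos; [apply pos_INR|lra]).
  assert (hA : (2 * INR (acylN H) + 30) * T = 2 * (INR (acylN H) * T) + 30 * T) by ring.
  pose proof (nearest_bridge h b y z hx hn oz) as c1. fold T in c1.
  pose proof (nearest_bridge h (b^-1)%g y z' hx (nearest_inv _ _ _ hn) oz') as c2. fold T in c2.
  set (A := (2 * INR (acylN H) + 30) * T) in *.
  destruct (Rle_dec (3 * T) (dist y (b $ y))) as [hb3|hb3].
  - assert (gromov z (b $ z') y <= T + d); [|lra].
    apply (hyp_cut z (b $ y)); auto.
    pose proof (gromov_swap (b $ y) (b $ z') y) as sw.
    rewrite (gromov_act_x b y (b $ z') y), act_VK in sw.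
    rewrite (gromov_sym _ z' y) in sw. lra.
  - destruct (Rle_dec (gromov z (b $ z') y) A) as [|hc]; auto. exfalso. apply hb. apply Rnot_le_lt in hc.
    apply Rnot_le_lt in hb3.
    pose proof (gromov_le_l z (b $ z') y) as zl. pose proof (gromov_le_r z (b $ z') y) as zr.
    destruct (geodesic_fun y z) as [sg hsg]. rewrite (dist_sym _ z y) in zl.
    assert (oy : online h (6004 * d) y).
    { replace (6004 * d) with (6000 * d + 4 * d) by lra. apply axial_online; auto; lra. }
    assert (oy' := online_mono h (6004 * d) (6010 * d) y ltac:(lra) oy).
    assert (on : forall s, 10 * T <= s <= A - 10 * T ->
        online h (4 * d) (sg s) /\ online (b * h * b^-1)%g (4 * d) (sg s)).
    { intros s hs. destruct (hsg s ltac:(lra)) as [s1 s2]. 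
      pose proof (gromov_geo y z (sg s) s s1 s2) as s0. split.
      - apply (online_mono h (0 + 2 * d)); [lra|].
        apply (online_between h (6010 * d) 0 y z); auto; lra.
      - replace (4 * d) with (2 * d + 2 * d) by lra.
        assert (m1 : gromov y (b $ z') (sg s) <= d).
        { replace d with (0 + d) by lra. apply (hyp_cut y z); [lra|].
          pose proof (gromov_lip_x z (b $ z') y (sg s)). lra. }
        assert (m2 : gromov (b $ y) (b $ z') (sg s) <= 2 * d).
        { rewrite gromov_sym. replace (2 * d) with (d + d) by lra. apply (hyp_cut _ y); [rewrite gromov_sym; auto|].
          pose proof (gromov_lip y (b $ y) y (sg s)) as l.
          assert (e0 : gromov y y (sg s) = dist y (sg s)) by (unfold gromov; rewrite dist_refl; lra).
          rewrite (gromov_sym (b $ y)) in l. lra. }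
        apply (online_between _ (6010 * d) (2 * d) (b $ y) (b $ z')); auto; try lra.
        + apply online_conj; auto.
        + apply online_conj; auto.
        + pose proof (dist_tri _ y (b $ y) (sg s)). lra.
        + pose proof (dist_tri _ (b $ z') (sg s) y). rewrite (dist_sym _ (sg s) y) in *. lra. }
    destruct (on (10 * T)) as [p1 p2]; [lra|]. destruct (on (A - 10 * T)) as [q1 q2]; [lra|].
    apply (commens_of_overlap (6000 * d) h _ (sg (10 * T)) (sg (A - 10 * T)) (4 * d) y (b $ y)); auto; try lra.
    + apply lox_conj. apply (axial_lox (6000 * d) h y); auto; lra.
    + replace ((b * h * b^-1) $ b $ y) with (b $ h $ y) by (rewrite <- !act_mul; f_equal; grp).
      rewrite act_dist. fold T.
      destruct (hsg (10 * T) ltac:(lra)) as [u1 _]. destruct (hsg (A - 10 * T) ltac:(lra)) as [u2 _].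
      pose proof (dist_tri _ y (sg (10 * T)) (sg (A - 10 * T))). lra.
Qed.

(** The letters [b t] form a linked word, because [nearest_gromov] bounds the corners by [A] and
    each [t] moves [y] by at least [10 A]. The inverse of [f] is put in front as first letter:
    whatever point [f $ y] of the axis is taken, the word leaves in another direction. *)
Lemma ping_pong h b y (f f' : G) l : axial (6000 * d) h y -> nearest h b y -> ~ stab h b ->
  let A := (2 * INR (acylN H) + 30) * dist (h $ y) y in
  stab h f -> (forall t, In t (f' :: l) -> stab h t /\ 10 * A <= dist (t $ y) y) ->
  gromov (f $ y) (prod_list (map (fun t => b * t)%g (f' :: l)) $ y) y <= A + 2 * d.
Proof.
  intros hx hn hb A hf hl. consts.
  set (T := dist (h $ y) y) in *.
  assert (hT : 100000 * kappa H <= T) by apply hx.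
  assert (hN : 0 <= INR (acylN H) * T) by (apply Rmult_le_pos; [apply pos_INR|lra]).
  assert (hA : A = 2 * (INR (acylN H) * T) + 30 * T) by (unfold A; ring).
  assert (oy : online h (6010 * d) y).
  { apply (online_mono h (6000 * d + 4 * d)); [lra|]. apply axial_online; auto; lra. }
  assert (star : forall t t', stab h t -> stab h t' -> gromov (t $ y) (b $ t' $ y) y <= A).
  { intros t t' s s'. apply (nearest_gromov h b y); auto; apply online_stab; auto. }
  assert (brid : forall t, stab h t -> gromov (t $ y) ((b^-1) $ y) y <= T).
  { intros t s. apply nearest_bridge; auto; [apply nearest_inv; auto|apply online_stab; auto]. }
  assert (lk : linked y (A + d) ((f^-1)%g :: map (fun t => b * t)%g (f' :: l))).
  { assert (first : forall t t', stab h t' -> 10 * A <= dist (t' $ y) y -> stab h t -> 10 * A <= dist (t $ y) y ->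
        gromov (((b * t)^-1) $ y) ((b * t') $ y) y <= A + d).
    { intros t t' s' d' s dt. rewrite gromov_sym, ginv_mul, !act_mul.
      apply (hyp_cut _ ((t^-1) $ y)).
      - rewrite gromov_sym. apply star; auto. apply stab_inv; auto.
      - pose proof (gromov_swap ((t^-1) $ y) ((t^-1) $ (b^-1) $ y) y) as sw.
        rewrite (gromov_act_x (t^-1)%g), !act_VK, ginv_inv in sw. specialize (brid t s).
        rewrite (dist_sym _ y), (dist_act_l (t^-1)%g y y), ginv_inv, (dist_sym _ y) in sw. lra. }
    assert (len : forall t, stab h t -> 10 * A <= dist (t $ y) y -> 2 * (A + d) + 2 * d < dist ((b * t) $ y) y).
    { intros t s dt. rewrite act_mul, dist_act_l. specialize (brid t s).
      pose proof (gromov_dist (t $ y) ((b^-1) $ y) y). pose proof (dist_ge0 _ ((b^-1) $ y) y). lra. }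
    destruct (hl f' (or_introl eq_refl)) as [s1 d1].
    simpl. split; [|split].
    - rewrite ginv_inv, act_mul. pose proof (star f f' hf s1). lra.
    - intros _. apply len; auto.
    - revert f' hl s1 d1. induction l as [|t l IH]; intros f' hl s1 d1; [exact I|].
      destruct (hl t ltac:(simpl; auto)) as [s2 d2].
      simpl. split; [apply first; auto|]. split; [intros _; apply len; auto|].
      apply (IH t); auto. intros u [<-|hu]; auto. apply hl; simpl; auto. }
  simpl map in lk. apply linked_gromov in lk. rewrite ginv_inv in lk.
  replace (A + 2 * d) with (A + d + d) by lra. exact lk.
Qed.

End PingPong.

Definition gap_bound (dl kp : R) (N : nat) : nat :=
  (2 * natceil ((2 * (100000 * kp) + 32000 * dl) / dl) * N)%nat.
(** [100 (N + 20)] half periods cover the length [21 A] needed in [coset_good], and [window_count]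
    allows [gap_bound] elements in each. *)
Definition coset_bound (dl kp : R) (N : nat) : nat :=
  (100 * (N + 20) * gap_bound dl kp N)%nat.

Section Coset.
Context {H : acyl_action}.
Local Notation X := (spc H).
Local Notation G := (grp H).
Local Notation d := (delta H).
Local Notation m0 := (gap_bound (delta H) (kappa H) (acylN H)).
Local Notation MA := (coset_bound (delta H) (kappa H) (acylN H)).
Implicit Types p q x y z : X.
Implicit Types g h b f : G.

Lemma natceil_div (x : R) : x < INR (natceil (x / d)) * d.
Proof.
  consts. pose proof (natceil_gt (x / d)) as hn.
  apply Rmult_lt_compat_r with (r := d) in hn; [|lra]. unfold Rdiv in hn at 1.
  rewrite Rmult_assoc, Rinv_l in hn by lra. lra.
Qed.

Lemma gap_count a h y (u0 : G) l : 0 <= a <= 7000 * d -> axial a h y -> NoDup l ->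
  (forall u, In u l -> stab h (u0^-1 * u)%g /\ dist ((u0^-1 * u) $ y) y <= 100000 * kappa H) ->
  (length l <= m0)%nat.
Proof.
  intros ha hx hl hu. consts.
  rewrite <- (length_map (fun u => (u0^-1 * u)%g)).
  apply (stab_bounded a h y (100000 * kappa H)); auto; [lra | |  | ].
  - apply natceil_div.
  - apply Injective_map_NoDup; auto. intros v w e; apply gmul_eq_l in e; auto.
  - intros g hg. apply in_map_iff in hg as [u [<- hg]]. auto.
Qed.

(** Half a period is short enough: two elements with images in one window differ, after all errors,
    by a shift below the period [T], hence by the gap hypothesis by one of at most [100000 kappa],
    and [gap_count] applies. *)
Lemma window_count h y (x : G) (i : Z) (P : list G) (K : nat) (Rad : R) :
  axial (6000 * d) h y -> NoDup P ->
  (forall u, In u P -> stab h (x * u)%g) ->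
  (forall u u', In u P -> In u' P -> pos_stab h (u^-1 * u')%g /\
     (dist ((u^-1 * u') $ y) y < dist (h $ y) y -> dist ((u^-1 * u') $ y) y <= 100000 * kappa H)) ->
  (forall u u', In u P -> In u' P ->
     dist ((x * u * gpow h i) $ y) ((x * u' * gpow h i) $ y) <= Rad) ->
  Rad < INR K * (dist (h $ y) y / 2) -> (length P <= K * m0)%nat.
Proof.
  intros hx hP hs hmin hR hK. consts.
  set (T := dist (h $ y) y) in *.
  assert (hT : 100000 * kappa H <= T) by apply hx.
  assert (oy : online h (6004 * d) y).
  { replace (6004 * d) with (6000 * d + 4 * d) by lra. apply axial_online; auto; lra. }
  assert (oi : forall k, online h (6004 * d) (gpow h k $ y)) by (intros; apply online_stab; auto; apply stab_pow).
  destruct (eventually_list P (fun u n m =>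
     gromov (gpow h (-n) $ y) (gpow h m $ y) ((x * u * gpow h i) $ y) <= 6004 * d)) as [n0 h0].
  { intros u hu. rewrite act_mul. exact (online_stab h (6004 * d) _ _ (hs u hu) (oi i) y y). }
  set (P0 := gpow h (-n0) $ y). set (Q0 := gpow h n0 $ y).
  assert (hpq : forall u, In u P -> gromov P0 Q0 ((x * u * gpow h i) $ y) <= 6004 * d).
  { intros u hu. apply (h0 u hu n0 n0); lia. }
  destruct P as [|v P']; [simpl; lia|]. set (P := v :: P') in *.
  destruct (exists_min (fun u => dist ((x * u * gpow h i) $ y) P0) P) as [um [hum hmn]]; [unfold P; congruence|].
  set (c0 := dist ((x * um * gpow h i) $ y) P0) in *.
  apply (bucket_pigeonhole (fun u => dist ((x * u * gpow h i) $ y) P0) c0 (T / 2)); [lra|auto| |].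
  - intros u hi. pose proof (line_dist_ge P0 ((x * u * gpow h i) $ y) ((x * um * gpow h i) $ y)) as l.
    fold c0 in l. specialize (hR u um hi hum). specialize (hmn u hi). unfold Rabs in l; destruct (Rcase_abs _); lra.
  - intros F t nF iF hF. destruct F as [|u0 q]; [simpl; lia|]. set (F := u0 :: q) in *.
    assert (hu0 : In u0 F) by (simpl; auto).
    apply (gap_count (6000 * d) h y u0); auto; [lra|].
    intros u hu. destruct (hmin u0 u (iF u0 hu0) (iF u hu)) as [ps gap].
    split; [apply pos_stab_stab; auto|]. apply gap.
    pose proof (pos_disp (6000 * d) h y _ y (gpow h i $ y) (6004 * d) ltac:(lra) hx ps oy (oi i)) as pd.
    assert (e : dist ((u0^-1 * u) $ gpow h i $ y) (gpow h i $ y) =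
       dist ((x * u * gpow h i) $ y) ((x * u0 * gpow h i) $ y)).
    { rewrite <- (act_dist (x * u0)%g), <- !act_mul. f_equal; f_equal; grp. }
    pose proof (line_dist P0 Q0 ((x * u * gpow h i) $ y) ((x * u0 * gpow h i) $ y) (6004 * d)
      (hpq u (iF u hu)) (hpq u0 (iF u0 hu0))) as l.
    pose proof (hF u hu). pose proof (hF u0 hu0).
    unfold Rabs in l; destruct (Rcase_abs _); lra.
Qed.

(** Moves a word over a coset of the elementary subgroup into the subgroup: the letters become
    [phi t], and the separator absorbs the translating elements. *)
Lemma conj_sep h (x : G) w i s l :
  let phi := fun t => (x * t * gpow h i)%g in
  (x * sep w (s :: l) * gpow h i)%g =
  (phi s * prod_list (map (fun t => (gpow h (-i) * w * x^-1) * phi t) l))%g.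
Proof.
  intros phi. revert s; induction l as [|t l IH]; intros s.
  - unfold phi, prod_list. cbn [sep map fold_right]. grp.
  - change (sep w (s :: t :: l)) with (s * (w * sep w (t :: l)))%g.
    simpl map. simpl prod_list. change (fold_right gmul 1%g) with (@prod_list G).
    rewrite <- (gmul_assoc _ (gpow h (-i) * w * x^-1)%g), <- IH.
    unfold phi. rewrite gpow_opp. grp.
Qed.

(** The factor 4 arises because one of two orientations is kept, and at least half of the letters
    survive when at most [MA] of them are dropped. *)
Lemma coset_good (U B : list G) h y a (x : G) (c : nat) : 0 <= a <= 2990 * d -> axial a h y ->
  not_in_infinite_virtually_cyclic U -> NoDup B -> incl B U ->
  (forall u, In u B -> stab h (x * u)%g) -> (length U <= c * length B)%nat ->
  (length U <= 4 * c * MA)%nat \/ good U MA (4 * c).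
Proof.
  intros ha hx hU hB hBU hs hc. consts.
  destruct (Nat.le_gt_cases (length U) (4 * c * MA)) as [hsm|hlg]; [left; auto|right].
  assert (hBl : (4 * MA < length B)%nat) by nia.
  assert (oy : online h (a + 4 * d) y) by (apply axial_online; auto; lra).
  assert (hB1 : exists B1, NoDup B1 /\ incl B1 B /\ (length B <= 2 * length B1)%nat /\
     forall u u', In u B1 -> In u' B1 -> pos_stab h (u^-1 * u')%g).
  { pose proof (length_sel_split (fun u => pos_stab h (x * u)%g) B) as sp.
    assert (e : forall u u' : G, (u^-1 * u' = (x * u)^-1 * (x * u'))%g) by (intros; grp).
    destruct (Nat.le_ge_cases (length (sel (fun u => ~ pos_stab h (x * u)%g) B)) (length (sel (fun u => pos_stab h (x * u)%g) B))).
    - exists (sel (fun u => pos_stab h (x * u)%g) B). split; [apply NoDup_sel; auto|].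
      split; [apply incl_sel|]. split; [lia|].
      intros u u' hu hu'. apply in_sel in hu as [_ hu]. apply in_sel in hu' as [_ hu'].
      rewrite e. apply pos_stab_mul_inv; auto.
    - exists (sel (fun u => ~ pos_stab h (x * u)%g) B). split; [apply NoDup_sel; auto|].
      split; [apply incl_sel|]. split; [lia|].
      intros u u' hu hu'. apply in_sel in hu as [hu1 hu]. apply in_sel in hu' as [hu1' hu'].
      rewrite e. apply stab_sign; auto. }
  destruct hB1 as [B1 [nB1 [iB1 [lB1 pB1]]]].
  assert (hMA : (m0 <= MA)%nat) by (unfold coset_bound; nia).
  (* The shortest translation [k] between elements of [B1] replaces [h], so that few elements of [B1]
     move [y] into a segment of length [T]. *)
  set (L := sel (fun uv => 100000 * kappa H < dist (((fst uv)^-1 * snd uv) $ y) y) (list_prod B1 B1)).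
  assert (hL : L <> []).
  { intros hL. assert (hn : (length B1 <= m0)%nat); [|lia].
    destruct B1 as [|u0 B1']; [simpl; lia|]. set (B1 := u0 :: B1') in *.
    apply (gap_count a h y u0); auto; [lra|].
    intros u hu. split; [apply pos_stab_stab, pB1; simpl; auto|].
    apply Rnot_lt_le. intros hlt.
    assert (hi : In (u0, u) L).
    { apply in_sel. split; [apply in_prod; auto; simpl; auto|auto]. }
    rewrite hL in hi; destruct hi. }
  destruct (exists_min (fun uv => dist (((fst uv)^-1 * snd uv) $ y) y) L hL) as [[v0 v1] [hv hmin]].
  apply in_sel in hv as [hv hvd]. apply in_prod_iff in hv as [hv0 hv1]. simpl in hmin, hvd.
  set (k := (v0^-1 * v1)%g) in *.
  assert (hk := pB1 v0 v1 hv0 hv1). fold k in hk.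
  assert (kx : axial (6000 * d) k y) by (apply (pos_axial a h y k); auto; lra).
  assert (hkc : commensurable h k) by (apply (pos_axial_commens a h y k); auto; lra).
  set (T := dist (k $ y) y) in *.
  assert (gap : forall u u', In u B1 -> In u' B1 -> pos_stab k (u^-1 * u')%g /\
     (dist ((u^-1 * u') $ y) y < T -> dist ((u^-1 * u') $ y) y <= 100000 * kappa H)).
  { intros u u' hu hu'. split; [apply (pos_stab_commens h); auto|].
    intros hlt. apply Rnot_lt_le. intros hgt.
    assert (hi : In (u, u') L) by (apply in_sel; split; [apply in_prod; auto|auto]).
    specialize (hmin _ hi). simpl in hmin. lra. }
  set (u1 := v0). assert (hu1 : In u1 B1) by exact hv0.
  assert (hs1 : forall u, In u B1 -> stab k (u1^-1 * u)%g) by (intros; apply pos_stab_stab, gap; auto).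
  (* If [w u1] were in [stab k] for all [w] in [U], then so would be [u1 k u1^-1], which is the
     quotient of [v1 u1] by [u1 u1]. Being loxodromic, it is commensurable with [k]; thus [u1], and
     then all of [U], would lie in [stab k]. *)
  assert (hw : exists w, In w U /\ ~ stab k (w * u1)%g).
  { apply NNPP; intros hn.
    assert (ha1 : forall w, In w U -> stab k (w * u1)%g) by (intros w hw; apply NNPP; intros hw2; apply hn; eauto).
    assert (hu1k : stab k u1).
    { unfold stab. apply (commens_of_stab (6000 * d) k _ y); auto; [lra| |].
      - apply lox_conj. apply (axial_lox (6000 * d) k y); auto; lra.
      - replace (u1 * k * u1^-1)%g with ((v1 * u1) * (u1 * u1)^-1)%g by (unfold k, u1; grp).
        apply stab_mul; [|apply stab_inv]; apply ha1, hBU, iB1; auto. }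
    destruct (outside_stab (6000 * d) k y U ltac:(lra) kx hU) as [w [hw1 hw2]]. apply hw2.
    replace w with ((w * u1) * u1^-1)%g by grp. apply stab_mul; auto. apply stab_inv; auto. }
  destruct hw as [w [hwU hw]].
  (* Correcting [w u1] by powers of [k] on both sides moves the feet of the bridge to [y], which
     makes [b] satisfy [nearest]. *)
  destruct (near_min (fun ij : Z * Z => dist (gpow k (fst ij) $ y) ((w * u1 * gpow k (snd ij)) $ y)) d) as [[i j] hij].
  { exact (inhabits (0, 0)%Z). } { lra. } { intros; apply dist_ge0. }
  simpl in hij.
  set (b := (gpow k (-i) * w * u1 * gpow k j)%g).
  assert (hb : ~ stab k b).
  { intros hb. apply hw. replace (w * u1)%g with (gpow k i * b * gpow k (-j))%g.
    - apply stab_mul; [apply stab_mul; auto; apply stab_pow|apply stab_pow].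
    - unfold b. rewrite !gpow_opp. grp. }
  assert (hn : nearest k b y).
  { intros n m. specialize (hij (i + n, j + m)%Z). simpl in hij.
    unfold b. rewrite <- (act_dist (gpow k i) y), <- (act_dist (gpow k i) (gpow k n $ y)), <- !act_mul.
    rewrite !gpow_add in hij. rewrite gpow_opp. grp_in hij. grp. exact hij. }
  set (x1 := (gpow k (-j) * u1^-1)%g).
  assert (hx1 : forall u, In u B1 -> stab k (x1 * u)%g).
  { intros u hu. unfold x1. rewrite <- gmul_assoc. apply stab_mul; [apply stab_pow|auto]. }
  assert (eb : (gpow k (-i) * w * x1^-1)%g = b) by (unfold b, x1; rewrite !gpow_opp; grp).
  set (phi := fun t => (x1 * t * gpow k i)%g).
  assert (hphi : forall t, In t B1 -> stab k (phi t)) by (intros t ht; apply stab_mul; [auto|apply stab_pow]).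
  set (A := (2 * INR (acylN H) + 30) * T).
  assert (hT : 100000 * kappa H <= T) by apply kx.
  assert (hNT : 0 <= INR (acylN H) * T) by (apply Rmult_le_pos; [apply pos_INR|lra]).
  assert (eA : A = 2 * (INR (acylN H) * T) + 30 * T) by (unfold A; ring).
  assert (eK : INR (100 * (acylN H + 20)) * (T / 2) = 50 * (INR (acylN H) * T) + 1000 * T).
  { rewrite mult_INR, plus_INR. replace (INR 100) with 100 by (simpl; lra). replace (INR 20) with 20 by (simpl; lra). field. }
  assert (win : forall P Rad, NoDup P -> incl P B1 -> Rad <= 21 * A ->
     (forall u u', In u P -> In u' P -> dist (phi u $ y) (phi u' $ y) <= Rad) -> (length P <= MA)%nat).
  { intros P Rad nP iP hR hd. unfold coset_bound.
    apply (window_count k y x1 i P _ Rad); auto. fold T. lra. }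
  (* The letters that move [y] too little for [ping_pong] are dropped; their images of [y] are
     within [20 A] of each other, so there are at most [MA] of them. *)
  set (S := sel (fun t => 10 * A <= dist (phi t $ y) y) B1).
  assert (hSl : (length B1 <= length S + MA)%nat).
  { rewrite (length_sel_split (fun t => 10 * A <= dist (phi t $ y) y) B1). fold S.
    assert (length (sel (fun t => ~ (10 * A <= dist (phi t $ y) y)%R) B1) <= MA)%nat; [|lia].
    apply (win _ (20 * A)); [apply NoDup_sel; auto| | lra |].
    - apply incl_sel.
    - intros u u' hu hu'. apply in_sel in hu as [_ hu]. apply in_sel in hu' as [_ hu'].
      pose proof (dist_tri _ (phi u $ y) y (phi u' $ y)). rewrite (dist_sym _ y) in *. lra. }
  assert (hSi : incl S B1) by (apply incl_sel).
  exists S, (fun _ _ => True), w. split; [apply NoDup_sel; auto|].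
  split; [intros u hu; auto|]. split; [auto|]. split; [nia|]. split.
  { intros s _. assert (e : length (sel (fun _ : G => ~ True) S) = 0%nat); [|lia].
    destruct (sel (fun _ : G => ~ True) S) as [|z q] eqn:eq; auto.
    assert (hz : In z (sel (fun _ : G => ~ True) S)) by (rewrite eq; simpl; auto).
    apply in_sel in hz; tauto. }
  intros g P nP hP.
  assert (iP : incl P B1).
  { intros s hsP. destruct (hP s hsP) as [t [l [[h1 _] _]]]. auto. }
  apply (win P (2 * A + 4 * d)); auto; [lra|].
  set (z := (x1 * g * gpow k i) $ y).
  assert (hz : forall s f, In s P -> stab k f -> gromov ((phi s * f) $ y) z (phi s $ y) <= A + 2 * d).
  { intros s f hsP hf. destruct (hP s hsP) as [t [l [hv eg]]].
    unfold z. rewrite <- eg, (conj_sep k x1 w i s (t :: l)), eb.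
    change (x1 * s * gpow k i)%g with (phi s).
    change (fun t0 => (b * (x1 * t0 * gpow k i))%g) with (fun t0 => (b * phi t0)%g).
    rewrite (act_mul (phi s) f), (act_mul (phi s) (prod_list _)), gromov_act.
    replace (map (fun t => (b * phi t)%g) (t :: l)) with (map (fun t => (b * t)%g) (map phi (t :: l))) by (rewrite map_map; reflexivity).
    apply valid_incl in hv.
    apply (ping_pong k b y f (phi t) (map phi l)); auto.
    intros t' ht'. change (phi t :: map phi l) with (map phi (t :: l)) in ht'.
    apply in_map_iff in ht' as [t0 [<- ht0]].
    assert (hi : In t0 S) by (apply hv; simpl; auto). split; [apply hphi; auto|].
    apply in_sel in hi as [_ hi]. exact hi. }
  (* [hz] bounds the Gromov product with the common end [z] at [phi u $ y] and at [phi u' $ y]; the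
     two products add up to the distance of these points. *)
  intros u u' hu hu'.
  pose proof (hz u ((phi u)^-1 * phi u')%g hu) as z1. pose proof (hz u' ((phi u')^-1 * phi u)%g hu') as z2.
  rewrite gmul_KV in z1, z2.
  specialize (z1 ltac:(apply stab_mul; [apply stab_inv|]; apply hphi; auto)).
  specialize (z2 ltac:(apply stab_mul; [apply stab_inv|]; apply hphi; auto)).
  pose proof (gromov_swap (phi u' $ y) z (phi u $ y)). lra.
Qed.
End Coset.

Definition long (kp : R) : R := 100000000 * kp.
(** A number of periods: [commens_of_overlap] asks for about [2 (N + 1)], and the rest is a margin
    for the cut off ends. *)
Definition fineness (N : nat) : nat := (100 * (N + 1))%nat.
Definition spot_bound (dl kp : R) (N : nat) : nat :=
  (2 * natceil ((200000 * kp + 16000 * dl) / dl) * N)%nat.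
(** With more elements than this, some bucket of a [fineness]-th part of their length range holds
    more than [spot_bound] of them. The extra bucket takes in the upper end of the range. *)
Definition heavy_bound (dl kp : R) (N : nat) : nat :=
  ((fineness N + 1) * spot_bound dl kp N)%nat.
Definition light_bound (dl kp : R) (N : nat) : nat :=
  ((2 * fineness N + 1) * heavy_bound dl kp N)%nat.

(** * Reduced words and periods *)

Section Patterns.
Context {H : acyl_action}.
Variable o : spc H.
Local Notation X := (spc H).
Local Notation G := (grp H).
Local Notation d := (delta H).
Local Notation kap := (kappa H).
Local Notation K := (fineness (acylN H)).
Local Notation m1 := (spot_bound (delta H) (kappa H) (acylN H)).
Local Notation m2 := (heavy_bound (delta H) (kappa H) (acylN H)).
Local Notation M1 := (light_bound (delta H) (kappa H) (acylN H)).
Implicit Types x y z : X.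
Implicit Types g h b s u v : G.

Definition len g := dist (g $ o) o.

(** Both kinds of corner in the words [s b s b ...]; the constant 600 is the upper end of the radii
    in [thin_annulus]. *)
Definition red s b := gromov ((s^-1) $ o) (b $ o) o <= 600 * d /\ gromov ((b^-1) $ o) (s $ o) o <= 600 * d.

(* [g] is a reduced word beginning with [s b]: the constant [600] of [red] degrades to [602] along a
   broken geodesic. *)
Definition pre g s b := gromov o (g $ o) (s $ o) <= 602 * d /\ gromov o (g $ o) ((s * b) $ o) <= 602 * d /\
  len s + len b - 1200 * d <= len (s * b)%g.

Lemma K_ge : INR K = 100 * INR (acylN H) + 100.
Proof. unfold fineness. rewrite mult_INR, plus_INR. replace (INR 100) with 100 by (simpl; lra). simpl (INR 1). ring. Qed.

Lemma axial_online_1904 h y : axial (1900 * d) h y -> online h (1904 * d) y.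
Proof.
  intros hx. consts.
  replace (1904 * d) with (1900 * d + 4 * d) by lra. apply axial_online; auto; lra.
Qed.

Lemma axial_lox_1900 h y : axial (1900 * d) h y -> lox h.
Proof. intros hx. consts. apply (axial_lox (1900 * d) h y); auto; lra. Qed.

#[local] Hint Resolve axial_online_1904 : core.

Lemma len_inv g : dist ((g^-1) $ o) o = len g.
Proof. unfold len. rewrite dist_act_l, ginv_inv, dist_sym. reflexivity. Qed.

Lemma red_sym s b : red s b -> red b s.
Proof. intros [h1 h2]; split; auto. Qed.

Fixpoint interleave b (l : list G) : list G :=
  match l with
  | [] => []
  | s :: l' => match l' with [] => [s] | _ => s :: b :: interleave b l' end
  end.

Lemma prod_interleave b l : prod_list (interleave b l) = sep b l.
Proof.
  induction l as [|s l IH]; [reflexivity|]. destruct l as [|t l]; [apply gmul_1r|].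
  change (s * (b * prod_list (interleave b (t :: l))) = s * (b * sep b (t :: l)))%g.
  rewrite IH. reflexivity.
Qed.

Lemma interleave_linked b l : long kap <= len b ->
  (forall s, In s l -> red s b /\ long kap <= len s) -> linked o (600 * d) (interleave b l).
Proof.
  intros hb hl. consts. unfold long, len in *.
  induction l as [|s l IH]; [exact I|]. destruct l as [|t l]; [exact I|].
  assert (IH' : linked o (600 * d) (interleave b (t :: l))) by (apply IH; intros; apply hl; simpl; auto).
  destruct (hl s) as [[r1 r2] ls]; [simpl; auto|]. destruct (hl t) as [[r3 r4] lt]; [simpl; auto|].
  assert (e : exists q, interleave b (t :: l) = t :: q) by (destruct l; simpl; eauto).
  destruct e as [q eq].
  change (interleave b (s :: t :: l)) with (s :: b :: interleave b (t :: l)). rewrite eq in *.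
  simpl. split; [auto|]. split; [intros; lra|]. split; [auto|]. split; [intros; lra|].
  exact IH'.
Qed.

Lemma pre_of_word b s t l g : long kap <= len b ->
  (forall s', In s' (s :: t :: l) -> red s' b /\ long kap <= len s') -> sep b (s :: t :: l) = g ->
  pre g s b /\ gromov o (g $ o) ((s * b * t) $ o) <= 602 * d /\
  len s + len b + len t - 2402 * d <= len (s * b * t)%g.
Proof.
  intros hb hl eg. consts.
  pose proof (interleave_linked b _ hb hl) as lk.
  destruct (hl s) as [[r1 r2] ls]; [simpl; auto|]. destruct (hl t) as [[r3 r4] lt]; [simpl; auto|].
  unfold long, len in *.
  set (w := sep b (t :: l)).
  assert (eg' : g = (s * (b * w))%g) by (rewrite <- eg; reflexivity).
  assert (e : exists q, interleave b (t :: l) = t :: q) by (destruct l; simpl; eauto). destruct e as [q eq].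
  change (interleave b (s :: t :: l)) with (s :: b :: interleave b (t :: l)) in lk.
  assert (ew : prod_list (t :: q) = w) by (rewrite <- eq; apply prod_interleave).
  rewrite eq in lk.
  assert (A1 : gromov o (g $ o) (s $ o) <= 601 * d).
  { pose proof (linked_gromov o _ s b (t :: q) lk) as c.
    change (prod_list (b :: t :: q)) with (b * prod_list (t :: q))%g in c. rewrite ew in c.
    rewrite gromov_act_x, eg', act_mul, act_VK. lra. }
  destruct lk as [_ [_ lk]].
  assert (A2 : gromov (s $ o) (g $ o) ((s * b) $ o) <= 601 * d).
  { pose proof (linked_gromov o _ b t q lk) as c. rewrite ew in c.
    rewrite gromov_act_x, eg', <- !act_mul. grp. lra. }
  destruct lk as [_ [_ lk]].
  assert (A3 : gromov ((s * b) $ o) (g $ o) ((s * b * t) $ o) <= 601 * d).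
  { destruct q as [|b' q].
    - assert (e : g = (s * b * t)%g) by (rewrite eg', <- ew; unfold prod_list; simpl; grp).
      rewrite e, gromov_sym, gromov_id_l. lra.
    - pose proof (linked_gromov o _ t b' q lk) as c.
      rewrite gromov_act_x, eg', <- ew, <- !act_mul.
      change (prod_list (t :: b' :: q)) with (t * prod_list (b' :: q))%g. grp. lra. }
  assert (f1 : gromov ((s * b) $ o) o (s $ o) <= 600 * d).
  { rewrite gromov_act_x, act_mul, act_VK, gromov_sym. exact r1. }
  assert (db : dist ((s * b) $ o) (s $ o) = dist (b $ o) o) by (rewrite act_mul, act_dist; auto).
  assert (f2 : dist (b $ o) o - 600 * d <= gromov (s $ o) o ((s * b) $ o)).
  { pose proof (gromov_swap o (s $ o) ((s * b) $ o)) as c. pose proof (gromov_dist ((s*b) $ o) o (s $ o)).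
    pose proof (gromov_dist (s $ o) o ((s * b) $ o)). rewrite (dist_sym _ (s $ o) ((s * b) $ o)) in *.
    rewrite (dist_sym _ o ((s * b) $ o)), (dist_sym _ o (s $ o)) in *. lra. }
  assert (B2 : gromov o (g $ o) ((s * b) $ o) <= 602 * d).
  { rewrite gromov_sym. replace (602 * d) with (601 * d + d) by lra.
    apply (hyp_cut _ (s $ o)); [rewrite gromov_sym; auto|lra]. }
  assert (f3 : gromov (s $ o) ((s * b * t) $ o) ((s * b) $ o) <= 600 * d).
  { rewrite gromov_act_x, <- !act_mul. grp. exact r4. }
  assert (B3 : gromov o ((s * b * t) $ o) ((s * b) $ o) <= 601 * d).
  { rewrite gromov_sym. replace (601 * d) with (600 * d + d) by lra.
    apply (hyp_cut _ (s $ o)); [rewrite gromov_sym; auto|lra]. }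
  assert (dt : dist ((s * b * t) $ o) ((s * b) $ o) = dist (t $ o) o) by (rewrite act_mul, act_dist; auto).
  assert (f4 : dist (t $ o) o - 601 * d <= gromov ((s * b) $ o) o ((s * b * t) $ o)).
  { pose proof (gromov_dist o ((s * b * t) $ o) ((s * b) $ o)).
    pose proof (gromov_dist ((s * b) $ o) o ((s * b * t) $ o)).
    rewrite (dist_sym _ ((s * b) $ o) ((s * b * t) $ o)) in *.
    rewrite (dist_sym _ o ((s * b * t) $ o)), (dist_sym _ o ((s * b) $ o)) in *. lra. }
  split; [|split].
  - split; [lra|]. split; [auto|]. pose proof (gromov_dist ((s * b) $ o) o (s $ o)) as gd.
    rewrite (dist_sym _ o (s $ o)) in gd. unfold len. lra.
  - rewrite gromov_sym. replace (602 * d) with (601 * d + d) by lra.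
    apply (hyp_cut _ ((s * b) $ o)); [rewrite gromov_sym; auto|lra].
  - pose proof (gromov_dist ((s * b) $ o) o (s $ o)) as gd. rewrite (dist_sym _ o (s $ o)) in gd.
    pose proof (gromov_dist o ((s * b * t) $ o) ((s * b) $ o)) as gd'.
    rewrite (dist_sym _ o ((s * b * t) $ o)), (dist_sym _ o ((s * b) $ o)) in gd'. lra.
Qed.

Lemma on_line g z z' : gromov o (g $ o) z <= 602 * d -> gromov o (g $ o) z' <= 602 * d ->
  dist z z' <= Rabs (dist z o - dist z' o) + 1206 * d.
Proof. intros a b. pose proof (line_dist o (g $ o) z z' (602 * d) a b). lra. Qed.

(** In the frame of [s], the segment from [o] to [b $ o] and its image under [h] lie along one
    geodesic, shifted by the difference of the lengths. This is less than [len b], so they overlap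
    and [h] translates along the segment, with both end points near the axis. *)
Lemma pre_axial g s s' b : pre g s b -> pre g s' b ->
  200000 * kap <= len s' - len s -> len s' - len s <= len b - 200000 * kap ->
  let h := (s^-1 * s')%g in
  axial (1900 * d) h o /\ axial (1900 * d) h (b $ o) /\ len s' - len s <= len h <= len s' - len s + 1206 * d.
Proof.
  intros [p1 [p2 p3]] [p1' [p2' p3']] ht1 ht2 h. consts.
  assert (d1 : dist (h $ o) o = dist (s' $ o) (s $ o)).
  { unfold h. rewrite act_mul, dist_act_l, ginv_inv. reflexivity. }
  assert (d2 : dist (h $ o) (b $ o) = dist (s' $ o) ((s * b) $ o)).
  { unfold h. rewrite act_mul, dist_act_l, ginv_inv, act_mul. reflexivity. }
  assert (d3 : dist (h $ b $ o) (b $ o) = dist ((s' * b) $ o) ((s * b) $ o)).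
  { unfold h. rewrite !act_mul, dist_act_l, ginv_inv. reflexivity. }
  assert (d4 : dist (h $ b $ o) o = dist ((s' * b) $ o) (s $ o)).
  { unfold h. rewrite !act_mul, dist_act_l, ginv_inv. reflexivity. }
  assert (db : dist ((s * b) $ o) (s $ o) = len b) by (rewrite act_mul, act_dist; auto).
  assert (db' : dist ((s' * b) $ o) (s' $ o) = len b) by (rewrite act_mul, act_dist; auto).
  pose proof (dist_tri _ ((s * b) $ o) (s $ o) o) as t1. pose proof (dist_tri _ ((s' * b) $ o) (s' $ o) o) as t2.
  pose proof (on_line g _ _ p1' p1) as l1. pose proof (on_line g _ _ p1' p2) as l2.
  pose proof (on_line g _ _ p2' p2) as l3. pose proof (on_line g _ _ p2' p1) as l4.
  pose proof (line_dist_ge o (s' $ o) (s $ o)) as g1. pose proof (line_dist_ge o (s' $ o) ((s * b) $ o)) as g2.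
  pose proof (line_dist_ge o ((s' * b) $ o) ((s * b) $ o)) as g3. pose proof (line_dist_ge o ((s' * b) $ o) (s $ o)) as g4.
  fold (len s) in *. fold (len s') in *. fold (len (s * b)%g) in *. fold (len (s' * b)%g) in *.
  rewrite db in t1. rewrite db' in t2.
  assert (N1 : len s' - len s <= dist (h $ o) o <= len s' - len s + 1206 * d).
  { rewrite d1. unfold Rabs in *; repeat destruct (Rcase_abs _); lra. }
  assert (N2 : len b - (len s' - len s) - 1200 * d <= dist (h $ o) (b $ o) <= len b - (len s' - len s) + 1206 * d).
  { rewrite d2. unfold Rabs in *; repeat destruct (Rcase_abs _); lra. }
  assert (N3 : (len s' - len s) - 1200 * d <= dist (h $ b $ o) (b $ o) <= (len s' - len s) + 2406 * d).
  { rewrite d3. unfold Rabs in *; repeat destruct (Rcase_abs _); lra. }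
  assert (N4 : len b + (len s' - len s) - 1200 * d <= dist (h $ b $ o) o <= len b + (len s' - len s) + 1206 * d).
  { rewrite d4. unfold Rabs in *; repeat destruct (Rcase_abs _); lra. }
  clear l1 l2 l3 l4 g1 g2 g3 g4 d1 d2 d3 d4 t1 t2. set (t := len s' - len s) in *.
  split; [|split].
  - split; [|unfold len in *; lra].
    rewrite <- (gromov_act h), act_KV.
    assert (c1 : gromov o (b $ o) (h $ o) <= 1206 * d).
    { unfold gromov. rewrite (dist_sym _ o (h $ o)), (dist_sym _ (b $ o) (h $ o)), (dist_sym _ o (b $ o)).
      fold (len b). lra. }
    replace (1900 * d) with (1899 * d + d) by lra. apply (hyp_cut _ (b $ o)); [lra|].
    assert (c3 : t - 604 * d <= gromov (h $ b $ o) (h $ h $ o) (h $ o)).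
    { rewrite gromov_act. unfold gromov. rewrite (dist_sym _ (b $ o) (h $ o)). fold (len b). lra. }
    assert (c4 : 100000 * kap <= gromov (b $ o) (h $ b $ o) (h $ o)).
    { unfold gromov. rewrite act_dist. fold (len b). rewrite (dist_sym _ (b $ o) (h $ b $ o)), (dist_sym _ (b $ o) (h $ o)). lra. }
    pose proof (hyp_min (b $ o) (h $ b $ o) (h $ h $ o) (h $ o) (100000 * kap) c4 ltac:(lra)). lra.
  - split; [|unfold len in *; lra].
    assert (c1 : gromov o (h $ b $ o) (b $ o) <= 1804 * d).
    { unfold gromov. rewrite (dist_sym _ o (b $ o)), (dist_sym _ o (h $ b $ o)). fold (len b). lra. }
    assert (c2 : t - 1300 * d <= gromov ((h^-1) $ b $ o) o (b $ o)).
    { rewrite <- (gromov_act h), act_KV. unfold gromov. rewrite act_dist.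
      rewrite (dist_sym _ (b $ o) (h $ b $ o)), (dist_sym _ (b $ o) (h $ o)), (dist_sym _ o (b $ o)). fold (len b). lra. }
    rewrite gromov_sym. replace (1900 * d) with (1899 * d + d) by lra. apply (hyp_cut _ o).
    + rewrite gromov_sym. lra.
    + rewrite gromov_sym. lra.
  - exact N1.
Qed.

(** Every [s] carries two points deep in the segment from [o] to [b $ o] onto the geodesic to
    [g $ o], at places known up to the spread of the lengths; [spot] applies. *)
Lemma pre_spot g b c P : long kap <= len b -> NoDup P ->
  (forall s, In s P -> pre g s b /\ c <= len s <= c + 200000 * kap) -> (length P <= m1)%nat.
Proof.
  intros hb hP hs. consts. unfold long, len in hb.
  destruct (geodesic_fun o (b $ o)) as [sg hsg]. rewrite (dist_sym _ o (b $ o)) in hsg.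
  destruct (hsg (8000 * d) ltac:(lra)) as [a1 a2]. destruct (hsg (8000 * d + kap) ltac:(lra)) as [b1 b2].
  assert (key : forall s t, In s P -> 8000 * d <= t <= 8000 * d + kap -> gromov o (g $ o) (s $ sg t) <= 2 * d).
  { intros s t hi ht. destruct (hs s hi) as [[p1 [p2 _]] _]. destruct (hsg t ltac:(lra)) as [t1 t2].
    replace (2 * d) with (0 + 2 * d) by lra.
    rewrite act_mul in p2.
    apply (line_between o (g $ o) (s $ o) (s $ b $ o) _ (602 * d) 0); auto; try (rewrite act_dist); try lra.
    rewrite gromov_act. unfold gromov. rewrite (dist_sym _ o (b $ o)). lra. }
  apply (spot o (g $ o) (sg (8000 * d)) (sg (8000 * d + kap)) (2 * d) (c - 8000 * d) (200000 * kap + 16000 * d)); auto; try lra.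
  - pose proof (dist_tri _ o (sg (8000 * d)) (sg (8000 * d + kap))). lra.
  - apply natceil_div.
  - intros s hi. split; [apply key; auto; lra|]. split; [apply key; auto; lra|].
    destruct (hs s hi) as [_ hc]. unfold len in hc.
    pose proof (line_dist_ge o (s $ sg (8000 * d)) (s $ o)) as l. rewrite act_dist, (dist_sym _ (sg (8000 * d)) o), a1 in l.
    unfold Rabs in l; destruct (Rcase_abs _); lra.
Qed.

(* Many [s'] in [S], slightly shorter than [s], such that all [s' b] follow one geodesic. *)
Definition heavy b (S : list G) s := exists g P, NoDup P /\ incl P S /\ In s P /\ (m2 < length P)%nat /\
  forall s', In s' P -> pre g s' b /\ len s - len b / INR K <= len s' <= len s.

(** In a bucket of width [len b / INR K] with more than [m2] elements the longest one would be
    heavy. *)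
Lemma light_count g b S c P : long kap <= len b -> NoDup P -> incl P S ->
  (forall s, In s P -> ~ heavy b S s /\ pre g s b /\ c <= len s <= c + 2 * len b) -> (length P <= M1)%nat.
Proof.
  intros hb hP iP hs. consts. pose proof K_ge as hK. pose proof (pos_INR (acylN H)).
  unfold long in hb.
  assert (hw : 0 < len b / INR K) by (apply Rdiv_lt_0_compat; lra).
  assert (hwK : INR K * (len b / INR K) = len b) by (field; lra).
  apply (bucket_pigeonhole len c (len b / INR K)); [auto|auto| |].
  - intros s hi. destruct (hs s hi) as [_ [_ hc]].
    rewrite plus_INR, mult_INR. simpl (INR 2). simpl (INR 1). nra.
  - intros F t nF iF hF. destruct (Nat.le_gt_cases (length F) m2) as [|hgt]; auto. exfalso.
    destruct (exists_max len F) as [s [hsF hmx]]; [intros e; rewrite e in hgt; simpl in hgt; lia|].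
    destruct (hs s (iF s hsF)) as [hnh _]. apply hnh.
    exists g, F. split; [auto|]. split; [intros u hu; auto|]. split; auto. split; auto.
    intros u hu. destruct (hs u (iF u hu)) as [_ [hpu _]]. split; auto.
    specialize (hmx u hu). pose proof (hF u hu). pose proof (hF s hsF). lra.
Qed.

(* [k] is a period of [b]; in the tail lemma [w] is [s^-1 s' o] for the shortest [s'] witnessing that
   [s] is heavy, so that the axis of [k] follows [s^-1] over many periods. *)
Definition tail k (w : X) s b := axial (1900 * d) k o /\ online k (1904 * d) (b $ o) /\
  online k (1904 * d) w /\ INR K * len k <= 2 * dist w o /\ dist w o <= len s /\
  gromov ((s^-1) $ o) o w <= 604 * d /\ long kap <= dist w ((s^-1) $ o) /\ INR K * len k <= 2 * len b.

(** More than [m1] elements spread over a range [D] above [200000 kap], and pigeonhole yields two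
    whose lengths differ by at most [D / INR K]; their quotient is [k]. Both [k] and the quotient
    [hm] by the shortest element translate along the segment to [b $ o], hence are commensurable. So
    the axis of [k] also passes by the preimage of [o] under [hm], at distance about [D] from
    [o]. *)
Lemma tail_of_heavy b S s : long kap <= len b -> (forall u, In u S -> long kap <= len u) ->
  heavy b S s -> exists k w, tail k w s b.
Proof.
  intros hb hS [g [P [nP [iP [hsP [hl hp]]]]]]. consts. pose proof K_ge as hK.
  pose proof (pos_INR (acylN H)) as hN0. unfold long in *.
  assert (hw : 0 < len b / INR K) by (apply Rdiv_lt_0_compat; lra).
  assert (hwK : INR K * (len b / INR K) = len b) by (field; lra).
  set (W := len b / INR K) in *.
  destruct (exists_min len P) as [sm [hsm hmin]]; [intros e; rewrite e in hl; simpl in hl; lia|].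
  set (D := len s - len sm) in *.
  assert (hD0 : 0 <= D) by (specialize (hmin s hsP); unfold D; lra).
  assert (hDW : D <= W) by (destruct (hp sm hsm); unfold D; lra).
  assert (hD1 : 200000 * kap < D).
  { apply Rnot_le_lt. intros hle. assert (length P <= m1)%nat.
    { apply (pre_spot g b (len sm)); auto. intros u hu. destruct (hp u hu). specialize (hmin u hu).
      split; auto. unfold D in hle. lra. }
    unfold heavy_bound in hl. lia. }
  assert (ex : exists si sj, In si P /\ In sj P /\ 200000 * kap <= len sj - len si <= D / INR K).
  { apply NNPP; intros hn.
    assert (0 < D / INR K) by (apply Rdiv_lt_0_compat; lra).
    assert (INR K * (D / INR K) = D) by (field; lra).
    assert (length P <= m2)%nat; [|lia].
    apply (bucket_pigeonhole len (len sm) (D / INR K)); [auto|auto| |].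
    - intros u hi. destruct (hp u hi) as [_ hc]. specialize (hmin u hi).
      rewrite plus_INR. simpl (INR 1). unfold D in *. lra.
    - intros F c nF iF hF. destruct F as [|u0 q] eqn:eF; [simpl; lia|]. rewrite <- eF in *.
      destruct (exists_min len F) as [si [hsi hmi]]; [congruence|].
      apply (pre_spot g b (len si)); auto.
      intros u hu. split; [apply hp; auto|]. specialize (hmi u hu). split; auto.
      apply Rnot_lt_le. intros hlt. apply hn. exists si, u.
      pose proof (hF u hu). pose proof (hF si hsi). repeat split; auto; lra. }
  destruct ex as [si [sj [hsi [hsj [ht1 ht2]]]]].
  assert (hDK : INR K * (D / INR K) = D) by (field; lra).
  set (t := len sj - len si) in *.
  assert (htK : 100 * t <= D /\ INR K * t <= D).
  { assert (INR K * t <= D) by (rewrite <- hDK; apply Rmult_le_compat_l; lra).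
    split; auto. assert (100 * t <= INR K * t) by (apply Rmult_le_compat_r; lra). lra. }
  assert (hWb : 100 * W <= len b) by nra.
  set (k := (si^-1 * sj)%g). set (hm := (sm^-1 * s)%g).
  destruct (pre_axial g si sj b) as [k1 [k2 k3]]; [apply hp; auto|apply hp; auto|auto|fold t; lra|].
  destruct (pre_axial g sm s b) as [h1 [h2 h3]]; [apply hp; auto|apply hp; auto|fold D; lra|fold D; lra|].
  fold k in k1, k2, k3. fold hm in h1, h2, h3. fold t in k3. fold D in h3.
  assert (hNk : INR (acylN H) * len k <= INR (acylN H) * (2 * t)) by (apply Rmult_le_compat_l; lra).
  assert (cm : commensurable k hm).
  { apply (commens_of_overlap (1900 * d) k hm o (b $ o) (1904 * d) o o); auto; try lra.
    - apply (axial_lox_1900 _ o); auto.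
    - fold (len k). fold (len hm). rewrite (dist_sym _ o (b $ o)). fold (len b). nra. }
  exists k, ((hm^-1) $ o).
  assert (ew : dist ((hm^-1) $ o) o = dist (sm $ o) (s $ o)).
  { unfold hm. rewrite ginv_mul, ginv_inv, act_mul, dist_act_l, ginv_inv. reflexivity. }
  destruct (hp sm hsm) as [[q1 _] _]. destruct (hp s hsP) as [[q2 _] _].
  pose proof (on_line g _ _ q1 q2) as ol. pose proof (line_dist_ge o (sm $ o) (s $ o)) as ol'.
  fold (len sm) in *. fold (len s) in *.
  pose proof (hS sm (iP sm hsm)) as lsm.
  assert (ol2 : D <= dist (sm $ o) (s $ o) <= D + 1206 * d).
  { unfold D in *. unfold Rabs in *; repeat destruct (Rcase_abs _); lra. }
  split; [auto|]. split; [apply axial_online_1904; auto|]. split.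
  { apply (online_commens hm); [apply commens_sym; auto|]. apply online_stab; [|apply axial_online_1904; auto].
    apply stab_inv. rewrite <- (gpow_1 hm) at 2. apply stab_pow. }
  rewrite ew. split; [nra|]. split; [unfold D in *; lra|]. split; [|split].
  - rewrite gromov_act_x. rewrite ginv_inv. rewrite <- act_mul.
    replace (hm * s^-1)%g with (sm^-1)%g by (unfold hm; grp).
    rewrite <- (gromov_act sm), act_KV. unfold hm. rewrite <- act_mul. grp.
    unfold gromov. rewrite (dist_sym _ o (sm $ o)), (dist_sym _ (s $ o) (sm $ o)), (dist_sym _ o (s $ o)).
    fold (len s). fold (len sm). unfold D in *. lra.
  - rewrite <- (act_dist s), act_KV. unfold hm. rewrite <- act_mul. grp. exact lsm.
  - nra.
Qed.

(** The axis of [k] follows [u], so that of [u^-1 k u] passes by [u^-1 $ o] and [o] and meets [h]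
    along its tail. Hence this conjugate is also periodic along [v]; conjugating once more by [v]
    brings it onto the tail of [k], and [k] is commensurable with its own conjugate. The order of
    [len k] and [len h] makes the first tail long enough for both periods. *)
Lemma half_heavy u v h k w w' : tail h w u v -> tail k w' v u -> len k <= len h ->
  long kap <= len u -> long kap <= len v ->
  commensurable h (u^-1 * k * u)%g /\ stab k (u * v)%g.
Proof.
  intros [a1 [a2 [a3 [a4 [a5 [a6 [a7 a8]]]]]]] [b1 [b2 [b3 [b4 [b5 [b6 [b7 b8]]]]]]] hkh hu hv.
  consts. pose proof K_ge as hK. pose proof (pos_INR (acylN H)) as hN0.
  unfold long in *.
  assert (hT : 100000 * kap <= len k) by apply b1.
  assert (hNh : 0 <= INR (acylN H) * len h) by (apply Rmult_le_pos; lra).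
  assert (hNk : 0 <= INR (acylN H) * len k) by (apply Rmult_le_pos; lra).
  rewrite hK in a4, b4.
  assert (a4' : 100 * (INR (acylN H) * len h) + 100 * len h <= 2 * dist w o) by lra.
  assert (b4' : 100 * (INR (acylN H) * len k) + 100 * len k <= 2 * dist w' o) by lra.
  assert (cj : forall (x g0 : G) e0 z, online g0 e0 z -> online (x^-1 * g0 * x)%g e0 ((x^-1) $ z)).
  { intros x g0 e0 z oz. pose proof (online_conj (x^-1)%g g0 e0 z oz) as c. rewrite ginv_inv in c. exact c. }
  assert (lj : forall (x g0 : G), lox g0 -> lox (x^-1 * g0 * x)%g).
  { intros x g0 l0. pose proof (lox_conj (x^-1)%g g0 l0) as c. rewrite ginv_inv in c. exact c. }
  assert (lk : lox k) by (apply (axial_lox_1900 _ o); auto).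
  assert (C1 : commensurable h (u^-1 * k * u)%g).
  { assert (o1 : online (u^-1 * k * u)%g (1904 * d) ((u^-1) $ o)) by (apply cj, axial_online_1904; auto).
    assert (o2 : online (u^-1 * k * u)%g (1904 * d) o).
    { rewrite <- (act_VK u o). apply cj; auto. }
    apply (commens_of_overlap (1900 * d) h _ o w (1904 * d) o ((u^-1) $ o)); auto; try lra.
    - apply (online_mono _ (604 * d + 2 * d)); [lra|].
      apply (online_between _ (1904 * d) (604 * d) ((u^-1) $ o) o); auto; try lra;
      rewrite (dist_sym _ _ w); lra.
    - rewrite <- !act_mul. grp. rewrite act_mul, act_dist. fold (len h). fold (len k).
      rewrite (dist_sym _ o w). lra. }
  split; auto.
  set (k' := ((u * v)^-1 * k * (u * v))%g).
  assert (ek : k' = (v^-1 * (u^-1 * k * u) * v)%g) by (unfold k'; grp).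
  assert (oh : forall z, online h (1904 * d) z -> online k' (1904 * d) ((v^-1) $ z)).
  { intros z oz. rewrite ek. apply cj. apply (online_commens h); auto. }
  assert (o1 : online k' (1904 * d) ((v^-1) $ o)) by (apply oh, axial_online_1904; auto).
  assert (o2 : online k' (1904 * d) o) by (rewrite <- (act_VK v o); apply oh; auto).
  assert (C2 : commensurable k k').
  { apply (commens_of_overlap (1900 * d) k _ o w' (1904 * d) o (((u * v)^-1) $ o)); auto; try lra.
    - unfold k'. apply lj; auto.
    - apply (online_mono _ (604 * d + 2 * d)); [lra|].
      apply (online_between _ (1904 * d) (604 * d) ((v^-1) $ o) o); auto; try lra;
      rewrite (dist_sym _ _ w'); lra.
    - unfold k'. rewrite <- !act_mul.
      replace ((u * v)^-1 * k * (u * v) * (u * v)^-1)%g with ((u * v)^-1 * k)%g by grp.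
      rewrite act_mul, act_dist. fold (len k). rewrite (dist_sym _ o w'). lra. }
  replace (u * v)%g with (((u * v)^-1)^-1)%g by apply ginv_inv. apply stab_inv.
  unfold stab. rewrite ginv_inv. exact C2.
Qed.

Lemma both_heavy u v h k w w' : tail h w u v -> tail k w' v u ->
  long kap <= len u -> long kap <= len v -> stab k (u * v)%g.
Proof.
  intros a b hu hv. destruct (Rle_dec (len k) (len h)) as [hkh|hkh].
  - apply (half_heavy u v h k w w'); auto.
  - destruct (half_heavy v u k h w' w b a ltac:(lra) hv hu) as [c s].
    apply (stab_conj (v^-1)%g) in s. rewrite ginv_inv in s.
    replace (v^-1 * (v * u) * v)%g with (u * v)%g in s by grp.
    apply (stab_commens (v^-1 * h * v)%g); auto. apply commens_sym, c.
Qed.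

(** [vm] is so long that it runs along [v1], [u] and a piece of [v2] about as long as [u]. Its
    period [hm] meets [h1] at the beginning and the period of [v2], conjugated by [v1 u], on that
    piece. *)
Lemma far_commens g u v1 v2 vm h1 h2 hm w1 w2 wm :
  tail h1 w1 u v1 -> tail h2 w2 u v2 -> tail hm wm u vm ->
  long kap <= len u -> len u <= len v1 -> len u <= len v2 -> len v1 + 2 * len u < len vm ->
  pre g v1 u -> pre g vm u -> gromov o (g $ o) ((v1 * u * v2) $ o) <= 602 * d ->
  len v1 + len u + len v2 - 2402 * d <= len (v1 * u * v2)%g ->
  commensurable h1 ((v1 * u) * h2 * (v1 * u)^-1)%g.
Proof.
  intros [a1 [a2 [a3 [a4 [a5 _]]]]] [b1 [b2 [b3 [b4 [b5 _]]]]] [c1 [c2 [c3 [c4 [c5 _]]]]]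
    hu hu1 hu2 hfar pv1 pvm hq hl.
  pose proof pv1 as [p1 [p2 p3]]. pose proof pvm as [q1 _].
  consts. pose proof K_ge as hK. pose proof (pos_INR (acylN H)) as hN0.
  unfold long in *.
  assert (bnd : forall k w, INR K * len k <= 2 * dist w o -> dist w o <= len u ->
     100 * (INR (acylN H) * len k) + 100 * len k <= 2 * len u).
  { intros k w e1 e2. rewrite hK in e1. lra. }
  pose proof (bnd _ _ a4 a5) as T1. pose proof (bnd _ _ b4 b5) as T2. pose proof (bnd _ _ c4 c5) as T3.
  assert (nn : forall k, 0 <= len k) by (intros; apply dist_ge0).
  assert (nN : forall k, 0 <= INR (acylN H) * len k) by (intros; apply Rmult_le_pos; auto).
  pose proof (nn h1). pose proof (nn h2). pose proof (nn hm). pose proof (nN h1). pose proof (nN h2). pose proof (nN hm).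
  assert (lg : len vm - 1204 * d <= dist o (g $ o)).
  { unfold gromov in q1. pose proof (dist_ge0 _ (g $ o) (vm $ o)). rewrite (dist_sym _ o (vm $ o)) in q1. fold (len vm) in q1. lra. }
  destruct (geodesic_fun o (g $ o)) as [sg hsg].
  assert (on0 : forall c, 0 <= c <= dist o (g $ o) -> gromov o (g $ o) (sg c) <= 602 * d).
  { intros c hc. destruct (hsg c hc) as [s1 s2]. rewrite (gromov_geo _ _ _ c s1 s2). lra. }
  assert (P1 : forall v h0 w0 c, axial (1900 * d) h0 o -> online h0 (1904 * d) (v $ o) -> pre g v w0 ->
     10000 * d <= c -> c <= len v - 10000 * d -> c <= dist o (g $ o) -> online h0 (605 * d) (sg c)).
  { intros v h0 w0 c x1 x2 [x3 _] x4 x5 x6. destruct (hsg c ltac:(lra)) as [s1 s2].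
    pose proof (on_line g _ _ (on0 c ltac:(lra)) x3) as l. pose proof (line_dist_ge o (sg c) (v $ o)) as l'.
    rewrite (dist_sym _ (sg c) o), s1 in l, l'. fold (len v) in l, l'.
    replace (605 * d) with (603 * d + 2 * d) by lra.
    apply (online_between h0 (1904 * d) (603 * d) o (v $ o)); auto; try lra.
    - unfold gromov. rewrite s1, (dist_sym _ (v $ o) (sg c)), (dist_sym _ o (v $ o)). fold (len v).
      unfold Rabs in *; repeat destruct (Rcase_abs _); lra.
    - rewrite (dist_sym _ (v $ o) (sg c)). unfold Rabs in *; repeat destruct (Rcase_abs _); lra. }
  set (k := ((v1 * u) * h2 * (v1 * u)^-1)%g).
  assert (Ck : commensurable hm k).
  { assert (P2 : forall c, len v1 + len u + 10000 * d <= c <= len v1 + 2 * len u - 20000 * d ->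
       online k (1208 * d) (sg c)).
    { intros c hc. destruct (hsg c ltac:(lra)) as [s1 s2].
      pose proof (on_line g _ _ (on0 c ltac:(lra)) p2) as l1. pose proof (line_dist_ge o (sg c) ((v1 * u) $ o)) as l1'.
      pose proof (on_line g _ _ (on0 c ltac:(lra)) hq) as l2. pose proof (line_dist_ge o (sg c) ((v1 * u * v2) $ o)) as l2'.
      pose proof (dist_tri _ ((v1 * u) $ o) (v1 $ o) o) as tr.
      rewrite (act_mul v1 u), act_dist, <- act_mul in tr. fold (len v1) in tr. fold (len u) in tr.
      rewrite (dist_sym _ (sg c) o), s1 in l1, l1', l2, l2'.
      fold (len (v1 * u)%g) in *. fold (len (v1 * u * v2)%g) in *.
      assert (pq : dist ((v1 * u) $ o) ((v1 * u * v2) $ o) = len v2).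
      { rewrite (act_mul (v1 * u)%g), act_dist, dist_sym. reflexivity. }
      pose proof (line_dist_ge o ((v1 * u) $ o) ((v1 * u * v2) $ o)) as l3. rewrite pq in l3.
      fold (len (v1 * u)%g) in *. fold (len (v1 * u * v2)%g) in *.
      replace (1208 * d) with (1206 * d + 2 * d) by lra.
      apply (online_between k (1904 * d) (1206 * d) ((v1 * u) $ o) ((v1 * u * v2) $ o)); auto; try lra.
      - apply online_conj, axial_online_1904; auto.
      - rewrite (act_mul (v1 * u)%g). apply online_conj; auto.
      - unfold gromov. rewrite pq, (dist_sym _ _ (sg c)), (dist_sym _ ((v1 * u * v2) $ o) (sg c)).
        unfold Rabs in *; repeat destruct (Rcase_abs _); lra.
      - rewrite (dist_sym _ _ (sg c)). unfold Rabs in *; repeat destruct (Rcase_abs _); lra.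
      - rewrite (dist_sym _ _ (sg c)). unfold Rabs in *; repeat destruct (Rcase_abs _); lra. }
    set (ca := len v1 + len u + 10000 * d). set (cb := len v1 + 2 * len u - 20000 * d).
    apply (commens_of_overlap (1900 * d) hm k (sg ca) (sg cb) (1208 * d) o ((v1 * u) $ o)); auto; try lra.
    - apply lox_conj, (axial_lox_1900 h2 o); auto.
    - apply (online_mono _ (605 * d)); [lra|]. apply (P1 vm hm u); auto; try (unfold ca; lra).
    - apply (online_mono _ (605 * d)); [lra|]. apply (P1 vm hm u); auto; try (unfold cb; lra).
    - apply P2. unfold ca, cb; lra.
    - apply P2. unfold ca, cb; lra.
    - unfold k. rewrite <- !act_mul.
      replace (v1 * u * h2 * (v1 * u)^-1 * (v1 * u))%g with ((v1 * u) * h2)%g by grp.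
      rewrite (act_mul (v1 * u)%g), act_dist. fold (len hm). fold (len h2).
      destruct (hsg ca) as [s1 _]; [unfold ca; lra|]. destruct (hsg cb) as [s2 _]; [unfold cb; lra|].
      pose proof (dist_tri _ o (sg ca) (sg cb)). unfold ca, cb in *. lra. }
  assert (C1 : commensurable h1 hm).
  { set (cc := len u - 20000 * d).
    apply (commens_of_overlap (1900 * d) h1 hm o (sg cc) (1904 * d) o o); auto; try lra.
    - apply (axial_lox_1900 hm o); auto.
    - apply (online_mono _ (605 * d)); [lra|]. apply (P1 v1 h1 u); auto; try (unfold cc; lra).
    - apply (online_mono _ (605 * d)); [lra|]. apply (P1 vm hm u); auto; try (unfold cc; lra).
    - fold (len h1). fold (len hm). destruct (hsg cc) as [s1 _]; [unfold cc; lra|]. unfold cc in *. lra. }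
  eapply commens_trans; eauto.
Qed.

End Patterns.

(** * Separating letters in the diffuse case *)

Lemma good_mono {G : Group} (U : list G) M C M' C' : (M <= M')%nat -> (C <= C')%nat ->
  good U M C -> good U M' C'.
Proof.
  intros hM hC [S [al [b [h1 [h2 [h3 [h4 [h5 h6]]]]]]]]. exists S, al, b.
  repeat split; auto; [nia|]. intros g P nP hP. specialize (h6 g P nP hP). lia.
Qed.

Lemma sel_none {T} (P : T -> Prop) l : (forall x, In x l -> ~ P x) -> sel P l = [].
Proof.
  intros h. destruct (sel P l) as [|z q] eqn:e; auto. exfalso.
  assert (hz : In z (sel P l)) by (rewrite e; simpl; auto). apply in_sel in hz as [h1 h2]. exact (h z h1 h2).
Qed.

Section Diffuse.
Context {H : acyl_action}.
Variable o : spc H.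
Local Notation X := (spc H).
Local Notation G := (grp H).
Local Notation d := (delta H).
Local Notation kap := (kappa H).
Local Notation K := (fineness (acylN H)).
Local Notation MA := (coset_bound (delta H) (kappa H) (acylN H)).
Local Notation M1 := (light_bound (delta H) (kappa H) (acylN H)).
Local Notation len := (len o).
Local Notation red := (red o).
Local Notation pre := (pre o).
Local Notation heavy := (heavy o).
Local Notation tail := (tail o).

#[local] Hint Resolve axial_online_1904 : core.

(** Both periods follow [u] for many repetitions. So one period can serve all [v] next to the same
    [u], which gathers these [v] in one coset. *)
Lemma tail_commens (u v v' k k' : G) w w' : long kap <= len u -> tail k w v u -> tail k' w' v' u ->
  commensurable k k'.
Proof.
  intros hu [a1 [a2 [_ [_ [_ [_ [_ a8]]]]]]] [b1 [b2 [_ [_ [_ [_ [_ b8]]]]]]].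
  consts. pose proof (@K_ge H) as hK. pose proof (pos_INR (acylN H)) as hN0.
  unfold long in hu. rewrite hK in a8, b8.
  assert (0 <= INR (acylN H) * len k) by (apply Rmult_le_pos; auto; apply dist_ge0).
  assert (0 <= INR (acylN H) * len k') by (apply Rmult_le_pos; auto; apply dist_ge0).
  assert (0 <= len k) by apply dist_ge0. assert (0 <= len k') by apply dist_ge0.
  apply (commens_of_overlap (1900 * d) k k' o (u $ o) (1904 * d) o o); auto; try lra.
  - apply (axial_lox_1900 _ o); auto.
  - rewrite (dist_sym _ o (u $ o)). fold (len u). fold (len k). fold (len k'). lra.
Qed.

(** The letters are not longer than the separator, so all lengths fit into the range of
    [light_count] starting at 0. *)
Lemma light_heads_short S (al : G -> G -> Prop) b L : long kap <= len b -> incl L S ->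
  (forall s, In s S -> red s b /\ long kap <= len s /\ len s <= len b) ->
  (forall s, In s L -> ~ heavy b S s) -> few_heads L al b M1.
Proof.
  intros hb hi hS hL g P nP hP.
  assert (hPL : forall s, In s P -> In s L) by (intros s hs; destruct (hP s hs) as [t [l [[h1 _] _]]]; auto).
  consts. unfold long in *.
  apply (light_count o g b S 0); auto.
  - intros s hs; auto.
  - intros s hs. split; [auto|]. destruct (hP s hs) as [t [l [hv e]]]. apply valid_incl in hv.
    split.
    + apply (pre_of_word o b s t l g); auto. intros s' hs'. destruct (hS s') as [? [? _]]; auto.
    + destruct (hS s) as [_ [_ h3]]; auto. assert (0 <= len s) by apply dist_ge0. lra.
Qed.

(** The letters may be much longer than [u], beyond the range of [light_count]. If one first letter
    were shorter than the longest by more than [2 * len u], [far_commens] would align its period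
    with that of its successor, which [al] forbids. *)
Lemma light_heads_long S (al : G -> G -> Prop) u L (hh : G -> G) (ww : G -> X) :
  long kap <= len u -> incl L S ->
  (forall s, In s S -> red s u /\ len u <= len s /\ tail (hh s) (ww s) u s) ->
  (forall s t, al s t -> ~ commensurable (hh s) ((s * u) * hh t * (s * u)^-1)%g) ->
  (forall s, In s L -> ~ heavy u S s) -> few_heads L al u M1.
Proof.
  intros hu hi hS hal hL g P nP hP.
  assert (hPL : forall s, In s P -> In s L) by (intros s hs; destruct (hP s hs) as [t [l [[h1 _] _]]]; auto).
  consts.
  destruct P as [|p0 P']; [simpl; lia|]. set (P := p0 :: P') in *.
  destruct (exists_max len P) as [vm [hvm hmax]]; [unfold P; congruence|].
  assert (word : forall s, In s P -> exists t, al s t /\ In t L /\ pre g s u /\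
     gromov o (g $ o) ((s * u * t) $ o) <= 602 * d /\ len s + len u + len t - 2402 * d <= len (s * u * t)%g).
  { intros s hs. destruct (hP s hs) as [t [l [hv e]]]. exists t.
    destruct hv as [h1 [h2 h3]]. split; auto. split; [apply h3|].
    apply (pre_of_word o u s t l g); auto. intros s' hs'.
    assert (hs2 : In s' L) by (destruct hs' as [<-|hs']; auto; apply valid_incl in h3; auto).
    destruct (hS s') as [? [? _]]; auto. split; auto. lra. }
  destruct (word vm hvm) as [_ [_ [_ [pvm _]]]].
  apply (light_count o g u S (len vm - 2 * len u)); auto.
  - intros s hs; auto.
  - intros s hs. split; [auto|]. destruct (word s hs) as [t [ha [ht [p1 [p2 p3]]]]]. split; auto.
    specialize (hmax s hs). split; [|lra].
    apply Rnot_lt_le. intros hlt. apply (hal s t ha).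
    destruct (hS s) as [_ [q1 q2]]; auto. destruct (hS t) as [_ [q3 q4]]; auto. destruct (hS vm) as [_ [_ q6]]; auto.
    apply (far_commens o g u s t vm (hh s) (hh t) (hh vm) (ww s) (ww t) (ww vm)); auto. lra.
Qed.

(** Transitions aligning the periods of two letters are forbidden, yet half of all transitions must
    remain. Either no commensurability class of periods holds a quarter of [V], or one works inside
    such a class, where a transition from [s] is forbidden only if [s u] is in [stab (hh v0)]; if
    half of the class is of that kind, it lies in a coset. *)
Lemma periodic_good (U V : list G) (u : G) (hh : G -> G) (ww : G -> X) (c : nat) :
  not_in_infinite_virtually_cyclic U -> In u U -> NoDup V -> incl V U -> long kap <= len u ->
  (forall v, In v V -> red v u /\ len u <= len v /\ tail (hh v) (ww v) u v) ->
  (length U <= c * length V)%nat ->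
  (length U <= 64 * c * MA)%nat \/ good U (M1 + MA) (64 * c).
Proof.
  intros hU huU nV iV hu hV hc. consts.
  set (al := fun s t => ~ commensurable (hh s) ((s * u) * hh t * (s * u)^-1)%g).
  assert (hV2 : ((length U <= 64 * c * MA)%nat \/ good U (M1 + MA) (64 * c)) \/
    exists V2, NoDup V2 /\ incl V2 V /\ (length V <= 8 * length V2)%nat /\
      forall s, In s V2 -> (4 * length (sel (fun t => ~ al s t) V2) <= length V2)%nat).
  { destruct (classic (exists v0, In v0 V /\ (length V <= 4 * length (sel (fun v => commensurable (hh v0) (hh v)) V))%nat)) as [[v0 [hv0 hpop]]|hnp].
    - set (V1 := sel (fun v => commensurable (hh v0) (hh v)) V) in *.
      destruct (Nat.le_gt_cases (length V1) (2 * length (sel (fun v => stab (hh v0) (v * u)%g) V1))) as [hb|hb].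
      + left. destruct (hV v0 hv0) as [_ [_ [ax _]]].
        destruct (coset_good U (sel (fun v => stab (hh v0) (v * u)%g) V1) (u * hh v0 * u^-1)%g (u $ o) (1900 * d) u (8 * c)) as [hl|hg]; auto.
        * lra.
        * apply axial_conj; auto.
        * apply NoDup_sel, NoDup_sel; auto.
        * intros v hv. apply in_sel in hv as [hv _]. apply in_sel in hv as [hv _]. auto.
        * intros v hv. apply in_sel in hv as [_ hv]. apply (stab_conj u) in hv.
          replace (u * v)%g with (u * (v * u) * u^-1)%g by grp. exact hv.
        * nia.
        * left. nia.
        * right. apply (good_mono U MA (4 * (8 * c))); auto; lia.
      + right. exists (sel (fun v => ~ stab (hh v0) (v * u)%g) V1).
        pose proof (length_sel_split (fun v => stab (hh v0) (v * u)%g) V1) as sp.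
        split; [apply NoDup_sel, NoDup_sel; auto|]. split; [|split; [lia|]].
        * intros v hv. apply in_sel in hv as [hv _]. apply in_sel in hv as [hv _]. auto.
        * intros s hs. rewrite sel_none; [simpl; lia|]. intros t ht hn.
          apply in_sel in hs as [hs hs2]. apply in_sel in hs as [_ hs]. apply in_sel in ht as [ht _]. apply in_sel in ht as [_ ht].
          apply NNPP in hn. apply hs2. unfold stab.
          eapply commens_trans; [exact hs|]. eapply commens_trans; [exact hn|]. apply commens_conj, commens_sym, ht.
    - right. exists V. split; auto. split; [intros v hv; auto|]. split; [lia|].
      intros s hs. destruct (sel (fun t => ~ al s t) V) as [|t0 q] eqn:e; [simpl; lia|]. rewrite <- e.
      assert (ht0 : In t0 V /\ commensurable (hh s) ((s * u) * hh t0 * (s * u)^-1)%g).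
      { assert (hi : In t0 (sel (fun t => ~ al s t) V)) by (rewrite e; simpl; auto).
        apply in_sel in hi as [hi hn]. apply NNPP in hn. auto. }
      destruct ht0 as [ht0 ct0].
      assert (hle : (length (sel (fun t => ~ al s t) V) <= length (sel (fun v => commensurable (hh t0) (hh v)) V))%nat).
      { apply length_sel_mono. intros t ht hn. apply NNPP in hn.
        assert (cc := commens_trans _ _ _ (commens_sym _ _ ct0) hn).
        apply (commens_conj ((s * u)^-1)%g) in cc. grp_in cc. exact cc. }
      assert (~ (length V <= 4 * length (sel (fun v => commensurable (hh t0) (hh v)) V))%nat); [|lia].
      intros hx; apply hnp; eauto. }
  destruct hV2 as [hdone|[V2 [nV2 [iV2 [lV2 hal]]]]]; [exact hdone|].
  assert (hS : forall v, In v V2 -> red v u /\ len u <= len v /\ tail (hh v) (ww v) u v) by (intros; apply hV; auto).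
  pose proof (length_sel_split (fun v => heavy u V2 v) V2) as sp.
  set (Hv := sel (fun v => heavy u V2 v) V2) in *. set (L := sel (fun v => ~ heavy u V2 v) V2) in *.
  destruct (Nat.le_gt_cases (length V2) (2 * length L)) as [hl|hl].
  - right. exists L, al, u. split; [apply NoDup_sel; auto|].
    assert (iL : incl L V2) by (apply incl_sel).
    split; [intros v hv; auto|]. split; [auto|]. split; [nia|]. split.
    + intros s hs. specialize (hal s (iL s hs)).
      assert (length (sel (fun t => ~ al s t) L) <= length (sel (fun t => ~ al s t) V2))%nat; [|lia].
      apply NoDup_incl_length; [apply NoDup_sel, NoDup_sel; auto|].
      intros t ht. apply in_sel in ht as [ht hn]. apply in_sel. split; auto.
    + intros g P nP hP. assert (length P <= M1)%nat; [|lia].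
      apply (light_heads_long V2 al u L hh ww hu iL hS) with (g := g); auto.
      intros v hv. apply in_sel in hv; tauto.
  - assert (hT : forall v, In v Hv -> exists k w, tail k w v u).
    { intros v hv. apply in_sel in hv as [hv hh2]. apply (tail_of_heavy o u V2); auto.
      intros v' hv'. destruct (hS v' hv') as [_ [? _]]. lra. }
    destruct (Nat.eq_dec (length Hv) 0) as [h0|h0]; [left; nia|].
    destruct Hv as [|v0 q] eqn:eH; [simpl in h0; lia|].
    destruct (hT v0 (or_introl eq_refl)) as [k [w hk]]. rewrite <- eH in *. 
    assert (iH : forall v, In v Hv -> In v V2) by (intros v hv; unfold Hv in hv; apply in_sel in hv; tauto).
    (* [16 * c] has a factor 8 for passing from [V] to [V2] and a factor 2 for the heavy part;
       [coset_good] contributes the remaining 4 of 64. *)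
    destruct (coset_good U Hv k o (1900 * d) u (16 * c)) as [hg|hg]; auto.
    + lra.
    + apply hk.
    + apply NoDup_sel; auto.
    + intros v hv; auto.
    + intros v hv. destruct (hT v) as [k' [w' hk']]; [auto|].
      apply (stab_commens k'); [apply (tail_commens u v v0 k' k w' w); auto|].
      destruct (hS v (iH v hv)) as [_ [q1 q2]].
      apply (both_heavy o u v (hh v) k' (ww v) w'); auto. lra.
    + nia.
    + left; nia.
    + right. apply (good_mono U MA (4 * (16 * c))); auto; lia.
Qed.

Lemma diffuse_good (U U0 V : list G) (l : R) (c1 c2 : nat) :
  not_in_infinite_virtually_cyclic U -> NoDup U0 -> incl U0 U -> NoDup V -> incl V U ->
  (forall u, In u U0 -> long kap <= len u <= l) -> (forall v, In v V -> l <= len v /\ long kap <= len v) ->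
  (length U <= c1 * length V)%nat ->
  (forall v, In v V -> (length U <= c2 * length (sel (fun u => red u v) U0))%nat) ->
  (length U <= 256 * c1 * c2 * MA + 2 * c2)%nat \/ good U (M1 + MA) (256 * c1 * c2 + 2 * c2).
Proof.
  intros hU nU0 iU0 nV iV hU0 hV hc1 hc2. consts.
  destruct (Nat.le_gt_cases (length U) (2 * c2)) as [hsm|hlg]; [left; lia|].
  set (S := fun v => sel (fun u => red u v) U0).
  destruct (classic (exists v, In v V /\ (length (S v) <= 2 * length (sel (fun u => ~ heavy v (S v) u) (S v)))%nat)) as [[v [hv hl]]|hn].
  - right. set (L := sel (fun u => ~ heavy v (S v) u) (S v)) in *.
    assert (iL : incl L (S v)) by (apply incl_sel).
    exists L, (fun _ _ => True), v. split; [apply NoDup_sel, NoDup_sel; auto|].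
    split; [intros u hu; apply iU0; apply iL in hu; apply in_sel in hu; tauto|].
    split; [auto|]. specialize (hc2 v hv). fold (S v) in hc2. split; [nia|]. split.
    + intros s _. rewrite sel_none; [simpl; lia|tauto].
    + intros g P nP hP. assert (length P <= M1)%nat; [|lia].
      destruct (hV v hv) as [hv1 hv2].
      apply (light_heads_short (S v) (fun _ _ => True) v L hv2 iL) with (g := g); auto.
      * intros s hs. apply in_sel in hs as [hs hr]. specialize (hU0 s hs). split; auto. split; lra.
      * intros s hs. apply in_sel in hs; tauto.
  - set (Q := fun u v => red u v /\ heavy v (S v) u).
    (* Each [v] has at least [c] heavy partners. Rounding down costs a factor 2, so the common [u]
       is heavy for at least one in [4 * c2] elements of [V]. *)
    set (c := (length U / (2 * c2))%nat).
    assert (hc20 : c2 <> 0%nat).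
    { intros ->. destruct V as [|v q]; [simpl in hc1; lia|]. specialize (hc2 v (or_introl eq_refl)). simpl in hc2. lia. }
    assert (hcc : (2 * c2 * c <= length U < 2 * c2 * (c + 1))%nat).
    { unfold c. pose proof (Nat.div_mod (length U) (2 * c2) ltac:(lia)). pose proof (Nat.mod_upper_bound (length U) (2 * c2) ltac:(lia)). nia. }
    destruct (double_count Q U0 V c) as [u [hu hcnt]].
    { intros v hv. assert (hq : (length (sel (fun u => heavy v (S v) u) (S v)) <= length (sel (fun u => Q u v) U0))%nat).
      { apply NoDup_incl_length; [apply NoDup_sel, NoDup_sel; auto|].
        intros u hu. apply in_sel in hu as [hu hh]. apply in_sel in hu as [hu hr]. apply in_sel. split; auto. split; auto. }
      pose proof (length_sel_split (fun u => heavy v (S v) u) (S v)) as sp.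
      assert (~ (length (S v) <= 2 * length (sel (fun u => ~ heavy v (S v) u) (S v)))%nat) by (intros hx; apply hn; eauto).
      specialize (hc2 v hv). fold (S v) in hc2. nia. }
    { intros e. destruct V as [|v q]; [simpl in hc1; lia|]. specialize (hc2 v (or_introl eq_refl)).
      rewrite e in hc2. simpl in hc2. lia. }
    set (V' := sel (Q u) V) in *.
    assert (hT : forall v, exists kw : G * X, In v V' -> tail (fst kw) (snd kw) u v).
    { intros v. destruct (classic (In v V')) as [hi|hi]; [|exists (1%g, o); tauto].
      apply in_sel in hi as [hv [hr hh]]. destruct (hV v hv) as [hv1 hv2].
      destruct (tail_of_heavy o v (S v) u hv2) as [k [w hk]]; auto.
      - intros u' hu'. apply in_sel in hu' as [hu' _]. apply hU0; auto.
      - exists (k, w); auto. }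
    set (hh := fun v => fst (proj1_sig (constructive_indefinite_description _ (hT v)))).
    set (ww := fun v => snd (proj1_sig (constructive_indefinite_description _ (hT v)))).
    assert (hU0l : (length U0 <= length U)%nat) by (apply NoDup_incl_length; auto).
    assert (hc0 : (1 <= c)%nat) by nia.
    assert (hVV : (length V <= 4 * c2 * length V')%nat).
    { assert (length V * c <= length U * length V')%nat by nia.
      assert (length U <= 4 * c2 * c)%nat by nia.
      assert (length V * length U <= 4 * c2 * (length V * c))%nat by nia.
      assert (length V * length U <= 4 * c2 * (length U * length V'))%nat by nia.
      nia. }
    destruct (periodic_good U V' u hh ww (4 * c1 * c2)) as [hg|hg]; auto.
    + apply NoDup_sel; auto.
    + intros v hv; apply in_sel in hv as [hv _]; auto.
    + apply hU0; auto.
    + intros v hv. assert (hv' := hv). apply in_sel in hv' as [hv1 [hr _]].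
      split; [apply red_sym; auto|]. destruct (hV v hv1). specialize (hU0 u hu). split; [lra|].
      unfold hh, ww. destruct (constructive_indefinite_description _ (hT v)) as [kw hk]; simpl. auto.
    + nia.
    + left; nia.
    + right. apply (good_mono U (M1 + MA) (64 * (4 * c1 * c2))); auto; lia.
Qed.
End Diffuse.

Definition concentrated_bound (dl kp : R) (N : nat) : nat :=
  (2 * natceil (2 * long kp / dl) * N)%nat.

(** [P], the rest of [Q], and the complement of [Q] will be the elements for which a move of the
    base point gains, is neutral, or loses. *)
Lemma sum_three_way {T} (P Q : T -> Prop) (f : T -> R) (al be ga : R) (U : list T) :
  (forall u, P u -> Q u) -> (forall u, In u U -> P u -> f u <= - al) ->
  (forall u, In u U -> Q u -> f u <= be) -> (forall u, In u U -> f u <= ga) ->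
  fold_right Rplus 0 (map f U) <= be * INR (length U) - (al + be) * INR (length (sel P U))
     + (ga - be) * INR (length (sel (fun u => ~ Q u) U)).
Proof.
  intros hPQ; induction U as [|u U IH]; intros h1 h2 h3; [simpl; lra|].
  specialize (IH ltac:(intros; apply h1; simpl; auto) ltac:(intros; apply h2; simpl; auto)
    ltac:(intros; apply h3; simpl; auto)).
  pose proof (h1 u (or_introl eq_refl)) as f1. pose proof (h2 u (or_introl eq_refl)) as f2.
  pose proof (h3 u (or_introl eq_refl)).
  cbn [map fold_right].
  destruct (sel_cons P u U) as [[p1 ->]|[p1 ->]];
  destruct (sel_cons (fun u => ~ Q u) u U) as [[q1 ->]|[q1 ->]]; cbn [length]; rewrite ?S_INR.
  - exfalso; auto.
  - specialize (f1 p1). lra.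
  - lra.
  - apply NNPP in q1. specialize (f2 q1). lra.
Qed.

Lemma sel_unique_le1 {T} (P : T -> Prop) l : NoDup l -> (forall x y, P x -> P y -> x = y) ->
  (length (sel P l) <= 1)%nat.
Proof.
  intros hl hu. destruct (sel P l) as [|a [|b q]] eqn:e; simpl; try lia.
  assert (hn : NoDup (a :: b :: q)) by (rewrite <- e; apply NoDup_sel; auto).
  assert (ha : In a (sel P l)) by (rewrite e; simpl; auto). assert (hb : In b (sel P l)) by (rewrite e; simpl; auto).
  apply in_sel in ha as [_ ha]. apply in_sel in hb as [_ hb]. exfalso.
  inversion hn as [|? ? hna _]; subst. apply hna. left. apply hu; auto.
Qed.

(** * Energy *)

Section Energy.
Context {H : acyl_action}.
Variable o : spc H.
Local Notation X := (spc H).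
Local Notation G := (grp H).
Local Notation d := (delta H).
Local Notation kap := (kappa H).
Local Notation MA := (coset_bound (delta H) (kappa H) (acylN H)).
Local Notation M1 := (light_bound (delta H) (kappa H) (acylN H)).
Local Notation mc := (concentrated_bound (delta H) (kappa H) (acylN H)).
Local Notation len := (len o).
Local Notation red := (red o).
Implicit Types y z p : X.
Implicit Types g h b s u v : G.

(** Both [u $ o] and its counterpart for the inverse lie in the direction of [p], so moving the base
    point by [rho] towards [p] cuts off [rho] at both ends. *)
Lemma move_both u p y rho : dist o y = rho -> rho <= gromov p y o -> 2 * rho <= len u ->
  rho <= gromov (u $ o) p o -> rho <= gromov ((u^-1) $ o) p o -> dist (u $ y) y <= len u - 2 * rho + 6 * d.
Proof.
  intros h1 h2 h3 h4 h5. consts.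
  pose proof (hyp_min _ _ y o rho h4 h2) as a1. pose proof (hyp_min _ _ y o rho h5 h2) as a2.
  pose proof (gromov_dist (u $ o) y o) as b1. pose proof (gromov_dist ((u^-1) $ o) y o) as b2.
  rewrite (dist_act_l (u^-1)%g o y), (dist_act_l (u^-1)%g o o), ginv_inv, (dist_sym _ o (u $ y)), (dist_sym _ o (u $ o)) in b2.
  rewrite (dist_sym _ y o) in *. fold (len u) in *.
  pose proof (act_dist u o y) as b3.
  destruct (four_point (u $ y) (u $ o) y o) as [f|f];
  rewrite ?(dist_sym _ (u $ y) (u $ o)), ?(dist_sym _ y o) in f; fold (len u) in f; lra.
Qed.

(** What may be lost at one end is gained at the other. *)
Lemma move_one u p y rho : dist o y = rho -> rho <= gromov p y o ->
  2 * rho <= len u ->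
  rho <= gromov (u $ o) p o \/ rho <= gromov ((u^-1) $ o) p o -> dist (u $ y) y <= len u + 4 * d.
Proof.
  intros h1 h2 h3 h4. consts.
  pose proof (gromov_dist (u $ o) y o) as b1. pose proof (gromov_dist ((u^-1) $ o) y o) as b2.
  pose proof (gromov_ge0 (u $ o) y o) as c1. pose proof (gromov_ge0 ((u^-1) $ o) y o) as c2.
  rewrite (dist_act_l (u^-1)%g o y), (dist_act_l (u^-1)%g o o), ginv_inv, (dist_sym _ o (u $ y)), (dist_sym _ o (u $ o)) in b2.
  assert (hh : rho - d <= gromov (u $ o) y o \/ rho - d <= gromov ((u^-1) $ o) y o).
  { destruct h4 as [h4|h4]; [left|right]; apply (hyp_min _ p); auto. }
  rewrite (dist_sym _ y o) in *. fold (len u) in *.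
  pose proof (act_dist u o y) as b3. pose proof (dist_ge0 _ o y).
  destruct (four_point (u $ y) (u $ o) y o) as [f|f];
  rewrite ?(dist_sym _ (u $ y) (u $ o)), ?(dist_sym _ y o) in f; fold (len u) in f; destruct hh; lra.
Qed.

Lemma move_any u y : dist (u $ y) y <= len u + 2 * dist o y.
Proof.
  pose proof (dist_tri _ (u $ y) (u $ o) y). pose proof (dist_tri _ (u $ o) o y).
  rewrite act_dist, (dist_sym _ y o) in *. fold (len u) in *. lra.
Qed.

Definition fwd p rho u := rho <= gromov (u $ o) p o.
Definition bwd p rho u := rho <= gromov ((u^-1) $ o) p o.

(* Moving the almost optimal base point by [rho] towards [p] cannot save energy. *)
Lemma energy_balance (U : list G) p rho : U <> [] -> quasi_center (@act H) U d o ->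
  350 * d <= rho <= dist p o ->
  (100 * length (sel (fun u => (2 * rho <= len u)%R /\ fwd p rho u /\ bwd p rho u) U) <=
   100 * length (sel (fun u => ~ ((2 * rho <= len u)%R /\ (fwd p rho u \/ bwd p rho u))) U) + length U)%nat.
Proof.
  intros hU hq hrho. consts.
  destruct (geodesic_fun o p) as [sg hsg]. destruct (hsg rho) as [e1 e2]; [rewrite (dist_sym _ o p); lra|].
  set (y := sg rho) in *.
  specialize (hq y). unfold avg_disp, card in hq.
  assert (hN : 0 < INR (length U)) by (apply lt_0_INR; destruct U; [congruence|simpl; lia]).
  set (P := fun u => 2 * rho <= len u /\ fwd p rho u /\ bwd p rho u).
  set (Q := fun u => 2 * rho <= len u /\ (fwd p rho u \/ bwd p rho u)).
  assert (hs : fold_right Rplus 0 (map (fun u => dist (u $ o) o) U) <=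
               fold_right Rplus 0 (map (fun u => dist (u $ y) y) U) + d * INR (length U)).
  { apply (Rmult_le_compat_r (INR (length U))) in hq; [|lra].
    unfold Rdiv in hq. rewrite Rmult_plus_distr_r, !Rmult_assoc, Rinv_l in hq by lra. lra. }
  assert (gy : rho <= gromov p y o).
  { unfold gromov. rewrite (dist_sym _ y o), e1, e2, (dist_sym _ o p). lra. }
  pose proof (sum_three_way P Q (fun u => dist (u $ y) y - len u) (2 * rho - 6 * d) (4 * d) (2 * rho) U) as st.
  assert (hd : forall l, fold_right Rplus 0 (map (fun u => dist (u $ y) y - len u) l) =
     fold_right Rplus 0 (map (fun u => dist (u $ y) y) l) - fold_right Rplus 0 (map (fun u => dist (u $ o) o) l)).
  { induction l as [|u l IH]; simpl; [lra|]. rewrite IH. change (len u) with (dist (u $ o) o). lra. }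
  rewrite hd in st.
  assert (st' := st ltac:(unfold P, Q; tauto)
    ltac:(intros u _ [q1 [q2 q3]]; pose proof (move_both u p y rho e1 gy q1 q2 q3); lra)
    ltac:(intros u _ [q1 q2]; pose proof (move_one u p y rho e1 gy q1 q2); lra)
    ltac:(intros u _; pose proof (move_any u y); lra)).
  change (length (sel (fun u => 2 * rho <= len u /\ fwd p rho u /\ bwd p rho u) U)) with (length (sel P U)).
  set (a := length (sel P U)) in *.
  change (length (sel (fun u => ~ (2 * rho <= len u /\ (fwd p rho u \/ bwd p rho u))) U)) with (length (sel (fun u => ~ Q u) U)).
  set (b := length (sel (fun u => ~ Q u) U)) in *. set (n := length U) in *.
  assert (han : (a <= n)%nat) by apply length_sel_le. apply le_INR in han.
  pose proof (pos_INR a). pose proof (pos_INR b).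
  apply INR_le. rewrite plus_INR, !mult_INR. replace (INR 100) with 100 by (simpl; lra).
  (* [7 = 1 + 4 + 2]: the slack of the base point, the neutral case, and the error on [P]. For [rho]
     at least [350 * d] this is at most a hundredth of [2 * rho] per element. *)
  assert (hm : 2 * rho * INR a <= 2 * rho * INR b + 7 * d * INR n) by nra.
  assert (7 * d * INR n <= 2 * rho * (INR n / 100)).
  { replace (7 * d * INR n) with (2 * (350 * d) * (INR n / 100)) by field. apply Rmult_le_compat_r; lra. }
  assert (hf : 2 * rho * INR a <= 2 * rho * (INR b + INR n / 100)) by lra.
  apply Rmult_le_reg_l in hf; lra.
Qed.

Definition annulus p rho u := rho - d <= gromov (u $ o) p o < rho \/ rho - d <= gromov ((u^-1) $ o) p o < rho.

(** For each of the two points [u $ o] and [u^-1 $ o] the 201 annuli between [350 * d] and [551 * d]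
    are disjoint, so an element is in at most two of them, and some annulus holds at most a
    hundredth of [U]. *)
Lemma thin_annulus (U : list G) p : U <> [] -> exists rho, 351 * d <= rho <= 600 * d /\
  (100 * length (sel (annulus p rho) U) <= length U)%nat.
Proof.
  intros hU. consts. apply NNPP; intros hn.
  set (c := (length U / 100 + 1)%nat).
  pose proof (Nat.div_mod (length U) 100 ltac:(lia)) as e1. pose proof (Nat.mod_upper_bound (length U) 100 ltac:(lia)) as e2.
  destruct (double_count (fun u (i : nat) => annulus p (350 * d + INR i * d) u) U (seq 1 201) c) as [u [hu hc]]; auto.
  - intros i hi. apply in_seq in hi. apply Nat.le_ngt. intros hlt. apply hn.
    exists (350 * d + INR i * d).
    assert (1 <= INR i) by (apply (le_INR 1); lia).
    assert (INR i <= 201) by (replace 201 with (INR 201) by (simpl; lra); apply le_INR; lia).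
    split; [nra|]. change (fun u : G => annulus p (350 * d + INR i * d) u) with (annulus p (350 * d + INR i * d)) in hlt. unfold c in hlt. lia.
  - assert (h2 : (length (sel (fun i : nat => annulus p (350 * d + INR i * d) u) (seq 1 201)) <= 2)%nat).
    { assert (un : forall t (i j : nat), 350 * d + INR i * d - d <= t < 350 * d + INR i * d ->
        350 * d + INR j * d - d <= t < 350 * d + INR j * d -> i = j).
      { intros t i j a b. destruct (Nat.lt_trichotomy i j) as [hl|[hl|hl]]; auto; exfalso.
        - apply (le_INR (S i)) in hl. rewrite S_INR in hl. nra.
        - apply (le_INR (S j)) in hl. rewrite S_INR in hl. nra. }
      eapply Nat.le_trans.
      - apply (length_sel_or _ (fun i : nat => 350 * d + INR i * d - d <= gromov (u $ o) p o < 350 * d + INR i * d)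
          (fun i : nat => 350 * d + INR i * d - d <= gromov ((u^-1) $ o) p o < 350 * d + INR i * d)).
        intros i _ hi; exact hi.
      - apply (Nat.add_le_mono _ 1 _ 1); apply sel_unique_le1; try apply seq_NoDup; intros i j a b; eapply un; eauto. }
    rewrite length_seq in hc. unfold c in hc. nia.
Qed.

(** Across an annulus of width [d], [z] follows the direction of [p] longer than [z'] does, so the
    two part before [rho]. *)
Lemma red_of_cut p rho (z z' : X) : rho <= 600 * d -> rho <= gromov z p o -> gromov z' p o < rho - d ->
  gromov z z' o <= 600 * d.
Proof.
  intros h0 h1 h2. consts.
  destruct (Rle_dec (gromov z z' o) (600 * d)) as [|hn]; auto. exfalso. apply Rnot_le_lt in hn.
  pose proof (hyp_min z' z p o rho) as hm. rewrite (gromov_sym z' z) in hm. specialize (hm ltac:(lra) h1). lra.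
Qed.

(** The threshold [l] makes each [v] at least as long as the letters of [U0]: [light_heads_short]
    needs this when [v] separates, [light_heads_long] when an element of [U0] does. *)
Definition split_sets (U : list G) (c : nat) := exists U0 V l,
  NoDup U0 /\ incl U0 U /\ NoDup V /\ incl V U /\
  (forall u, In u U0 -> long kap <= len u <= l) /\ (forall v, In v V -> l <= len v /\ long kap <= len v) /\
  (length U <= c * length V)%nat /\
  (forall v, In v V -> (length U <= c * length (sel (fun u => red u v) U0))%nat).

Lemma split_at (U P Q : list G) (c : nat) m :
  (length U <= c * length (sel (fun u => (len u <= m)%R) P))%nat ->
  (length U <= c * length (sel (fun u => (m <= len u)%R) Q))%nat ->
  NoDup P -> NoDup Q -> incl P U -> incl Q U ->
  (forall u, In u P -> long kap <= len u) -> (forall u, In u Q -> long kap <= len u) ->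
  (forall u v, In u P -> In v Q -> red u v) -> split_sets U c.
Proof.
  intros hP hQ nP nQ iP iQ lP lQ hr.
  exists (sel (fun u => len u <= m) P), (sel (fun v => m <= len v) Q), m.
  split; [apply NoDup_sel; auto|]. split; [intros u hu; apply in_sel in hu as [hu _]; auto|].
  split; [apply NoDup_sel; auto|]. split; [intros u hu; apply in_sel in hu as [hu _]; auto|].
  split; [intros u hu; apply in_sel in hu as [hu hl]; auto|].
  split; [intros u hu; apply in_sel in hu as [hu hl]; auto|].
  split; [auto|]. intros v hv. apply in_sel in hv as [hv _].
  rewrite (length_sel_split (fun u => red u v) (sel _ P)), (sel_none (fun u => ~ red u v)), Nat.add_0_r in hP; auto.
  intros u hu hn. apply in_sel in hu as [hu _]. auto.
Qed.

(** [P] is cut at its median length. If at least half of [Q] is above it, the short half of [P] goes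
    with that; otherwise half of [Q] is below it and the roles are exchanged. *)
Lemma split_by_length (U P Q : list G) (c : nat) : (length U <= c * length P)%nat -> (length U <= c * length Q)%nat ->
  NoDup P -> NoDup Q -> incl P U -> incl Q U -> U <> [] ->
  (forall u, In u P -> long kap <= len u) -> (forall u, In u Q -> long kap <= len u) ->
  (forall u v, In u P -> In v Q -> red u v) -> split_sets U (2 * c).
Proof.
  intros hP hQ nP nQ iP iQ hU lP lQ hr.
  assert (hU0 : (1 <= length U)%nat) by (destruct U; [congruence|simpl; lia]).
  assert (hP0 : P <> []) by (intros ->; simpl in hP; lia).
  destruct (median len P hP0) as [m [h1 h2]].
  destruct (Nat.le_gt_cases (length Q) (2 * length (sel (fun v => (m <= len v)%R) Q))) as [hq|hq].
  - apply (split_at U P Q _ m); auto; nia.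
  - apply (split_at U Q P _ m); auto; [|nia|intros u v hu hv; apply red_sym; auto].
    assert (hq2 : (length Q <= 2 * length (sel (fun u => (len u <= m)%R) Q))%nat); [|nia].
    pose proof (length_sel_split (fun v => (m <= len v)%R) Q).
    assert (length (sel (fun v => ~ (m <= len v)%R) Q) <= length (sel (fun u => (len u <= m)%R) Q))%nat; [|lia].
    apply length_sel_mono. intros x _ hx. apply Rnot_le_lt in hx. lra.
Qed.

Lemma reduced_split (U : list G) : U <> [] -> NoDup U -> quasi_center (@act H) U d o ->
  (100 * length (sel (fun u => (len u <= long kap)%R) U) <= length U)%nat ->
  split_sets U 100.
Proof.
  intros hU nU hq hsh. consts.
  set (W := fun u => long kap < len u).
  assert (hW : (100 * length (sel (fun u => ~ W u) U) <= length U)%nat).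
  { assert (length (sel (fun u => ~ W u) U) <= length (sel (fun u => (len u <= long kap)%R) U))%nat; [|lia].
    apply length_sel_mono. intros u _ hu. apply Rnot_lt_le, hu. }
  pose proof (length_sel_split W U) as spW.
  assert (hU0 : (1 <= length U)%nat) by (destruct U; [congruence|simpl; lia]).
  set (near := fun p u => fwd p (600 * d) u \/ bwd p (600 * d) u).
  destruct (classic (exists p, long kap < dist p o /\ (length U < 8 * length (sel (fun u => W u /\ near p u) U))%nat)) as [[p [hp hbig]]|hstar].
  - (* A direction [p] shared by many elements: separate those pointing towards [p] from the others. *)
    destruct (thin_annulus U p hU) as [rho [hrho han]].
    assert (hlong : 2 * rho <= long kap) by (unfold long; lra).
    pose proof (energy_balance U p rho hU hq ltac:(unfold long in *; lra)) as en.
    set (fin := fun u => rho <= gromov (u $ o) p o). set (bin := fun u => rho <= gromov ((u^-1) $ o) p o).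
    set (fout := fun u => gromov (u $ o) p o < rho - d). set (bout := fun u => gromov ((u^-1) $ o) p o < rho - d).
    set (AA := sel (fun u => W u /\ fin u /\ bin u) U). set (AB := sel (fun u => W u /\ fin u /\ bout u) U).
    set (BA := sel (fun u => W u /\ fout u /\ bin u) U). set (BB := sel (fun u => W u /\ fout u /\ bout u) U).
    assert (tri : forall t, t < rho - d \/ rho - d <= t < rho \/ rho <= t) by (intros; lra).
    assert (eAA : (length AA <= length (sel (fun u => (2 * rho <= len u)%R /\ fwd p rho u /\ bwd p rho u) U))%nat).
    { apply length_sel_mono. intros u _ [w [a b]]. split; [unfold W in w; lra|]. split; [exact a|exact b]. }
    assert (eBB : (length (sel (fun u => ~ ((2 * rho <= len u)%R /\ (fwd p rho u \/ bwd p rho u))) U) <=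
       length BB + (length (sel (annulus p rho) U) + length (sel (fun u => ~ W u) U)))%nat).
    { eapply Nat.le_trans; [apply (length_sel_or _ (fun u => W u /\ fout u /\ bout u) (fun u => annulus p rho u \/ ~ W u))|
        apply Nat.add_le_mono_l, length_sel_or; intros x _ hx; exact hx].
      intros u _ hu. destruct (classic (W u)) as [w|w]; [|auto].
      assert (hl : 2 * rho <= len u) by (unfold W in w; lra).
      destruct (tri (gromov (u $ o) p o)) as [a|[a|a]]; [|right; left; left; auto|exfalso; apply hu; split; auto; left; exact a].
      destruct (tri (gromov ((u^-1) $ o) p o)) as [b|[b|b]]; [|right; left; right; auto|exfalso; apply hu; split; auto; right; exact b].
      left. repeat split; auto. }
    assert (eS : (length (sel (fun u => W u /\ near p u) U) <= length AA + (length AB + (length BA + length (sel (annulus p rho) U))))%nat).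
    { eapply Nat.le_trans; [apply (length_sel_or _ (fun u => W u /\ fin u /\ bin u) (fun u => (W u /\ fin u /\ bout u) \/ ((W u /\ fout u /\ bin u) \/ annulus p rho u)))|
        apply Nat.add_le_mono_l].
      - intros u _ [w nr].
        destruct (tri (gromov (u $ o) p o)) as [a|[a|a]]; [|right; right; right; left; auto|];
        (destruct (tri (gromov ((u^-1) $ o) p o)) as [b|[b|b]]; [|right; right; right; right; auto|]).
        + exfalso. destruct nr as [nr|nr]; unfold fwd, bwd in nr; lra.
        + right; right; left. repeat split; auto.
        + right; left. repeat split; auto.
        + left. repeat split; auto.
      - eapply Nat.le_trans; [apply length_sel_or; intros x _ hx; exact hx|].
        apply Nat.add_le_mono_l. apply length_sel_or; intros x _ hx; exact hx. }
    assert (cut : forall z z', rho <= gromov z p o -> gromov z' p o < rho - d -> gromov z z' o <= 600 * d).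
    { intros z z'. apply red_of_cut. lra. }
    assert (cut' : forall z z', rho <= gromov z p o -> gromov z' p o < rho - d -> gromov z' z o <= 600 * d).
    { intros z z' a b. rewrite gromov_sym. auto. }
    assert (lg : forall R u, In u (sel (fun u => W u /\ R u) U) -> long kap <= len u).
    { intros R u hu. apply in_sel in hu as [_ [hu _]]. unfold W in hu. lra. }
    assert (sb : forall R, incl (sel R U) U) by (intros R u hu; apply in_sel in hu; tauto).
    assert (nd : forall R, NoDup (sel R U)) by (intros; apply NoDup_sel; auto).
    (* If [AB] and [BA] are both small, the many elements near [p] are in [AA]. By [energy_balance]
       nearly as many lose under the move, and up to the annulus and the short elements these form
       [BB]. *)
    destruct (Nat.le_gt_cases (length U) (50 * length AB)) as [hAB|hAB]; [|
    destruct (Nat.le_gt_cases (length U) (50 * length BA)) as [hBA|hBA]].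
    + apply (split_by_length U AB AB 50); auto; try apply lg; try apply sb; try apply nd.
      intros u v hu hv. apply in_sel in hu as [_ [_ [u1 u2]]]. apply in_sel in hv as [_ [_ [v1 v2]]].
      split; [apply cut'|apply cut']; auto.
    + apply (split_by_length U BA BA 50); auto; try apply lg; try apply sb; try apply nd.
      intros u v hu hv. apply in_sel in hu as [_ [_ [u1 u2]]]. apply in_sel in hv as [_ [_ [v1 v2]]].
      split; [apply cut|apply cut]; auto.
    + apply (split_by_length U AA BB 50); auto; try apply lg; try apply sb; try apply nd; try lia.
      intros u v hu hv. apply in_sel in hu as [_ [_ [u1 u2]]]. apply in_sel in hv as [_ [_ [v1 v2]]].
      split; [apply cut|apply cut']; auto.
  (* No direction is shared by more than an eighth of [U]. For each [v] the two directions [v $ o]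
     and [v^-1 $ o] thus spoil at most a quarter of [U], while the shorter half of [W0] is almost
     half of [U]. *)
  - assert (hs : forall p, long kap < dist p o -> (8 * length (sel (fun u => W u /\ near p u) U) <= length U)%nat).
    { intros p hp. apply Nat.le_ngt. intros hlt. apply hstar. exists p. split; auto. }
    set (W0 := sel W U) in *.
    assert (hW0 : W0 <> []).
    { intros e. rewrite e in spW. simpl in spW. lia. }
    destruct (median len W0 hW0) as [m [h1 h2]].
    exists (sel (fun u => len u <= m) W0), (sel (fun v => m <= len v) W0), m.
    assert (inW : forall u, In u W0 -> In u U /\ W u) by (intros u hu; apply in_sel in hu; auto).
    split; [apply NoDup_sel, NoDup_sel; auto|]. split; [intros u hu; apply in_sel in hu as [hu _]; apply inW; auto|].
    split; [apply NoDup_sel, NoDup_sel; auto|]. split; [intros u hu; apply in_sel in hu as [hu _]; apply inW; auto|].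
    split; [intros u hu; apply in_sel in hu as [hu hl]; apply inW in hu as [_ hu]; unfold W in hu; lra|].
    split; [intros u hu; apply in_sel in hu as [hu hl]; apply inW in hu as [_ hu]; unfold W in hu; lra|].
    split; [lia|]. intros v hv. apply in_sel in hv as [hv _]. apply inW in hv as [hvU hvW].
    set (U1 := sel (fun u => (len u <= m)%R) W0) in *.
    pose proof (length_sel_split (fun u => red u v) U1) as sp.
    assert (hn : (length (sel (fun u => ~ red u v) U1) <= length (sel (fun u => W u /\ near (v $ o) u) U) + length (sel (fun u => W u /\ near ((v^-1) $ o) u) U))%nat).
    { eapply Nat.le_trans; [apply (length_sel_or _ (fun u => W u /\ near (v $ o) u) (fun u => W u /\ near ((v^-1) $ o) u))|].
      - intros u hu hr. apply in_sel in hu as [hu _]. apply inW in hu as [_ hu].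
        destruct (Rle_dec (gromov ((u^-1) $ o) (v $ o) o) (600 * d)) as [a|a].
        + right. split; auto. left. unfold fwd. rewrite gromov_sym.
          destruct (Rle_dec (gromov ((v^-1) $ o) (u $ o) o) (600 * d)) as [b|b]; [exfalso; apply hr; split; auto|lra].
        + left. split; auto. right. unfold bwd. lra.
      - apply Nat.add_le_mono; (apply NoDup_incl_length; [apply NoDup_sel, NoDup_sel, NoDup_sel; auto|];
          intros u hu; apply in_sel in hu as [hu hr]; apply in_sel in hu as [hu _]; apply inW in hu as [hu _]; apply in_sel; auto). }
    pose proof (hs (v $ o) hvW) as s1. pose proof (hs ((v^-1) $ o)) as s2. rewrite len_inv in s2. specialize (s2 hvW). lia.
Qed.

(* Elements of small displacement [s] and one [v] of much larger displacement: [s] is recovered from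
   [s v t v ...] because [v] moves along the same geodesic. *)
Lemma concentrated_good (U : list G) v : NoDup U -> In v U -> 100000000000000 * kap <= len v ->
  (length U <= 100 * length (sel (fun u => (len u <= long kap)%R) U))%nat ->
  (length U <= 200 * mc)%nat \/ good U mc 200.
Proof.
  intros nU hv hlv hc. consts.
  set (D := long kap) in *. assert (eD : D = 100000000 * kap) by reflexivity.
  set (U' := sel (fun u => len u <= D) U) in *.
  destruct (geodesic_fun o (v $ o)) as [sg hsg]. rewrite (dist_sym _ o (v $ o)) in hsg. fold (len v) in hsg.
  assert (hgeo : forall u c, 0 <= c <= len v -> gromov (u $ o) ((u * v) $ o) (u $ sg c) = 0 /\
      dist (u $ o) (u $ sg c) = c /\ dist ((u * v) $ o) (u $ sg c) = len v - c).
  { intros u c hcc. destruct (hsg c hcc) as [a b]. rewrite act_mul, gromov_act, !act_dist.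
    repeat split; auto. apply (gromov_geo _ _ _ c); auto. rewrite (dist_sym _ o (v $ o)). exact b. }
  assert (hU' : forall u, In u U' -> In u U /\ len u <= D) by (intros u hu; apply in_sel in hu; auto).
  (* Discarded are the [u] for which [u v] starts in the direction of [v^-1 $ o]. They carry a piece
     of the segment to [v $ o] onto the geodesic to [v^-1 $ o], at places known up to [2 D], so
     [spot] leaves at most [mc] of them. *)
  set (S := sel (fun u => gromov ((v^-1) $ o) ((u * v) $ o) o <= 10 * D) U').
  assert (hex : (length (sel (fun u => ~ (gromov ((v^-1) $ o) ((u * v) $ o) o <= 10 * D)%R) U') <= mc)%nat).
  { destruct (hsg (3 * D) ltac:(lra)) as [a1 _]. destruct (hsg (3 * D + kap) ltac:(lra)) as [a2 _].
    apply (spot o ((v^-1) $ o) (sg (3 * D)) (sg (3 * D + kap)) (2 * d) (2 * D) (2 * D)); try lra.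
    - pose proof (dist_tri _ o (sg (3 * D)) (sg (3 * D + kap))). lra.
    - apply natceil_div.
    - apply NoDup_sel, NoDup_sel; auto.
    - intros u hu. apply in_sel in hu as [hu hbig]. apply Rnot_le_lt in hbig. apply hU' in hu as [_ hu].
      assert (key : forall c, 3 * D <= c <= 3 * D + kap -> gromov o ((v^-1) $ o) (u $ sg c) <= 2 * d).
      { intros c hcc. destruct (hgeo u c ltac:(lra)) as [g0 [g1 g2]].
        assert (c1 : gromov ((u * v) $ o) o (u $ sg c) <= d).
        { replace d with (0 + d) by lra. apply (hyp_cut _ (u $ o)); [rewrite gromov_sym; lra|].
          pose proof (gromov_lip (u $ o) o (u $ o) (u $ sg c)) as l. rewrite (gromov_sym o (u $ o)) in l.
          assert (e0 : gromov (u $ o) (u $ o) (u $ sg c) = dist (u $ o) (u $ sg c)) by (unfold gromov; rewrite dist_refl; lra).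
          fold (len u) in l. lra. }
        replace (2 * d) with (d + d) by lra. apply (hyp_cut _ ((u * v) $ o)); [rewrite gromov_sym; auto|].
        pose proof (gromov_lip_x ((v^-1) $ o) ((u * v) $ o) o (u $ sg c)) as l.
        pose proof (dist_tri _ o (u $ o) (u $ sg c)) as t. rewrite (dist_sym _ o (u $ o)) in t. fold (len u) in t.
        rewrite (gromov_sym ((u * v) $ o)). lra. }
      split; [apply key; lra|]. split; [apply key; lra|].
      destruct (hgeo u (3 * D) ltac:(lra)) as [_ [g1 _]].
      pose proof (dist_tri _ (u $ o) o (u $ sg (3 * D))) as t1. pose proof (dist_tri _ o (u $ o) (u $ sg (3 * D))) as t2.
      rewrite (dist_sym _ o (u $ sg (3 * D))) in t1, t2. rewrite (dist_sym _ o (u $ o)) in t2. rewrite g1 in t1, t2.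
      fold (len u) in t1, t2. lra. }
  pose proof (length_sel_split (fun u => gromov ((v^-1) $ o) ((u * v) $ o) o <= 10 * D) U') as sp. fold S in sp.
  destruct (Nat.le_gt_cases (length U') (2 * mc)) as [hsm|hlg]; [left; lia|right].
  assert (iS : forall s, In s S -> In s U /\ len s <= D /\ gromov ((v^-1) $ o) ((s * v) $ o) o <= 10 * D).
  { intros s hs. apply in_sel in hs as [hs h2]. apply hU' in hs as [h3 h4]. auto. }
  exists S, (fun _ _ => True), v. split; [apply NoDup_sel, NoDup_sel; auto|].
  split; [intros s hs; apply iS; auto|]. split; auto. split; [lia|]. split.
  { intros s _. rewrite sel_none; [simpl; lia|tauto]. }
  intros g P nP hP.
  assert (hPS : forall s, In s P -> In s S) by (intros s hs; destruct (hP s hs) as [t [l [[h1 _] _]]]; auto).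
  assert (word : forall s, In s P -> gromov o (g $ o) ((s * v) $ o) <= 12 * D).
  { intros s hs. destruct (hP s hs) as [t [l [hval eg]]]. apply valid_incl in hval.
    (* The word is read in the letters [s v], since [s] alone is too short for [linked]; the corner
       bound [10 D] of [S] grows to [11 D] by the displacement of [s]. The last letter has no [v]
       behind it and may be short. *)
    set (letters := fix letters (l : list G) : list G :=
       match l with [] => [] | s :: l' => match l' with [] => [s] | _ => (s * v)%g :: letters l' end end).
    assert (prl : forall l, prod_list (letters l) = sep v l).
    { induction l0 as [|s0 l0 IH]; [reflexivity|]. destruct l0 as [|t0 l0]; [apply gmul_1r|].
      change ((s0 * v) * prod_list (letters (t0 :: l0)) = s0 * (v * sep v (t0 :: l0)))%g. rewrite IH. grp. }
    assert (lk : forall l, incl l S -> linked o (11 * D) (letters l)).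
    { induction l0 as [|s0 l0 IH]; intros hi; [exact I|]. destruct l0 as [|t0 l0]; [exact I|].
      specialize (IH ltac:(intros x hx; apply hi; simpl; auto)).
      destruct (iS s0) as [_ [s1 s2]]; [apply hi; simpl; auto|]. destruct (iS t0) as [_ [t1 t2]]; [apply hi; simpl; auto|].
      assert (hd : dist (((s0 * v)^-1) $ o) ((v^-1) $ o) <= D).
      { rewrite ginv_mul, act_mul, act_dist, len_inv. exact s1. }
      change (letters (s0 :: t0 :: l0)) with ((s0 * v)%g :: letters (t0 :: l0)).
      destruct l0 as [|t' l0].
      - simpl. split; [|split; [congruence|exact I]].
        pose proof (gromov_le_r (((s0 * v)^-1) $ o) (t0 $ o) o) as l1. fold (len t0) in l1. lra.
      - change (letters (t0 :: t' :: l0)) with ((t0 * v)%g :: letters (t' :: l0)) in IH |- *.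
        split; [|split; [|exact IH]].
        + pose proof (gromov_lip (((s0 * v)^-1) $ o) ((v^-1) $ o) ((t0 * v) $ o) o). lra.
        + intros _. pose proof (dist_tri _ ((t0 * v) $ o) o (t0 $ o)) as tt1. rewrite (act_mul t0 v), act_dist in tt1.
          rewrite (dist_sym _ o (t0 $ o)) in tt1. rewrite act_mul. fold (len v) in tt1. fold (len t0) in tt1. lra. }
    specialize (lk (s :: t :: l) hval). specialize (prl (t :: l)).
    change (letters (s :: t :: l)) with ((s * v)%g :: letters (t :: l)) in lk.
    assert (e : exists a q, letters (t :: l) = a :: q) by (destruct l; simpl; eauto). destruct e as [a [q ea]].
    rewrite ea in lk, prl. apply linked_gromov in lk. rewrite prl in lk.
    rewrite gromov_act_x, <- eg. change (sep v (s :: t :: l)) with (s * (v * sep v (t :: l)))%g.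
    rewrite <- act_mul. replace ((s * v)^-1 * (s * (v * sep v (t :: l))))%g with (sep v (t :: l)) by grp. lra. }
  destruct (hsg (100 * D) ltac:(lra)) as [a1 _]. destruct (hsg (100 * D + kap) ltac:(lra)) as [a2 _].
  apply (spot o (g $ o) (sg (100 * D)) (sg (100 * D + kap)) (2 * d) (99 * D) (2 * D)); auto; try lra.
  - pose proof (dist_tri _ o (sg (100 * D)) (sg (100 * D + kap))). lra.
  - apply natceil_div.
  - intros s hs. destruct (iS s (hPS s hs)) as [_ [s1 s2]].
    assert (hso : gromov o (g $ o) (s $ o) <= 12 * D).
    { pose proof (gromov_le_l o (g $ o) (s $ o)) as l1. rewrite (dist_sym _ o (s $ o)) in l1. fold (len s) in l1. lra. }
    assert (key : forall c, 100 * D <= c <= 100 * D + kap -> gromov o (g $ o) (s $ sg c) <= 2 * d).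
    { intros c hcc. destruct (hgeo s c ltac:(lra)) as [g0 [g1 g2]].
      replace (2 * d) with (0 + 2 * d) by lra.
      apply (line_between o (g $ o) (s $ o) ((s * v) $ o) _ (12 * D) 0); auto; lra. }
    split; [apply key; lra|]. split; [apply key; lra|].
    destruct (hgeo s (100 * D) ltac:(lra)) as [_ [g1 _]].
    pose proof (dist_tri _ (s $ o) o (s $ sg (100 * D))) as t1. pose proof (dist_tri _ o (s $ o) (s $ sg (100 * D))) as t2.
    rewrite (dist_sym _ o (s $ sg (100 * D))) in t1, t2. rewrite (dist_sym _ o (s $ o)) in t2. rewrite g1 in t1, t2.
    fold (len s) in t1, t2. lra.
Qed.

End Energy.

(** * Constants and conclusion *)

Definition growth_mult (dl kp : R) (N : nat) : nat :=
  (light_bound dl kp N + coset_bound dl kp N + concentrated_bound dl kp N + 1)%nat.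
(** Dominates the losses of both cases, the diffuse one with [c1 = c2 = 100], and also the sizes
    below which [U] counts as small. *)
Definition growth_loss (dl kp : R) (N : nat) : nat :=
  (256 * 100 * 100 * (coset_bound dl kp N + 1) + 200 * concentrated_bound dl kp N + 200)%nat.

Lemma exists_displacement {G : Group} {X : MetricSpace} (act0 : G -> X -> X) U x0 r :
  0 < r -> r <= displacement act0 U x0 -> exists v, In v U /\ r <= dist (act0 v x0) x0.
Proof.
  unfold displacement. induction U as [|u U IH]; simpl; intros hr hd; [lra|].
  unfold Rmax in hd. destruct (Rle_dec _ _).
  - destruct (IH hr hd) as [v [h1 h2]]; eauto.
  - eauto.
Qed.

Lemma small_or_good {H : acyl_action} (U : list (grp H)) (o : spc H) : U <> [] -> NoDup U ->
  quasi_center (@act H) U (delta H) o -> 10 ^ 14 * kappa H <= displacement (@act H) U o ->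
  not_in_infinite_virtually_cyclic U ->
  (length U <= growth_loss (delta H) (kappa H) (acylN H))%nat \/
  good U (growth_mult (delta H) (kappa H) (acylN H)) (growth_loss (delta H) (kappa H) (acylN H)).
Proof.
  intros hU nU hq hd hvc. consts.
  set (A := coset_bound (delta H) (kappa H) (acylN H)). set (B := concentrated_bound (delta H) (kappa H) (acylN H)).
  set (L := light_bound (delta H) (kappa H) (acylN H)).
  assert (eM : growth_mult (delta H) (kappa H) (acylN H) = (L + A + B + 1)%nat) by reflexivity.
  assert (eC : growth_loss (delta H) (kappa H) (acylN H) = (256 * 100 * 100 * (A + 1) + 200 * B + 200)%nat) by reflexivity.
  destruct (Nat.le_gt_cases (length U) (100 * length (sel (fun u => (len o u <= long (kappa H))%R) U))) as [hc|hc].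
  - destruct (exists_displacement (@act H) U o (10 ^ 14 * kappa H)) as [v [hv hlv]]; [lra|lra|].
    destruct (concentrated_good o U v nU hv) as [h|h]; auto.
    + unfold len. lra.
    + left. fold B in h. lia.
    + right. apply (good_mono U B 200); auto; lia.
  - destruct (reduced_split o U hU nU hq) as [U0 [V [l [h1 [h2 [h3 [h4 [h5 [h6 [h7 h8]]]]]]]]]]; [lia|].
    destruct (diffuse_good o U U0 V l 100 100 hvc h1 h2 h3 h4 h5 h6 h7 h8) as [h|h].
    + left. fold A in h. lia.
    + right. refine (good_mono U _ _ _ _ _ _ h); fold A; fold L; lia.
Qed.

Lemma log2_ge1 (n : nat) : (1 <= n)%nat -> 1 <= log2 (2 * INR n).
Proof.
  intros hn. apply le_INR in hn. simpl in hn. unfold log2.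
  pose proof ln_lt_2. assert (0 < ln 2) by lra.
  apply (Rmult_le_reg_r (ln 2)); auto. unfold Rdiv. rewrite Rmult_assoc, Rinv_l by lra.
  rewrite Rmult_1_l, Rmult_1_r.
  destruct (Req_dec (INR n) 1) as [->|]; [rewrite Rmult_1_r; lra|].
  left. apply ln_increasing; lra.
Qed.

Theorem theorem1p14 :
  forall (delta kappa0 : R) (N0 : nat),
    0 < delta -> delta <= kappa0 -> (0 < N0)%nat ->
    exists alpha : R, 0 < alpha /\
      forall (G : Group) (X : MetricSpace) (act : G -> X -> X),
        geodesic_space X -> hyperbolic X delta ->
        isometric_action G X act -> acylindrical G X act delta kappa0 N0 ->
        forall (U : list G) (x0 : X),
          NoDup U ->
          quasi_center act U delta x0 ->
          displacement act U x0 >= 10 ^ 14 * kappa0 * log2 (2 * card U) ->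
          not_in_infinite_virtually_cyclic U ->
          card_ge (Upow U 3) ((alpha / (log2 (2 * card U)) ^ 6 * card U) ^ 2) /\
          (forall n : nat, (1 <= n)%nat ->
            card_ge (Upow U n)
              ((alpha / (log2 (2 * card U)) ^ 6 * card U) ^ Nat.div (n + 1) 2)).
Proof.
  intros delta kappa0 N0 hd hk _.
  set (M := growth_mult delta kappa0 N0). set (C := growth_loss delta kappa0 N0).
  assert (hM : (1 <= M)%nat) by (unfold M, growth_mult; lia).
  assert (hC : (1 <= C)%nat) by (unfold C, growth_loss; lia).
  set (D := INR (2 * M * C)).
  assert (hD : 1 <= D) by (apply (le_INR 1); nia).
  exists (/ D). split; [apply Rinv_0_lt_compat; lra|].
  intros G X act0 hgeo hhyp hiso hacyl U x0 nU hq hdisp hvc.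
  assert (main : forall n : nat, (1 <= n)%nat ->
    card_ge (Upow U n) ((/ D / (log2 (2 * card U)) ^ 6 * card U) ^ Nat.div (n + 1) 2)).
  2: { split; [exact (main 3%nat ltac:(lia))|exact main]. }
  intros n hn.
  (* For empty [U] the base is 0 and the exponent positive, so the bound is 0. *)
  destruct (classic (U = [])) as [hU|hU].
  - subst U. unfold card; simpl INR. rewrite Rmult_0_r.
    apply (card_ge_Upow [] n []); [constructor|simpl; tauto|].
    rewrite pow_i; [simpl; lra|]. apply Nat.div_str_pos. lia.
  - set (H := Build_acyl_action G X act0 delta kappa0 N0 hd hk hgeo hhyp hiso hacyl).
    assert (hN : (1 <= length U)%nat) by (destruct U; [congruence|simpl; lia]).
    pose proof (log2_ge1 _ hN) as hL. fold (card U) in hL.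
    set (L := log2 (2 * card U)) in *.
    assert (hcU : 1 <= card U) by (apply (le_INR 1); exact hN).
    assert (hL6 : 1 <= L ^ 6) by (apply pow_R1_Rle; exact hL).
    assert (hb : 0 <= / D / L ^ 6 * card U <= / D * card U).
    { assert (0 < / D) by (apply Rinv_0_lt_compat; lra).
      assert (hi : 0 < / L ^ 6) by (apply Rinv_0_lt_compat; lra).
      assert (/ L ^ 6 <= 1) by (rewrite <- Rinv_1; apply Rinv_le_contravar; lra).
      unfold Rdiv. split.
      - apply Rmult_le_pos; [apply Rmult_le_pos; lra|lra].
      - apply Rmult_le_compat_r; [lra|]. rewrite <- (Rmult_1_r (/ D)) at 2. apply Rmult_le_compat_l; lra. }
    assert (hdisp' : 10 ^ 14 * kappa0 <= displacement act0 U x0).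
    { apply Rge_le in hdisp. eapply Rle_trans; [|exact hdisp].
      rewrite <- (Rmult_1_r (10 ^ 14 * kappa0)) at 1. apply Rmult_le_compat_l; [|exact hL].
      apply Rmult_le_pos; [apply pow_le; lra|lra]. }
    destruct (@small_or_good H U x0 hU nU hq hdisp' hvc) as [hs|hg].
    (* Here [card U] is at most [C], hence at most [D], and the base is at most 1. *)
    + apply trivial_growth; auto. split; [lra|]. eapply Rle_trans; [apply hb|].
      apply (Rmult_le_reg_l D); [lra|]. rewrite <- Rmult_assoc, Rinv_r, Rmult_1_l, Rmult_1_r by lra.
      apply le_INR. simpl in hs. fold C in hs. nia.
    + apply (@good_growth G U M C); auto; [lra|]. fold D.
      replace (card U) with (/ D * card U * D) at 2 by (field; lra).
      apply Rmult_le_compat_r; lra.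
Qed.
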